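(* Let $R$ be an almost Dedekind domain which is SP-scattered, and let $\alpha$ be its SP-rank. Then \[ \mathrm{Inv}(R)\simeq\bigoplus_{i<\alpha}\mathcal{C}_c\big(\mathrm{Crit}_i(R)\setminus\mathrm{Crit}_{i+1}(R),\mathbb{Z}\big) \] as abelian groups; in particular, $\mathrm{Inv}(R)$ is a free abelian group.
   Context: An almost Dedekind domain is an integral domain $R$ such that $R_M$ is a discrete valuation ring for every maximal ideal $M$; let $K$ be its quotient field. $\mathrm{Inv}(R)$ is the group of invertible fractional ideals of $R$ under multiplication. $\mathcal{M}$ denotes $\mathrm{Max}(R)$ endowed with the inverse topology (the restriction to $\mathrm{Max}(R)$ of the coarsest topology on $\mathrm{Spec}(R)$ in which every Zariski-open Zariski-compact set is closed; on $\mathrm{Max}(R)$ it coincides with the constructible topology). Subsets of $\mathcal{M}$ carry the subspace topology. For a topological space $X$, $\mathcal{C}_c(X,\mathbb{Z})$ is the group (under pointwise addition) of continuous functions $X\to\mathbb{Z}$ ($\mathbb{Z}$ discrete) with compact support, the support being the closure of the set where the function is nonzero. A maximal ideal $M$ of an almost Dedekind domain $A$ is critical if for every finitely generated ideal $I\subseteq M$ there is a maximal ideal $N$ with $I\subseteq N^2$; $\mathrm{Crit}(A)$ is the set of critical maximal ideals. Define recursively for ordinals $\alpha$: $\mathrm{Crit}_0(R)=\mathrm{Max}(R)$, $T_0=R$; if $\alpha=\gamma+1$, $\mathrm{Crit}_\alpha(R)=\{P\in\mathrm{Max}(R)\mid PT_\gamma\in\mathrm{Crit}(T_\gamma)\}$;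 if $\alpha$ is a limit ordinal, $\mathrm{Crit}_\alpha(R)=\bigcap_{\gamma<\alpha}\mathrm{Crit}_\gamma(R)$; and $T_\alpha=\bigcap\{R_P\mid P\in\mathrm{Crit}_\alpha(R)\}$ (equal to $K$ if the set is empty; each $T_\alpha$ is again almost Dedekind). The SP-rank of $R$ is the least ordinal $\alpha$ with $\mathrm{Crit}_\alpha(R)=\mathrm{Crit}_{\alpha+1}(R)$; $R$ is SP-scattered if $\mathrm{Crit}_\alpha(R)=\emptyset$ for this $\alpha$. *)

(* Defs.v *)
From mathcomp Require Import all_boot all_order all_algebra.
From mathcomp Require Import boolp classical_sets.
Set Implicit Arguments. Unset Strict Implicit. Unset Printing Implicit Defensive.
Import Order.TTheory GRing.Theory Num.Theory.
Local Open Scope classical_set_scope.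
Local Open Scope ring_scope.
From Stdlib Require List.
Notation List_In := List.In.

(* Commutative algebra inside a fixed field K: all rings are subrings of K,  *)
(* all ideals / fractional ideals are subsets of K.                          *)
Section Alg.
Variable K : fieldType.

Definition subring (S : set K) : Prop :=
  S 1 /\ (forall x y, S x -> S y -> S (x - y)) /\ (forall x y, S x -> S y -> S (x * y)).

Definition quotient_field_of (R : set K) : Prop :=
  forall x : K, exists a b, R a /\ R b /\ b != 0 /\ x = a / b.

Definition sr_ideal (S I : set K) : Prop :=
  I `<=` S /\ I 0 /\ (forall x y, I x -> I y -> I (x + y)) /\
  (forall s x, S s -> I x -> I (s * x)).

Definition sr_prime (S P : set K) : Prop :=
  sr_ideal S P /\ P <> S /\ (forall a b, S a -> S b -> P (a * b) -> P a \/ P b).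

Definition sr_maximal (S M : set K) : Prop :=
  sr_ideal S M /\ M <> S /\
  (forall J, sr_ideal S J -> M `<=` J -> J = M \/ J = S).

Definition prod_set (I J : set K) : set K :=
  [set x | exists s : seq (K * K), (forall p, p \in s -> I p.1 /\ J p.2) /\
           x = \sum_(p <- s) p.1 * p.2].

Definition fg_ideal (S I : set K) : Prop :=
  exists s : seq K, (forall x, x \in s -> S x) /\
    I = [set x | exists c : seq K, (forall y, y \in c -> S y) /\ size c = size s /\
                 x = \sum_(i < size s) c`_i * s`_i].

Definition critical (S M : set K) : Prop :=
  sr_maximal S M /\
  forall I, fg_ideal S I -> I `<=` M -> exists N, sr_maximal S N /\ I `<=` prod_set N N.

Definition localization (R P : set K) : set K :=
  [set x | exists a b, R a /\ R b /\ ~ P b /\ x = a / b].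

Definition DVR (V : set K) : Prop :=
  exists v : K -> int,
    (forall x y, x != 0 -> y != 0 -> v (x * y) = v x + v y) /\
    (forall x y, x != 0 -> y != 0 -> x + y != 0 -> Num.min (v x) (v y) <= v (x + y)) /\
    (exists t, t != 0 /\ v t = 1) /\
    V = [set x | x = 0 \/ (x != 0 /\ 0 <= v x)].

Definition almost_dedekind (R : set K) : Prop :=
  subring R /\ quotient_field_of R /\
  forall M, sr_maximal R M -> DVR (localization R M).

Definition Spec (R : set K) : set (set K) := [set P | sr_prime R P].
Definition Max (R : set K) : set (set K) := [set M | sr_maximal R M].

(* T = intersection of the R_P, P in C (= K when C is empty) *)
Definition Tof (R : set K) (C : set (set K)) : set K :=
  [set x | forall P, C P -> localization R P x].

Definition crit_step (R : set K) (C : set (set K)) : set (set K) :=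
  [set P | sr_maximal R P /\ critical (Tof R C) (prod_set P (Tof R C))].

Definition frac_ideal (R J : set K) : Prop :=
  J 0 /\ (forall x y, J x -> J y -> J (x + y)) /\ (forall r x, R r -> J x -> J (r * x)) /\
  exists d, d != 0 /\ R d /\ forall x, J x -> R (d * x).

Definition Inv (R : set K) : set (set K) :=
  [set J | frac_ideal R J /\ exists J', frac_ideal R J' /\ prod_set J J' = R].

End Alg.

(* Elementary topology on subsets of a carrier type T, a topology being    *)
(* given by its family of open sets.                                        *)
Section Top.
Variable T : Type.

(* topology on X generated by the subbase Sb: opens are unions of finite
   intersections of members of Sb (the empty intersection being X) *)
Definition gen_topology (X : set T) (Sb : set (set T)) : set (set T) :=
  [set U | U `<=` X /\ forall x, U x -> exists s : seq (set T),
     (forall B, List_In B s -> Sb B) /\ X x /\ (forall B, List_In B s -> B x) /\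
     [set y | X y /\ forall B, List_In B s -> B y] `<=` U].

Definition subspace (op : set (set T)) (Y : set T) : set (set T) :=
  [set V | exists U, op U /\ V = U `&` Y].

Definition compact_in (op : set (set T)) (A : set T) : Prop :=
  forall F : set (set T), F `<=` op -> A `<=` [set x | exists U, F U /\ U x] ->
  exists s : seq (set T), (forall U, List_In U s -> F U) /\
    A `<=` [set x | exists U, List_In U s /\ U x].

Definition closure_in (op : set (set T)) (Y A : set T) : set T :=
  [set y | Y y /\ forall V, op V -> V y -> exists a, A a /\ V a].

Definition continuous_Z (op : set (set T)) (Y : set T) (f : T -> int) : Prop :=
  forall A : set int, op (Y `&` f @^-1` A).

(* C_c(Y, Z), functions represented as maps T -> int vanishing outside Y *)
Definition Cc (op : set (set T)) (Y : set T) : set (T -> int) :=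
  [set f | (forall x, ~ Y x -> f x = 0) /\ continuous_Z op Y f /\
           compact_in op (closure_in op Y [set y | Y y /\ f y != 0])].

End Top.

Definition zar_open (K : fieldType) (R : set K) (U : set (set K)) : Prop :=
  exists S, S `<=` R /\ U = [set P | sr_prime R P /\ ~ (S `<=` P)].

Definition inv_open (K : fieldType) (R : set K) : set (set (set K)) :=
  gen_topology (Spec R)
    [set Cl | exists U, zar_open R U /\ compact_in (zar_open R) U /\ Cl = Spec R `\` U].

Definition maxtop (K : fieldType) (R : set K) : set (set (set K)) :=
  subspace (inv_open R) (Max R).

(* Transfinite sequences indexed by a well-ordered type                     *)
Definition is_succ (d : Order.disp_t) (I : orderType d) (i j : I) : Prop :=
  (i < j)%O /\ forall k, ~ ((i < k)%O /\ (k < j)%O).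

(* C is the sequence (Crit_i(R))_i: successor and limit (incl. 0) clauses *)
Definition crit_seq (K : fieldType) (R : set K) (d : Order.disp_t) (I : orderType d)
    (C : I -> set (set K)) : Prop :=
  (forall i j, is_succ i j -> C j = crit_step R (C i)) /\
  (forall j, (forall i, ~ is_succ i j) ->
     C j = [set P | sr_maximal R P /\ forall i, (i < j)%O -> C i P]).

Definition crit_layer (K : fieldType) (d : Order.disp_t) (I : orderType d)
    (C : I -> set (set K)) (i : I) : set (set K) :=
  [set P | C i P /\ forall j, is_succ i j -> ~ C j P].

Definition dsum (d : Order.disp_t) (I : orderType d) (T : Type) (alpha : I)
    (G : I -> set (T -> int)) : set (I -> T -> int) :=
  [set f | (forall i, (i < alpha)%O -> G i (f i)) /\
           (forall i, ~ (i < alpha)%O -> f i = fun _ => 0) /\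
           exists s : seq I, forall i, f i <> (fun _ => 0) -> i \in s].

Definition dsum_add (I T : Type) (f g : I -> T -> int) : I -> T -> int :=
  fun i t => f i t + g i t.

Definition set_iso (A B : Type) (G : set A) (H : set B) (opA : A -> A -> A)
    (opB : B -> B -> B) (phi : A -> B) : Prop :=
  (forall x, G x -> H (phi x)) /\
  (forall x y, G x -> G y -> phi x = phi y -> x = y) /\
  (forall z, H z -> exists x, G x /\ phi x = z) /\
  (forall x y, G x -> G y -> phi (opA x y) = opB (phi x) (phi y)).

Definition free_abelian (A : Type) (G : set A) (op : A -> A -> A) : Prop :=
  exists (B : Type) (phi : A -> B -> int),
    set_iso G [set c : B -> int | exists s : seq B, forall b, c b != 0 -> List_In b s]
      op (fun c c' b => c b + c' b) phi.

(* Main.v *)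
From mathcomp Require Import all_boot all_order all_algebra.
From mathcomp Require Import boolp classical_sets functions wochoice filter.
From mathcomp Require Import zify ring.
Require Import Defs.
Set Implicit Arguments. Unset Strict Implicit. Unset Printing Implicit Defensive.
Import Order.TTheory GRing.Theory Num.Theory.
Local Open Scope classical_set_scope.
Local Open Scope ring_scope.

(** Write [v_M] for the normalized valuation of a maximal ideal [M].  An
    invertible fractional ideal [J] is determined by the function
    [nu_J : M |-> min v_M(J)], so [Inv R] is a group [G] of integer functions on
    [Max R], closed under pointwise minimum.  The sets [{g > 0}], for [g] in [G],
    form a basis of compact open sets of the inverse topology.  For [C] closed in
    [Max R] with [T = Tof R C], the maximal ideals of [T] are the [QT] for [Q] in
    [C], and [PT] is noncritical iff some [g] in [G] has [0 <= g <= 1] on [C] and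
    [g P = 1].

    Let [G_i] be the subgroup of the functions vanishing on [C i].  Compactness
    gives [G_j = U_(i<j) G_i] at limits, and restriction to [C i] identifies
    [G_(i+1) / G_i] with [C_c(C i \ C (i+1), Z)].  These quotients are free by a
    form of Nobeling's theorem, so the filtration splits.

    Nobeling's theorem is itself proved by a filtration.  Well-order the sets in
    question and let [F] be the field generated by those before [E].  Adjoining
    [E] enlarges the [F]-simple functions modulo an ideal [J] of negligible sets
    by a quotient isomorphic to the [F]-simple functions modulo another ideal
    [J'], so it suffices to induct with [J] arbitrary. *)

(** * Bases modulo a subgroup *)

Section Subgroups.
Variable A : zmodType.
Implicit Types (H N B : set A) (s : seq A) (c : A -> int).

(** No quotient group is formed: subgroups are sets inside an ambient group of integer functions,
    and freeness of a quotient means that some family is a basis modulo a subgroup. The ideal [J]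
    has to vary because [b * ind E] may be [F]-simple up to [J] without [b] being negligible; the
    functions [b] for which this happens are exactly the null functions of [J']. The constants,
    which are the simple functions of the trivial field, sit below the whole filtration and are
    treated separately. A layer is only locally compact, so the sets whose indicator lies in its
    group form a ring of sets, possibly without unit, whereas the induction is about fields of sets.
    A base point outside [Max R], where every function of [G] vanishes, repairs this: simple
    functions modulo constants become simple functions vanishing there. Freeness of the layers
    serves twice. It gives bases of the successive quotients, and it lets a basis be lifted to [G]
    and extended additively, so that restriction to each [C i] has an additive section; the sections
    yield the direct sum. *)

Definition sgrp H := H 0 /\ forall x y, H x -> H y -> H (x - y).

Lemma sgrpN H x : sgrp H -> H x -> H (- x).
Proof. by case=> H0 HB Hx; rewrite -[- x]add0r; exact: HB. Qed.

Lemma sgrpD H x y : sgrp H -> H x -> H y -> H (x + y).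
Proof.
by move=> sH Hx Hy; rewrite -[y]opprK; apply: sH.2 => //; exact: sgrpN.
Qed.

Lemma sgrpMz H x (n : int) : sgrp H -> H x -> H (x *~ n).
Proof.
move=> sH Hx; have HN (m : nat) : H (x *+ m).
  elim: m => [|m IH]; first by rewrite mulr0n; exact: sH.1.
  by rewrite mulrS; exact: sgrpD.
by case: n => m; [exact: HN | apply: sgrpN => //; exact: HN].
Qed.

Lemma sgrp_sum H (J : eqType) (r : seq J) (F : J -> A) : sgrp H ->
  (forall j, j \in r -> H (F j)) -> H (\sum_(j <- r) F j).
Proof.
move=> sH HF; rewrite big_seq; apply: (big_ind H) => //; first exact: sH.1.
by move=> x y; exact: sgrpD.
Qed.

Lemma sgrp1 : sgrp [set (0 : A)].
Proof. by split=> // x y -> ->; rewrite /= subr0. Qed.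

Definition lincomb s c := \sum_(b <- s) b *~ c b.

Definition zspan B := [set x | exists s c,
  [/\ uniq s, (forall b, b \in s -> B b) & x = lincomb s c]].

Lemma sum_widen (J : eqType) (V : zmodType) (s t : seq J) (F : J -> V) (c : J -> int) :
  uniq s -> uniq t -> {subset s <= t} ->
  \sum_(b <- s) F b *~ c b = \sum_(b <- t) F b *~ (if b \in s then c b else 0).
Proof.
move=> us ut st.
transitivity (\sum_(b <- t | b \in s) F b *~ c b).
  rewrite -[RHS]big_filter; apply: perm_big; apply: uniq_perm => //.
    exact: filter_uniq.
  move=> b; rewrite mem_filter; case bs: (b \in s) => //=.
  by rewrite st.
by rewrite big_mkcond; apply: eq_bigr => b _; case: ifP.
Qed.

Lemma lincomb_widen s t c : uniq s -> uniq t -> {subset s <= t} ->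
  lincomb s c = lincomb t (fun b => if b \in s then c b else 0).
Proof. exact: sum_widen. Qed.

Lemma zspan_gen B b : B b -> zspan B b.
Proof.
move=> Bb; exists [:: b], (fun=> 1); split=> //.
  by move=> x; rewrite inE => /eqP ->.
by rewrite /lincomb big_seq1 mulr1z.
Qed.

Lemma sgrp_zspan B : sgrp (zspan B).
Proof.
split.
  by exists [::], (fun=> 0); split=> //; rewrite /lincomb big_nil.
move=> x y [s [c [us sB ->]]] [t [e [ut tB ->]]].
set r := undup (s ++ t).
have ur : uniq r by exact: undup_uniq.
have sr : {subset s <= r} by move=> b bs; rewrite mem_undup mem_cat bs.
have tr : {subset t <= r} by move=> b bs; rewrite mem_undup mem_cat bs orbT.
exists r, (fun b => (if b \in s then c b else 0) - (if b \in t then e b else 0)).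
split=> //.
  by move=> b; rewrite mem_undup mem_cat => /orP[/sB|/tB].
rewrite (lincomb_widen _ us ur sr) (lincomb_widen _ ut ur tr) /lincomb -sumrB.
by apply: eq_bigr => b _; rewrite mulrzBr.
Qed.

Lemma sgrp_lincomb H s c : sgrp H -> (forall b, b \in s -> H b) ->
  H (lincomb s c).
Proof. by move=> sH HF; apply: sgrp_sum => // b /HF; exact: sgrpMz. Qed.

Lemma zspan_min B H : sgrp H -> B `<=` H -> zspan B `<=` H.
Proof.
move=> sH BH x [s [c [us sB ->]]].
by apply: sgrp_lincomb => // b /sB /BH.
Qed.

(** A basis of the image of [H] modulo [N], where [N] need not lie in [H]. Independence over
    duplicate-free lists forces distinct elements of [B] to have distinct classes. *)
Definition basis_mod N H B :=
  [/\ B `<=` H,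
      (forall x, H x -> exists2 y, zspan B y & N (x - y)) &
      (forall s c, uniq s -> (forall b, b \in s -> B b) -> N (lincomb s c) ->
         forall b, b \in s -> c b = 0)].

Definition free_mod N H := exists B, basis_mod N H B.

Definition addsg H N := [set x | exists h n, [/\ H h, N n & x = h + n]].

Lemma sgrp_addsg H N : sgrp H -> sgrp N -> sgrp (addsg H N).
Proof.
move=> sH sN; split; first by exists 0, 0; split; [exact: sH.1|exact: sN.1|rewrite addr0].
move=> _ _ [h [n [Hh Nn ->]]] [h' [n' [Hh' Nn' ->]]]; exists (h - h'), (n - n').
by split; [exact: sH.2|exact: sN.2|rewrite opprD addrACA].
Qed.

Lemma addsgl H N : sgrp N -> H `<=` addsg H N.
Proof. by move=> sN x Hx; exists x, 0; split=> //; [exact: sN.1|rewrite addr0]. Qed.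

Lemma addsgr H N : sgrp H -> N `<=` addsg H N.
Proof. by move=> sH x Hx; exists 0, x; split=> //; [exact: sH.1|rewrite add0r]. Qed.

Lemma addsgS H H' N : H `<=` H' -> addsg H N `<=` addsg H' N.
Proof. by move=> HH x [h [n [/HH ? ? ->]]]; exists h, n. Qed.

Lemma seq_has_max (S : eqType) (J : Type) (lt : J -> J -> Prop) (ix : S -> J)
    (s : seq S) x :
  (forall i j, [\/ i = j, lt i j | lt j i]) ->
  (forall i j k, lt i j -> lt j k -> lt i k) ->
  exists2 b, b \in x :: s & forall y, y \in x :: s -> ix y = ix b \/ lt (ix y) (ix b).
Proof.
move=> tot tr; elim: s x => [|z s IH] x.
  by exists x; [rewrite inE|move=> y; rewrite inE => /eqP ->; left].
have [b bs bmax] := IH z.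
case: (tot (ix x) (ix b)) => [e|l|l].
- exists b => [|y]; first by rewrite inE bs orbT.
  by rewrite inE => /orP[/eqP -> |]; [left|exact: bmax].
- exists b => [|y]; first by rewrite inE bs orbT.
  by rewrite inE => /orP[/eqP -> |]; [right|exact: bmax].
- exists x => [|y]; first by rewrite inE eqxx.
  rewrite inE => /orP[/eqP -> |/bmax [->|h]]; [by left|by right|right].
  exact: tr h l.
Qed.

(* Bases of the successive quotients assemble: in a linear relation modulo [N],
   the terms of largest index would form a relation modulo [L i]. *)
Lemma basis_mod_filtration (J : Type) (lt : J -> J -> Prop) (D : set J)
    (N H : set A) (L U B : J -> set A) :
  well_founded lt ->
  (forall i j, [\/ i = j, lt i j | lt j i]) ->
  (forall i j k, lt i j -> lt j k -> lt i k) ->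
  sgrp N -> (forall i, D i -> sgrp (L i)) -> sgrp H ->
  (forall i, D i -> N `<=` L i) -> (forall i, D i -> U i `<=` H) ->
  (forall i j, D i -> D j -> lt i j -> U i `<=` L j) ->
  (forall i x, D i -> L i x -> N x \/
     exists j u, [/\ D j, lt j i, U j u & N (x - u)]) ->
  (forall x, H x -> N x \/ exists j u, [/\ D j, U j u & N (x - u)]) ->
  (forall i, D i -> basis_mod (L i) (U i) (B i)) ->
  basis_mod N H [set b | exists2 i, D i & B i b].
Proof.
move=> wf tot tr sN sL sH NL UH UL LU HU bas.
set BB := [set b | _].
have spanN x y : zspan BB y -> (exists2 z, zspan BB z & N (x - y - z)) ->
    exists2 y, zspan BB y & N (x - y).
  move=> sy [z sz Nz]; exists (y + z); first exact: sgrpD (sgrp_zspan _) sy sz.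
  by rewrite opprD addrA.
(* Spanning is a descent: the remainder of [x] after reduction by [B i] lies in [L i], hence in [N]
   or, modulo [N], in some [U j] with [j] below [i]. *)
have spanU i x : D i -> U i x -> exists2 y, zspan BB y & N (x - y).
  move: x; elim/(well_founded_ind wf): i => i IH x Di Ux.
  have [_ /(_ x Ux) [y sy Ly] _] := bas i Di.
  have sy' : zspan BB y.
    by apply: zspan_min sy; [exact: sgrp_zspan|move=> b Bb; apply: zspan_gen; exists i].
  apply: (spanN _ y) => //.
  have [Ny|[j [u [Dj lji Uu Nu]]]] := LU i _ Di Ly.
    by exists 0; [exact: (sgrp_zspan _).1|rewrite subr0].
  have [z sz Nz] := IH j lji u Dj Uu; exists z => //.
  by rewrite -(subrK u (x - y)) -addrA; exact: sgrpD.
split.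
- by move=> b [i Di]; case: (bas i Di) => BU _ _ /BU /(UH i Di).
- move=> x /HU[Nx|[j [u [Dj Uu Nu]]]].
    by exists 0; [exact: (sgrp_zspan _).1|rewrite subr0].
  have [z sz Nz] := spanU j u Dj Uu; exists z => //.
  by rewrite -(subrK u x) -addrA; exact: sgrpD.
move=> s c us sB Ns b bs; apply/eqP/negP => /negP cb.
have [ix ixP] : {ix : A -> J & forall b, b \in s -> D (ix b) /\ B (ix b) b}.
  have [i0 _ _] := cid2 (sB b bs).
  apply: (@choice _ _ (fun b i => b \in s -> D i /\ B i b)) => a.
  have [/sB [i ? ?]|_] := boolP (a \in s); first by exists i.
  by exists i0.
set t := [seq b <- s | c b != 0].
have ut : uniq t by exact: filter_uniq.
have ts a : a \in t -> a \in s by rewrite mem_filter => /andP[].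
have et : lincomb s c = lincomb t c.
  rewrite /lincomb big_filter [RHS]big_mkcond; apply: eq_bigr => a _.
  by case: eqP => [->|//]; rewrite mulr0z.
have bt : b \in t by rewrite mem_filter cb.
case tE : t bt => [//|x t'] bt; rewrite -tE in bt.
have [b0] := seq_has_max ix t' x tot tr; rewrite -tE => b0t b0max.
set i0 := ix b0; have [Di0 _] := ixP b0 (ts _ b0t).
set t1 := [seq a <- t | `[< ix a = i0 >]].
have b01 : b0 \in t1 by rewrite mem_filter b0t andbT; apply/asboolP.
suff L1 : L i0 (lincomb t1 c).
  have [_ _ /(_ t1 c (filter_uniq _ ut) _ L1 b0 b01)] := bas i0 Di0.
  move=> cb0; have : c b0 = 0.
    apply: cb0 => a; rewrite mem_filter => /andP[/asboolP <- /ts /ixP []//].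
  by move: b0t; rewrite mem_filter => /andP[/eqP].
have -> : lincomb t1 c = lincomb t c - lincomb [seq a <- t | ~~ `[< ix a = i0 >]] c.
  apply/eqP; rewrite eq_sym subr_eq; apply/eqP.
  by rewrite /lincomb [LHS](bigID (fun a => `[< ix a = i0 >])) /= !big_filter.
apply: (sL _ Di0).2; first by rewrite -et; exact: NL.
apply: sgrp_lincomb; first exact: sL.
move=> a; rewrite mem_filter => /andP[/asboolP ne at_].
have [Da Ba] := ixP a (ts _ at_).
have [//|lta] := b0max a at_.
by apply: (UL _ _ Da Di0 lta); case: (bas _ Da) => BU _ _; exact: BU.
Qed.

Lemma basis_mod_span0 H B : sgrp H -> basis_mod [set 0] H B -> H = zspan B.
Proof.
move=> sH [BH sp _]; apply/seteqP; split; last exact: zspan_min.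
by move=> x /sp [y sy /= /eqP]; rewrite subr_eq0 => /eqP ->.
Qed.

(** The filtration with two steps, indexed by booleans with [false] below [true]. [L] may stick out
    of [H], but only by elements of [N]. *)
Lemma free_mod_trans N L H : sgrp N -> sgrp L -> sgrp H -> N `<=` L ->
  (forall x, L x -> exists2 y, H y & N (x - y)) ->
  free_mod N (L `&` H) -> free_mod L H -> free_mod N H.
Proof.
move=> sN sL sH NL LH [B1 b1] [B2 b2].
pose lt (a b : bool) := ~~ a /\ b.
exists [set b | exists2 i : bool, True & (if i then B2 else B1) b].
apply: (@basis_mod_filtration bool lt setT N H (fun i : bool => if i then L else N)
  (fun i : bool => if i then H else L `&` H)
  (fun i : bool => if i then B2 else B1)).
- have wff : Acc lt false by constructor => -[] [].
  case; last exact: wff.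
  constructor; case; last by move=> _; exact: wff.
  by case.
- by case; case; rewrite /lt; [constructor 1|constructor 3|constructor 2|constructor 1].
- by move=> i j k [ni _] [_ hk]; split.
- exact: sN.
- by case.
- exact: sH.
- by case=> _; [exact: NL|exact: subset_refl].
- by case=> _; [exact: subset_refl|move=> x []].
- by move=> i j _ _ [/negbTE -> ->] x [].
- case=> x _ /= Lx; last by left.
  right; have [y Hy Ny] := LH x Lx; exists false, y; split=> //=; split=> //.
  have -> : y = x - (x - y) by rewrite opprB addrC subrK.
  by apply: sL.2 => //; exact: NL.
- move=> x Hx; right; exists true, x; split=> //.
  by rewrite subrr; exact: sN.1.
- by case.
Qed.

End Subgroups.

(** * Additive maps defined on a subgroup *)

Section Additive.
Variables A A' : zmodType.
Implicit Types (H : set A) (f : A -> A').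

Definition additive_on H f := forall x y, H x -> H y -> f (x + y) = f x + f y.

Lemma additive_on0 H f : sgrp H -> additive_on H f -> f 0 = 0.
Proof.
by move=> sH /(_ 0 0 sH.1 sH.1); rewrite addr0 => /(congr1 (fun z => z - f 0));
  rewrite addrK subrr.
Qed.

Lemma additive_onB H f x y : sgrp H -> additive_on H f -> H x -> H y ->
  f (x - y) = f x - f y.
Proof.
move=> sH af Hx Hy; apply/eqP; rewrite eq_sym subr_eq; apply/eqP.
by rewrite -af ?subrK //; exact: sH.2.
Qed.

Lemma additive_onMz H f x (n : int) : sgrp H -> additive_on H f -> H x ->
  f (x *~ n) = f x *~ n.
Proof.
move=> sH af Hx; have fN (m : nat) : f (x *+ m) = f x *+ m.
  elim: m => [|m IH]; first by rewrite !mulr0n; exact: additive_on0 af.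
  rewrite !mulrS af ?IH //; exact: (sgrpMz (Posz m) sH Hx).
case: n => m; first exact: fN.
rewrite /intmul -sub0r (additive_onB sH af); first by rewrite fN (additive_on0 sH af) sub0r.
  exact: sH.1.
exact: (sgrpMz (Posz m.+1) sH Hx).
Qed.

Lemma additive_on_sum H f (J : eqType) (r : seq J) (F : J -> A) : sgrp H ->
  additive_on H f -> (forall j, j \in r -> H (F j)) ->
  f (\sum_(j <- r) F j) = \sum_(j <- r) f (F j).
Proof.
move=> sH af; elim: r => [|j r IH] HF.
  by rewrite !big_nil; exact: additive_on0 af.
have HF' i : i \in r -> H (F i) by move=> ir; apply: HF; rewrite inE ir orbT.
rewrite !big_cons af ?IH //; first by apply: HF; rewrite inE eqxx.
exact: sgrp_sum.
Qed.

(** The hypotheses say that [f] induces an isomorphism from [H] modulo [N] to [H'] modulo [N'], and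
    isomorphisms carry bases to bases. *)
Lemma basis_mod_push (N H B : set A) (N' H' : set A') f :
  sgrp H -> sgrp N' -> additive_on H f ->
  basis_mod N H B ->
  (forall x, H x -> H' (f x)) ->
  (forall x, H x -> N' (f x) <-> N x) ->
  (forall y, H' y -> exists2 x, H x & N' (y - f x)) ->
  basis_mod N' H' (f @` B).
Proof.
move=> sH sN' af [BH sp ind] fH fN fS; split.
- by move=> _ [b Bb <-]; apply: fH; exact: BH.
- move=> y /fS [x Hx Nx]; have [z sz Nz] := sp x Hx.
  have Hz : H z by exact: zspan_min sz.
  exists (f z).
    have [s [c [us sB ->]]] := sz.
    rewrite /lincomb (additive_on_sum sH af) => [|b bs]; last first.
      by apply: sgrpMz => //; apply: BH; exact: sB.
    apply: sgrp_sum; first exact: sgrp_zspan.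
    move=> b bs; rewrite (additive_onMz _ sH af); last by apply: BH; exact: sB.
    apply: sgrpMz; first exact: sgrp_zspan.
    by apply: zspan_gen; exists b => //; exact: sB.
  rewrite -(subrK (f x) y) -addrA; apply: sgrpD => //.
  by rewrite -(additive_onB sH af) //; apply/fN => //; exact: sH.2.
move=> s c us sB Ns b bs.
have [g gP] : {g : A' -> A & forall b, b \in s -> B (g b) /\ f (g b) = b}.
  apply: (@choice _ _ (fun b a => b \in s -> B a /\ f a = b)) => a.
  have [/sB [x Bx fx]|_] := boolP (a \in s); first by exists x.
  by exists 0.
have gB a : a \in map g s -> B a by move=> /mapP [x xs ->]; case: (gP x xs).
have ug : uniq (map g s).
  rewrite map_inj_in_uniq // => x y xs ys e.
  by rewrite -(gP x xs).2 -(gP y ys).2 e.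
have := ind (map g s) (c \o f) ug gB _ (g b) (map_f g bs).
rewrite /= (gP b bs).2; apply.
apply/fN; first by apply: sgrp_lincomb => // a /gB /BH.
rewrite /lincomb (additive_on_sum sH af) => [|a /gB /BH Ha]; last exact: sgrpMz.
rewrite big_map; congr N' : Ns; apply: eq_big_seq => a as_ /=.
rewrite (additive_onMz _ sH af); first by rewrite (gP a as_).2.
by apply: BH; case: (gP a as_).
Qed.

(** The universal property of a free abelian group. It produces both the additive sections of the
    layers and the coordinate map of a basis. *)
Lemma basis_extend (H B : set A) (l : A -> A') :
  sgrp H -> basis_mod [set 0] H B ->
  exists f, additive_on H f /\ (forall b, B b -> f b = l b).
Proof.
move=> sH bB; have HE := basis_mod_span0 sH bB; case: bB => BH _ ind.
have [r rP] : {r : A -> seq A * (A -> int) & forall x, H x ->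
    [/\ uniq (r x).1, (forall b, b \in (r x).1 -> B b) & x = lincomb (r x).1 (r x).2]}.
  apply: (@choice _ _ (fun x (p : seq A * (A -> int)) => H x ->
    [/\ uniq p.1, (forall b, b \in p.1 -> B b) & x = lincomb p.1 p.2])) => x.
  have [Hx|nHx] := pselect (H x); last by exists ([::], fun=> 0).
  by move: (Hx); rewrite HE => -[s [c [? ? ?]]]; exists (s, c).
pose f x := \sum_(b <- (r x).1) l b *~ (r x).2 b.
(* The chosen expression of [x] is immaterial: over a common support, the difference of two
   expressions is a relation, so the coefficients agree. *)
have fE x s c : H x -> uniq s -> (forall b, b \in s -> B b) -> x = lincomb s c ->
    f x = \sum_(b <- s) l b *~ c b.
  move=> Hx us sB xE; have [ur rB xE'] := rP x Hx.
  set t := (r x).1 in ur rB xE' *; set e := (r x).2 in xE' *.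
  set w := undup (s ++ t).
  have uw : uniq w by exact: undup_uniq.
  have sw : {subset s <= w} by move=> b bs; rewrite mem_undup mem_cat bs.
  have tw : {subset t <= w} by move=> b bs; rewrite mem_undup mem_cat bs orbT.
  have wB b : b \in w -> B b by rewrite mem_undup mem_cat => /orP[/sB|/rB].
  have wid (q : seq A) (k : A -> int) : uniq q -> {subset q <= w} ->
      \sum_(b <- q) l b *~ k b = \sum_(b <- w) l b *~ (if b \in q then k b else 0).
    by move=> uq qw; exact: sum_widen.
  rewrite /f -/t -/e (wid t) // (wid s) //.
  have z0 : lincomb w (fun b => (if b \in t then e b else 0) -
                                (if b \in s then c b else 0)) = 0.
    transitivity (lincomb w (fun b => if b \in t then e b else 0) -
                  lincomb w (fun b => if b \in s then c b else 0)).
      by rewrite /lincomb -sumrB; apply: eq_bigr => b _; rewrite mulrzBr.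
    by rewrite -(lincomb_widen e ur) // -(lincomb_widen c us) // -xE -xE' subrr.
  apply: eq_big_seq => b bw; congr (_ *~ _); apply/eqP; rewrite -subr_eq0.
  by rewrite (ind w _ uw wB z0 b bw).
exists f; split; last first.
  move=> b Bb; rewrite (fE b [:: b] (fun=> 1)) //.
  - by rewrite big_seq1 mulr1z.
  - exact: BH.
  - by move=> x; rewrite inE => /eqP ->.
  - by rewrite /lincomb big_seq1 mulr1z.
move=> x y Hx Hy; have [ux xB xE] := rP x Hx; have [uy yB yE] := rP y Hy.
set s := (r x).1 in ux xB xE; set t := (r y).1 in uy yB yE.
set w := undup (s ++ t).
have uw : uniq w by exact: undup_uniq.
have sw : {subset s <= w} by move=> b bs; rewrite mem_undup mem_cat bs.
have tw : {subset t <= w} by move=> b bs; rewrite mem_undup mem_cat bs orbT.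
have wB b : b \in w -> B b by rewrite mem_undup mem_cat => /orP[/xB|/yB].
set c := fun b => if b \in s then (r x).2 b else 0.
set e := fun b => if b \in t then (r y).2 b else 0.
have xE2 : x = lincomb w c by rewrite {1}xE; exact: lincomb_widen.
have yE2 : y = lincomb w e by rewrite {1}yE; exact: lincomb_widen.
rewrite (fE x w c) // (fE y w e) // (fE (x + y) w (fun b => c b + e b)) //.
- by rewrite -big_split; apply: eq_bigr => b _; rewrite mulrzDr.
- exact: sgrpD.
- by rewrite xE2 yE2 /lincomb -big_split; apply: eq_bigr => b _; rewrite mulrzDr.
Qed.

End Additive.

(** * Nobeling's theorem *)

Section SimpleFunctions.
Variable T : Type.
Implicit Types (E F J : set (set T)) (U V : set T) (f g : T -> int).

Definition ind U : T -> int := fun x => if `[< U x >] then 1 else 0.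

Lemma indT U x : U x -> ind U x = 1.
Proof. by move=> /asboolP; rewrite /ind => ->. Qed.

Lemma indF U x : ~ U x -> ind U x = 0.
Proof. by move=> /asboolPn; rewrite /ind => /negbTE ->. Qed.

Lemma ind_setC U : ind (~` U) = ind setT - ind U.
Proof.
apply/funext => x; rewrite /= -[LHS]/(ind _ x) -[RHS]/(ind setT x - ind U x).
rewrite (@indT setT) //.
by have [Ux|nUx] := pselect (U x); [rewrite (indT Ux) indF|rewrite (indF nUx) indT].
Qed.

Lemma ind_setI U V : ind (U `&` V) = ind U * ind V.
Proof.
apply/funext => x; rewrite -[LHS]/(ind _ x) -[RHS]/(ind U x * ind V x).
have [Ux|nUx] := pselect (U x); last by rewrite (indF nUx) mul0r indF // => -[].
rewrite (indT Ux) mul1r.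
by have [Vx|nVx] := pselect (V x); [rewrite (indT Vx) indT|rewrite (indF nVx) indF // => -[]].
Qed.

Inductive fgen E : set (set T) :=
| fgen_in U : E U -> fgen E U
| fgenT : fgen E setT
| fgenC U : fgen E U -> fgen E (~` U)
| fgenI U V : fgen E U -> fgen E V -> fgen E (U `&` V).

Lemma fgen0 E : fgen E set0.
Proof. by rewrite -setCT; apply: fgenC; exact: fgenT. Qed.

Lemma fgenU E U V : fgen E U -> fgen E V -> fgen E (U `|` V).
Proof. by move=> EU EV; rewrite -[_ `|` _]setCK setCU; apply: fgenC; apply: fgenI; exact: fgenC. Qed.

Lemma fgenS E E' : E `<=` E' -> fgen E `<=` fgen E'.
Proof.
move=> EE U; elim=> {U} [U /EE|| |]; first exact: fgen_in.
- exact: fgenT.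
- by move=> U _; exact: fgenC.
- by move=> U V _ ? _; exact: fgenI.
Qed.

Definition simp E := zspan [set ind U | U in fgen E].

Lemma sgrp_simp E : sgrp (simp E). Proof. exact: sgrp_zspan. Qed.

Lemma simp_ind E U : fgen E U -> simp E (ind U).
Proof. by move=> FU; apply: zspan_gen; exists U. Qed.

Lemma simpS E E' : E `<=` E' -> simp E `<=` simp E'.
Proof.
move=> EE; apply: zspan_min; first exact: sgrp_simp.
by move=> _ [U FU <-]; apply: simp_ind; exact: fgenS FU.
Qed.

Lemma simp_level E f : simp E f ->
  (exists s : seq int, forall x, f x \in s) /\ (forall n, fgen E [set x | f x = n]).
Proof.
set P := [set f | (exists s : seq int, forall x, f x \in s) /\
   (forall n, fgen E [set x | f x = n])].
apply: (@zspan_min _ _ P); last first.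
  move=> _ [U FU <-]; split.
    by exists [:: 0; 1] => x; rewrite /ind; case: ifP.
  move=> n; have [->|n1] := eqVneq n 1.
    suff -> : [set x | ind U x = 1] = U by [].
    apply/seteqP; split=> x /=; last exact: indT.
    by move=> h; apply/not_notP => /indF; rewrite h.
  have [->|n0] := eqVneq n 0.
    suff -> : [set x | ind U x = 0] = ~` U by exact: fgenC.
    apply/seteqP; split=> x /=; last exact: indF.
    by move=> + /indT => ->.
  suff -> : [set x | ind U x = n] = set0 by exact: fgen0.
  apply/seteqP; split=> x //=; rewrite /ind; case: ifP => _ h.
    by rewrite h eqxx in n1.
  by rewrite h eqxx in n0.
split.
  split; first by exists [:: 0] => x; rewrite inE.
  move=> n; have [->|n0] := eqVneq n 0.
    suff -> : [set x : T | (0 : T -> int) x = 0] = setT by exact: fgenT.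
    by apply/seteqP.
  suff -> : [set x : T | (0 : T -> int) x = n] = set0 by exact: fgen0.
  apply/seteqP; split=> x //= h.
  by move: n0; rewrite -h eqxx.
move=> f' g [[s sP] f'l] [[t tP] gl]; split.
  exists [seq a - b | a <- s, b <- t] => x.
  by apply/allpairsP; exists (f' x, g x); split; [exact: sP|exact: tP|].
move=> n.
have -> : [set x | (f' - g) x = n] =
    \big[setU/set0]_(a <- s) ([set x | f' x = a] `&` [set x | g x = a - n]).
  rewrite -bigcup_seq; apply/seteqP; split=> x /=.
    move=> <-; exists (f' x); first exact: sP.
    split=> //=; rewrite -[(f' - g) x]/(f' x - g x); lia.
  move=> [a _ [/= fa ga]]; rewrite -[(f' - g) x]/(f' x - g x); lia.
apply: (big_ind (fgen E)) => [|U V|a _]; [exact: fgen0|exact: fgenU|exact: fgenI].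
Qed.

Lemma simp_supp E f : simp E f -> fgen E [set x | f x != 0].
Proof.
move=> /simp_level [_ /(_ 0)] /fgenC; congr fgen.
by apply/seteqP; split=> x /= /eqP.
Qed.

Lemma simp_mul_ind E f V : fgen E V -> simp E f -> simp E (f * ind V).
Proof.
move=> FV; apply: (@zspan_min _ _ [set f | simp E (f * ind V)]).
  split; first by rewrite /= mul0r; exact: (sgrp_simp E).1.
  by move=> x y /= sx sy; rewrite mulrBl; exact: (sgrp_simp E).2.
by move=> _ [U FU <-]; rewrite /= -ind_setI; apply: simp_ind; exact: fgenI.
Qed.

(** A set generated by [E] and [V] equals some [U1] inside [V] and some [U2] outside, with both in
    the field of [E]; its indicator is [ind U2 + (ind U1 - ind U2) * ind V]. *)
Lemma simp_adjoin E V f : simp (E `|` [set V]) f ->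
  exists a b, [/\ simp E a, simp E b & f = b + a * ind V].
Proof.
pose P := [set f | exists a b, [/\ simp E a, simp E b & f = b + a * ind V]].
apply: (@zspan_min _ _ P).
  split; first by exists 0, 0; split; [exact: (sgrp_simp E).1|exact: (sgrp_simp E).1|rewrite mul0r addr0].
  move=> _ _ [a [b [sa sb ->]]] [a' [b' [sa' sb' ->]]]; exists (a - a'), (b - b').
  by split; [exact: (sgrp_simp E).2|exact: (sgrp_simp E).2|rewrite opprD mulrBl addrACA].
move=> _ [U FU <-].
have [U1 [U2 [F1 F2 ->]]] : exists U1 U2,
    [/\ fgen E U1, fgen E U2 & U = (U1 `&` V) `|` (U2 `\` V)].
  elim: FU => {U} [U [EU| ->]||U _|U U' _].
  - exists U, U; split; [exact: fgen_in|exact: fgen_in|].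
    by rewrite setIC setDE (setIC U (~` V)) -setIUl setUv setTI.
  - exists setT, set0; split; [exact: fgenT|exact: fgen0|].
    by rewrite setTI set0D setU0.
  - exists setT, setT; split; [exact: fgenT|exact: fgenT|].
    by rewrite setTI setTD setUv.
  - move=> [U1 [U2 [F1 F2 ->]]]; exists (~` U1), (~` U2); split; [exact: fgenC|exact: fgenC|].
    apply/seteqP; split=> x /=.
      by move=> h; have [Vx|nVx] := pselect (V x); [left|right]; split=> // Ux; apply: h; [left|right].
    by move=> [[nU Vx]|[nU Vx]] [[]|[]].
  - move=> [U1 [U2 [F1 F2 ->]]] _ [U1' [U2' [F1' F2' ->]]].
    exists (U1 `&` U1'), (U2 `&` U2'); split; [exact: fgenI|exact: fgenI|].
    apply/seteqP; split=> x /=.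
      by move=> [[[u v]|[u v]] [[u' v']|[u' v']]] //; [left|right].
    by move=> [[[u u'] v]|[[u u'] v]]; split; [left|left|right|right].
exists (ind U1 - ind U2), (ind U2); split; [|exact: simp_ind|].
  by apply: (sgrp_simp E).2; exact: simp_ind.
apply/funext => x; rewrite -[LHS]/(ind _ x).
rewrite -[RHS]/(ind U2 x + (ind U1 x - ind U2 x) * ind V x).
have [Vx|nVx] := pselect (V x).
  rewrite (indT Vx) mulr1 addrC subrK.
  by have [u|u] := pselect (U1 x); [rewrite (indT u) indT //; left|rewrite (indF u) indF // => -[[]|[]]].
rewrite (indF nVx) mulr0 addr0.
by have [u|u] := pselect (U2 x); [rewrite (indT u) indT //; right|rewrite (indF u) indF // => -[[]|[]]].
Qed.

Lemma fct_mulrzE f (n : int) x : (f *~ n) x = f x *~ n.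
Proof. by case: n => n; rewrite /intmul /= ?natmulfctE. Qed.

Lemma cst_ind (c : int) : cst c = ind setT *~ c :> (T -> int).
Proof. by apply/funext => x; rewrite fct_mulrzE indT // intz. Qed.

Lemma fgen_set0 U : fgen set0 U -> U = setT \/ U = set0.
Proof.
by elim=> {U} [//||U _ [->|->]|U V _ [->|->] _ [->|->]];
  rewrite ?setCT ?setC0 ?setTI ?set0I; auto.
Qed.

Lemma simp0P f : simp set0 f <-> exists c, f = cst c.
Proof.
split.
  apply: (@zspan_min _ _ [set f | exists c, f = cst c]).
    split; first by exists 0.
    by move=> _ _ [c ->] [d ->]; exists (c - d).
  move=> _ [U FU <-].
  have [->|->] := fgen_set0 FU.
  - by exists 1; apply/funext => x; exact: indT.
  - by exists 0; apply/funext => x; exact: indF.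
move=> [c ->]; rewrite cst_ind.
by apply: sgrpMz; [exact: sgrp_simp|apply: simp_ind; exact: fgenT].
Qed.

Definition set_ideal J :=
  [/\ J set0, (forall U V, J U -> J V -> J (U `|` V)) & (forall U V, U `<=` V -> J V -> J U)].

Definition null J := [set f : T -> int | J [set x | f x != 0]].

Lemma sgrp_null J : set_ideal J -> sgrp (null J).
Proof.
move=> [J0 JU JS]; split.
  by apply: JS J0 => x /eqP [].
move=> f g Jf Jg; apply: JS (JU _ _ Jf Jg) => x /=.
rewrite -[(f - g) x]/(f x - g x) => h.
by have [f0|] := eqVneq (f x) 0; [right; move: h; rewrite f0 sub0r oppr_eq0|left].
Qed.

(** The ideal generated by those members [U] of the field of [E] whose trace on [V] agrees modulo
    [J] with a member of that field. Its null functions form the kernel of multiplication by [ind V]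
    into the quotient by the old functions. *)
Definition trace_ideal J E V := [set W | exists U U',
  [/\ fgen E U, fgen E U', W `<=` U & J ((U `&` V) `\` U' `|` U' `\` (U `&` V))]].

Lemma set_ideal_trace J E V : set_ideal J -> set_ideal (trace_ideal J E V).
Proof.
move=> [J0 JU JS]; split.
- exists set0, set0; split=> //; [exact: fgen0|exact: fgen0|].
  by rewrite set0I !setD0 setU0.
- move=> W1 W2 [U1 [U1' [F1 F1' s1 j1]]] [U2 [U2' [F2 F2' s2 j2]]].
  exists (U1 `|` U2), (U1' `|` U2'); split; [exact: fgenU|exact: fgenU|exact: setUSS|].
  apply: JS (JU _ _ j1 j2) => x /=; tauto.
- move=> W1 W2 sW [U1 [U1' [F1 F1' s1 j1]]]; exists U1, U1'; split=> //.
  exact: subset_trans s1.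
Qed.

Lemma trace_idealP J E V b : set_ideal J -> simp E b ->
  addsg (simp E) (null J) (b * ind V) <-> null (trace_ideal J E V) b.
Proof.
move=> idJ sb; have [J0 JU JS] := idJ; split.
  move=> [g [n [sg Jn e]]].
  (* Off the support of [n] the functions [b * ind V] and [g] coincide, so their supports differ
     only inside a set of [J]. *)
  exists [set x | b x != 0], [set x | g x != 0].
  split=> //; [exact: simp_supp|exact: simp_supp|].
  apply: JS Jn => x /=.
  have := congr1 (fun h : T -> int => h x) e.
  rewrite -[(fun h => h x) (b * ind V)]/(b x * ind V x).
  rewrite -[(fun h => h x) (g + n)]/(g x + n x) => ex.
  move=> [[[bx Vx] /negP]|[gx nbV]].
    rewrite negbK => /eqP gx; move: ex; rewrite (indT Vx) mulr1 gx add0r => <-.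
    exact: bx.
  apply/eqP => nx; move: ex; rewrite nx addr0.
  have [Vx|nVx] := pselect (V x); last by rewrite (indF nVx) mulr0 => h; rewrite -h eqxx in gx.
  rewrite (indT Vx) mulr1 => bg; apply: nbV; split=> //.
  by rewrite bg.
move=> [U [U' [FU FU' sU jU]]].
(* Replacing [V] by [U'] changes the product only on the symmetric difference of [U'] and the trace
   of [U] on [V], because [b] vanishes off [U]. *)
exists (b * ind U'), (b * ind V - b * ind U'); split; last by rewrite addrC subrK.
  exact: simp_mul_ind.
apply: JS jU => x /=.
rewrite -[(_ - _) x]/(b x * ind V x - b x * ind U' x) => h.
have bx : b x != 0 by apply: contraNneq h => ->; rewrite !mul0r subrr.
have Ux := sU x bx.
have [Vx|nVx] := pselect (V x); have [Vx'|nVx'] := pselect (U' x).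
- by move: h; rewrite !indT // subrr eqxx.
- by left.
- by right; split=> // -[].
- by move: h; rewrite !indF // subrr eqxx.
Qed.

End SimpleFunctions.


Lemma well_order_exists (S : eqType) : exists lt : S -> S -> Prop,
  [/\ well_founded lt, (forall i j, [\/ i = j, lt i j | lt j i]) &
      (forall i j k, lt i j -> lt j k -> lt i k)].
Proof.
have [R woR] := well_ordering_principle S.
have woC : wo_chain R predT by exact: withinW.
have tot x y : R x y \/ R y x by apply/orP; exact: (wo_chainW woC).
have anti x y : R x y -> R y x -> x = y.
  by move=> h k; apply: (wo_chain_antisymmetric woC) => //; rewrite h k.
pose lt x y := R x y /\ x <> y; exists lt.
have min (A : set S) x : A x -> exists2 m, A m & forall y, A y -> ~ lt y m.
  move=> Ax; have [|m [[Am lm] _]] := woR [pred z | `[< A z >]].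
    by exists x; apply/asboolP.
  exists m; first exact/asboolP.
  move=> y Ay [Rym nym]; apply: nym; apply: anti => //.
  by apply: lm; apply/asboolP.
have tri i j : [\/ i = j, lt i j | lt j i].
  have [e|ne] := pselect (i = j); first by constructor 1.
  case: (tot i j) => h; [constructor 2|constructor 3]; split=> //.
  by move=> e; apply: ne.
split; [|exact: tri|].
  move=> x; apply/not_notP => nx.
  have [m nm mm] := min [set x | ~ Acc lt x] x nx.
  by apply: nm; constructor => y lym; apply/not_notP => /mm.
move=> i j k lij ljk; case: (tri i k) => // [e|lki].
  by case: lij ljk => Rij ne [Rjk _]; case: ne; apply: anti => //; rewrite e.
(* What remains is a cycle through [i], [j], [k], and a cycle has no minimal element. *)
have [m mA mm] := min [set x | [\/ x = i, x = j | x = k]] i (Or31 _ _ erefl).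
case: mA => e; rewrite e in mm.
- by case: (mm k (Or33 _ _ erefl)).
- by case: (mm i (Or31 _ _ erefl)).
- by case: (mm j (Or32 _ _ erefl)).
Qed.

(** * Transfinite induction over a well-ordered family of sets *)

Section Nobeling.
Variable T : Type.
Variables (lt : set T -> set T -> Prop) (BB : set (set T)).
Hypotheses (wf : well_founded lt) (tri : forall i j, [\/ i = j, lt i j | lt j i])
  (trans : forall i j k, lt i j -> lt j k -> lt i k).
Implicit Types (D J : set (set T)) (U V W : set T).

Let below V : set (set T) := [set U | BB U /\ lt U V].

(** A generated set involves finitely many generators. Either there are none, and the set is
    trivial, or [i] is the largest one. *)
Lemma fgen_below_cases D U :
  D `<=` BB -> (forall i j, D i -> BB j -> lt j i -> D j) -> fgen D U ->
  fgen set0 U \/ exists2 i, D i & fgen (below i `|` [set i]) U.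
Proof.
move=> DB Dd.
have mono i j : D i -> D j -> i = j \/ lt i j ->
    fgen (below i `|` [set i]) `<=` fgen (below j `|` [set j]).
  move=> Di Dj [->|lij]; first exact: subset_refl.
  apply: fgenS => W [[BW lW]| ->]; left; split=> //; last exact: DB.
  exact: trans lij.
have sub0 i : fgen set0 `<=` fgen (below i `|` [set i]) by apply: fgenS.
elim=> {U} [U DU||U _|U V _].
- by right; exists U => //; apply: fgen_in; right.
- by left; exact: fgenT.
- by move=> [h|[i Di h]]; [left; exact: fgenC|right; exists i => //; exact: fgenC].
move=> [hU|[i Di hU]] _ [hV|[j Dj hV]].
- by left; exact: fgenI.
- by right; exists j => //; apply: fgenI => //; exact: sub0.
- by right; exists i => //; apply: fgenI => //; exact: sub0.
- right; case: (tri i j) => lij.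
  + by exists j => //; apply: fgenI => //; apply: mono hU => //; left.
  + by exists j => //; apply: fgenI => //; apply: mono hU => //; right.
  + by exists i => //; apply: fgenI => //; apply: mono hV => //; right.
Qed.

Lemma simp_below_cases D f :
  D `<=` BB -> (forall i j, D i -> BB j -> lt j i -> D j) -> simp D f ->
  simp set0 f \/ exists2 i, D i & simp (below i `|` [set i]) f.
Proof.
move=> DB Dd.
have mono i j : D i -> D j -> i = j \/ lt i j ->
    simp (below i `|` [set i]) `<=` simp (below j `|` [set j]).
  move=> Di Dj [->|lij]; first exact: subset_refl.
  apply: simpS => W [[BW lW]| ->]; left; split=> //; last exact: DB.
  exact: trans lij.
have sub0 i : simp set0 `<=` simp (below i `|` [set i]) by apply: simpS.
pose P := [set f | simp set0 f \/ exists2 i, D i & simp (below i `|` [set i]) f].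
apply: (@zspan_min _ _ P).
  split; first by left; exact: (sgrp_simp _).1.
  move=> f' g [hU|[i Di hU]] [hV|[j Dj hV]].
  - by left; exact: (sgrp_simp _).2.
  - by right; exists j => //; apply: (sgrp_simp _).2 => //; exact: sub0.
  - by right; exists i => //; apply: (sgrp_simp _).2 => //; exact: sub0.
  - right; case: (tri i j) => lij.
    + by exists j => //; apply: (sgrp_simp _).2 => //; apply: mono hU => //; left.
    + by exists j => //; apply: (sgrp_simp _).2 => //; apply: mono hU => //; right.
    + by exists i => //; apply: (sgrp_simp _).2 => //; apply: mono hV => //; right.
move=> _ [U FU <-]; have [h|[i Di h]] := fgen_below_cases DB Dd FU.
  by left; exact: simp_ind.
by right; exists i => //; exact: simp_ind.
Qed.

(** Filter [simp D] by the largest generator used. The bottom of this filtration is the trivial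
    field, which is why freeness comes out modulo constants. *)
Lemma free_simp_mod_const D :
  D `<=` BB -> (forall i j, D i -> BB j -> lt j i -> D j) ->
  (forall i J, D i -> set_ideal J -> free_mod (null J) (simp (below i))) ->
  forall J, set_ideal J -> free_mod (addsg (simp set0) (null J)) (simp D).
Proof.
move=> DB Dd IH J idJ; have sJ := sgrp_null idJ.
have [B bB] : {B : set T -> set (T -> int) & forall i, D i ->
    basis_mod (addsg (simp (below i)) (null J)) (simp (below i `|` [set i])) (B i)}.
  apply: (@choice _ _ (fun i B => D i ->
    basis_mod (addsg (simp (below i)) (null J)) (simp (below i `|` [set i])) B)) => i.
  have [Di|nDi] := pselect (D i); last by exists set0.
  have [B' bB'] := IH i _ Di (set_ideal_trace (below i) i idJ).
  (* By [simp_adjoin] and [trace_idealP], multiplication by [ind i] identifies [simp (below i)]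
     modulo the null functions of the trace ideal with the new quotient; the induction hypothesis is
     used for that ideal rather than for [J]. *)
  exists ((fun b => b * ind i) @` B') => _.
  apply: (basis_mod_push _ _ _ bB').
  - exact: sgrp_simp.
  - by apply: sgrp_addsg => //; exact: sgrp_simp.
  - by move=> x y _ _; rewrite mulrDl.
  - move=> b sb; apply: simp_mul_ind; first by apply: fgen_in; right.
    by apply: simpS sb => W; left.
  - by move=> b sb; exact: trace_idealP.
  - move=> f /simp_adjoin [a [b [sa sb ->]]]; exists a => //.
    by rewrite addrK; exact: addsgl.
exists [set b | exists2 i, D i & B i b].
apply: (@basis_mod_filtration _ _ lt D (addsg (simp set0) (null J)) (simp D)
  (fun i => addsg (simp (below i)) (null J)) (fun i => simp (below i `|` [set i])) B) => //.
- by apply: sgrp_addsg => //; exact: sgrp_simp.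
- by move=> i _; apply: sgrp_addsg => //; exact: sgrp_simp.
- exact: sgrp_simp.
- by move=> i _; apply: addsgS; exact: simpS.
- by move=> i Di; apply: simpS => W [[BW lW]| ->] //; exact: Dd lW.
- move=> i j Di Dj lij f sf; apply: addsgl => //.
  apply: simpS sf => W [[BW lW]| ->]; split=> //; [exact: trans lij|exact: DB].
- move=> i x Di [h [n [sh Jn ->]]].
  have [||h0|[j [Bj lj] sj]] := simp_below_cases _ _ sh.
  + by move=> W [].
  + by move=> k j [_ lk] Bj ljk; split=> //; exact: trans lk.
  + by left; exists h, n.
  + right; exists j, h; split=> //; first exact: Dd lj.
    by rewrite addrC addKr; apply: addsgr => //; exact: sgrp_simp.
- move=> x /(simp_below_cases DB Dd) [x0|[i Di xi]].
    by left; exact: addsgl.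
  right; exists i, x; split=> //; rewrite subrr.
  by apply: (sgrp_addsg _ _).1 => //; exact: sgrp_simp.
Qed.

(** The induction proper: the constants are put back below the filtration of
    [free_simp_mod_const]. *)
Lemma free_simp_below i J : set_ideal J -> free_mod (null J) (simp (below i)).
Proof.
move: J; elim/(well_founded_ind wf): i => i IH J idJ; have sJ := sgrp_null idJ.
apply: (@free_mod_trans _ _ (addsg (simp set0) (null J))) => //.
- by apply: sgrp_addsg => //; exact: sgrp_simp.
- exact: sgrp_simp.
- by apply: addsgr; exact: sgrp_simp.
- move=> _ [h [n [sh Jn ->]]]; exists h; first by apply: simpS sh.
  by rewrite addrC addKr.
(* If [setT] is negligible every function is null and the empty basis serves. Otherwise no nonzero
   constant is null, since its support is [setT], and [ind setT] is a basis of the constants. *)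
- have [JT|nJT] := pselect (J setT).
    exists set0; split=> [//|x _|[|b s] c us sB _ a //]; last first.
      by case: (sB b); rewrite inE eqxx.
    exists 0; first exact: (sgrp_zspan _).1.
    by case: idJ => _ _; apply; [|exact: JT].
  exists [set ind setT]; split.
  + move=> _ ->; split; last by apply: simp_ind; exact: fgenT.
    by apply: addsgl => //; apply: simp_ind; exact: fgenT.
  + move=> _ [[h [n [sh Jn ->]]] _]; exists h; last by rewrite addrC addKr.
    have [c ->] := (simp0P h).1 sh; rewrite cst_ind.
    by apply: sgrpMz; [exact: sgrp_zspan|exact: zspan_gen].
  + move=> s c us sB Js b bs.
    apply/eqP/negP => /negP cb; apply: nJT.
    have sE : s = [:: ind setT].
      case: s us sB bs {Js} => [//|a [|a' s]] us sB _.
        by rewrite (sB a) ?inE ?eqxx.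
      by move: us; rewrite /= (sB a) ?inE ?eqxx // (sB a') ?inE ?eqxx ?orbT.
    have bE : b = ind setT by exact: (sB b bs).
    case: idJ => _ _; apply; last exact: Js.
    move=> x _ /=; rewrite sE /lincomb big_seq1 -bE fct_mulrzE bE indT // intz.
    by rewrite -bE.
- apply: free_simp_mod_const => //.
  + by move=> W [].
  + by move=> k j [_ lk] Bj ljk; split=> //; exact: trans lk.
  + by move=> j J' [Bj lj] idJ'; exact: IH.
Qed.

End Nobeling.

(** The sets with indicator in [Q] form a ring of sets avoiding [p]. Subtracting the value at [p]
    identifies the simple functions of the field they generate, modulo constants, with [Q]. The
    ideal used is the trivial one, whose only null function is 0. *)
Lemma free_indicator_span (T : Type) (p : T) (Q : set (T -> int)) :
  sgrp Q -> (forall f, Q f -> f p = 0) ->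
  (forall U V, Q (ind U) -> Q (ind V) -> Q (ind (U `&` V))) ->
  Q `<=` zspan [set ind U | U in [set U | Q (ind U)]] ->
  free_mod [set 0] Q.
Proof.
move=> sQ Qp QI Qspan; set BB := [set U | Q (ind U)].
have [lt [wf tri tr]] := well_order_exists (set T : eqType).
have id0 : set_ideal [set (set0 : set T)].
  split=> // [U V -> ->|U V UV e]; first by rewrite /= setU0.
  by rewrite /= -subset0 -e.
have [B bB] : free_mod (addsg (simp set0) (null [set set0])) (simp BB).
  apply: (@free_simp_mod_const T lt BB wf tri tr) => //.
  by move=> i J _ idJ; exact: free_simp_below.
(* Passing from the ring to the field adds nothing but complements. *)
have gB U : fgen BB U -> BB U \/ BB (~` U).
  have QD U' V : Q (ind U') -> Q (ind V) -> Q (ind (U' `&` ~` V)).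
    move=> QU QV; have -> : ind (U' `&` ~` V) = ind U' - ind (U' `&` V).
      by rewrite ind_setI ind_setC mulrBr -!ind_setI setIT.
    by apply: sQ.2 => //; exact: QI.
  elim=> {U} [U BU||U _ [h|h]|U V _ hU _ hV].
  - by left.
  - right; rewrite setCT /BB /=; have -> : ind set0 = 0 :> (T -> int).
      by apply/funext => x; exact: indF.
    exact: sQ.1.
  - by right; rewrite setCK.
  - by left.
  case: hU hV => [hU|hU] [hV|hV].
  - by left; exact: QI.
  - by left; rewrite -[V]setCK; exact: QD.
  - by left; rewrite setIC -[U]setCK; exact: QD.
  - right; rewrite setCI /BB /=.
    have -> : ind (~` U `|` ~` V) = ind (~` U) + ind (~` V `&` ~` ~` U).
      apply/funext => x; rewrite -[RHS]/(ind (~` U) x + ind (~` V `&` ~` ~` U) x).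
      have [Ux|nUx] := pselect (U x); last first.
        by rewrite (@indT _ (~` U) x) // indT ?indF ?addr0 //; [move=> [_]|left].
      rewrite (@indF _ (~` U) x) // add0r.
      by have [Vx|nVx] := pselect (V x);
        [rewrite !indF // => -[]|rewrite !indT //; [split=> //|right]].
    by apply: sgrpD => //; exact: QD.
pose f (h : T -> int) := h - cst (h p).
have fD : additive_on (simp BB) f.
  move=> x y _ _; apply/funext => t.
  rewrite -[LHS]/(x t + y t - (x p + y p)) -[RHS]/(x t - x p + (y t - y p)).
  by rewrite opprD addrACA.
have fQ h : simp BB h -> Q (f h).
  apply: (@zspan_min _ _ [set h | Q (f h)]).
    split.
      rewrite /= /f; have -> : (0 : T -> int) - cst ((0 : T -> int) p) = 0.
        by apply/funext => t; exact: subrr.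
      exact: sQ.1.
    move=> x y /= Qx Qy; have -> : f (x - y) = f x - f y; last exact: sQ.2.
    apply/funext => t.
    rewrite -[LHS]/(x t - y t - (x p - y p)) -[RHS]/(x t - x p - (y t - y p)).
    by rewrite !opprD !opprK addrACA.
  move=> _ [U /gB [QU|QU] <-] /=.
    rewrite /f (Qp _ QU); have -> : ind U - cst 0 = ind U; last exact: QU.
    by apply/funext => t; exact: subr0.
  have -> : f (ind U) = - ind (~` U); last exact: sgrpN.
  apply/funext => t; rewrite -[LHS]/(ind U t - ind U p) -[RHS]/(- ind (~` U) t).
  have := Qp _ QU; rewrite ind_setC -[(_ - _) p]/(ind setT p - ind U p).
  rewrite -[(_ - _) t]/(ind setT t - ind U t) !(@indT _ setT) // => /eqP.
  by rewrite subr_eq0 => /eqP <-; rewrite opprB.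
exists (f @` B); apply: (basis_mod_push _ _ fD bB) => //.
- exact: sgrp_simp.
- exact: sgrp1.
- move=> h sh; split.
    move=> /= fh; apply: addsgl; first exact: sgrp_null.
    by apply/simp0P; exists (h p); apply/eqP; rewrite -subr_eq0; apply/eqP.
  move=> [g [n [/simp0P [c ->] n0 ->]]] /=.
  have -> : n = 0.
    apply/funext => t; apply/eqP/negP => /negP nt.
    have : [set x | n x != 0] t by [].
    by rewrite n0.
  by apply/funext => t; exact: subrr.
- move=> y Qy; exists y.
    move: Qy => /Qspan; apply: zspan_min; first exact: sgrp_simp.
    by move=> _ [U QU <-]; apply: simp_ind; exact: fgen_in.
  by rewrite /f (Qp _ Qy); apply/funext => t; rewrite -[LHS]/(y t - (y t - 0)) subr0 subrr.
Qed.

(** * Valuations and invertible ideals *)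

Section Ideals.
Variable K : fieldType.
Implicit Types (S I J M : set K).

Lemma subring0 S : subring S -> S 0.
Proof. by case=> S1 [SB _]; rewrite -(subrr 1); exact: SB. Qed.

Lemma subringD S x y : subring S -> S x -> S y -> S (x + y).
Proof.
move=> sS Sx Sy; have [_ [SB _]] := sS; rewrite -[y]opprK -[- y]add0r.
by apply: (SB) => //; apply: (SB) => //; exact: subring0.
Qed.

Lemma sr_ideal_addsg S I J : sr_ideal S I -> sr_ideal S J -> subring S ->
  sr_ideal S (addsg I J).
Proof.
move=> [IS [I0 [ID IM]]] [JS [J0 [JD JM]]] sS; split.
  by move=> _ [a [b [/IS ? /JS ? ->]]]; exact: subringD.
split; first by exists 0, 0; rewrite addr0.
split; first move=> _ _ [a [b [Ia Jb ->]]] [a' [b' [Ia' Jb' ->]]].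
  by exists (a + a'), (b + b'); split; [exact: ID|exact: JD|rewrite addrACA].
move=> s _ Ss [a [b [Ia Jb ->]]]; exists (s * a), (s * b).
by split; [exact: IM|exact: JM|rewrite mulrDr].
Qed.

Lemma krull S I : subring S -> sr_ideal S I -> ~ I 1 ->
  exists2 M, sr_maximal S M & I `<=` M.
Proof.
move=> sS idI nI1.
pose P := [set J : set K | J = set0 \/ [/\ sr_ideal S J, I `<=` J & ~ J 1]].
have [|A [PA maxA]] := @Zorn_bigcup _ P.
  move=> F FP totF.
  have [[J0 FJ0 [idJ0 IJ0 nJ01]]|nex] := pselect (exists2 J, F J &
      [/\ sr_ideal S J, I `<=` J & ~ J 1]); last first.
    left; apply/seteqP; split=> // x [J FJ Jx].
    by have [e|h] := FP J FJ; [rewrite e in Jx|case: nex; exists J].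
  right; split; last 2 first.
  - by move=> x /IJ0 J0x; exists J0.
  - by move=> [J FJ J1]; have [e|[_ _]] := FP J FJ; [rewrite e in J1|].
  have FI J x : F J -> J x -> sr_ideal S J.
    by move=> FJ Jx; have [e|[]] := FP J FJ; [rewrite e in Jx|].
  split; [|split; [|split]].
  - by move=> x [J FJ Jx]; have [JS _] := FI J x FJ Jx; exact: JS.
  - by exists J0 => //; case: idJ0 => _ [].
  - move=> x y [J FJ Jx] [J' FJ' J'y].
    have [_ [_ [JD _]]] := FI J x FJ Jx; have [_ [_ [J'D _]]] := FI J' y FJ' J'y.
    have [JJ|JJ] := totF J J' FJ FJ'.
      by exists J' => //; apply: J'D => //; exact: JJ.
    by exists J => //; apply: JD => //; exact: JJ.
  - move=> s x Ss [J FJ Jx]; exists J => //.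
    by have [_ [_ [_]]] := FI J x FJ Jx; apply.
case: PA => [A0|[idA IA nA1]].
  exfalso; apply: (maxA I); last by right; split.
  rewrite A0 properEneq; split; last exact: sub0set.
  have [_ [I0 _]] := idI.
  by apply/eqP => e; rewrite -e in I0.
exists A => //; split=> //; split; first by move=> e; apply: nA1; rewrite e; case: sS.
move=> J idJ AJ.
have [J1|nJ1] := pselect (J 1).
  right; apply/seteqP; split; first by case: idJ.
  by move=> x Sx; rewrite -[x]mulr1; case: idJ => _ [_ [_]]; apply.
left; apply/seteqP; split=> //; apply/not_notP => nJA.
by apply: (maxA J); [split|right; split=> //; exact: subset_trans IA AJ].
Qed.

Lemma sr_maximal_comax S M a : subring S -> sr_maximal S M -> S a -> ~ M a ->
  exists c m, [/\ S c, M m & 1 = c * a + m].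
Proof.
move=> sS [idM [_ maxM]] Sa nMa; have [SM [M0 [MD MM]]] := idM.
pose Ja := [set x | exists2 c, S c & x = c * a].
have idJ : sr_ideal S Ja.
  split; first by move=> _ [c Sc ->]; case: sS => _ [_]; apply.
  split; first by exists 0; [exact: subring0|rewrite mul0r].
  split; first by move=> _ _ [c Sc ->] [c' Sc' ->]; exists (c + c'); [exact: subringD|rewrite mulrDl].
  by move=> s _ Ss [c Sc ->]; exists (s * c); [case: sS => _ [_]; apply|rewrite mulrA].
have Ja_a : Ja a by exists 1; [case: sS|rewrite mul1r].
have [|e|e] := maxM _ (sr_ideal_addsg idJ idM sS).
- by move=> m Mm; exists 0, m; split=> //; [exists 0; [exact: subring0|rewrite mul0r]|rewrite add0r].
- by exfalso; apply: nMa; rewrite -e; exists a, 0; rewrite addr0.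
- have : addsg Ja M 1 by rewrite e; case: sS.
  by move=> [_ [m [[c Sc ->] Mm ->]]]; exists c, m.
Qed.

Lemma sr_maximal_prime S M : subring S -> sr_maximal S M -> sr_prime S M.
Proof.
move=> sS mM; have [idM [MS _]] := mM; split=> //; split=> // a b Sa Sb Mab.
have [Ma|nMa] := pselect (M a); [by left|right].
have [c [m [Sc Mm e]]] := sr_maximal_comax sS mM Sa nMa.
have [_ [_ [MD MM]]] := idM.
by rewrite -[b]mul1r e mulrDl; apply: MD; [rewrite -mulrA; exact: MM|rewrite mulrC; exact: MM].
Qed.

Lemma sr_ideal_proper S I : subring S -> sr_ideal S I -> I <> S -> ~ I 1.
Proof.
move=> sS idI nIS I1; apply: nIS; apply/seteqP; split; first by case: idI.
by move=> x Sx; rewrite -[x]mulr1; case: idI => _ [_ [_]]; apply.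
Qed.

Lemma prod_set_min (P I J : set K) : P 0 -> (forall x y, P x -> P y -> P (x + y)) ->
  (forall a b, I a -> J b -> P (a * b)) -> prod_set I J `<=` P.
Proof.
move=> P0 PD PM x [s [sIJ ->]]; rewrite big_seq.
by apply: (big_ind P) => // p /sIJ [? ?]; exact: PM.
Qed.

Lemma prod_set_mul I J a b : I a -> J b -> prod_set I J (a * b).
Proof.
move=> Ia Jb; exists [:: (a, b)]; split; last by rewrite big_seq1.
by move=> p; rewrite inE => /eqP ->.
Qed.

Lemma prod_set0 I J : prod_set I J 0.
Proof. by exists [::]; split=> //; rewrite big_nil. Qed.

Lemma prod_setD I J x y : prod_set I J x -> prod_set I J y -> prod_set I J (x + y).
Proof.
move=> [s [sP ->]] [t [tP ->]]; exists (s ++ t); split; last by rewrite big_cat.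
by move=> p; rewrite mem_cat => /orP[/sP|/tP].
Qed.

Lemma prod_setC I J : prod_set I J = prod_set J I.
Proof.
by apply/seteqP; split; apply: prod_set_min => [||a b Ia Jb];
  [exact: prod_set0|exact: prod_setD|rewrite mulrC; exact: prod_set_mul
  |exact: prod_set0|exact: prod_setD|rewrite mulrC; exact: prod_set_mul].
Qed.

Lemma prod_set_scale I J s x : (forall a, I a -> I (s * a)) ->
  prod_set I J x -> prod_set I J (s * x).
Proof.
move=> Is; move: x; apply: (@prod_set_min [set x | prod_set I J (s * x)]) => /=.
- by rewrite mulr0; exact: prod_set0.
- by move=> x y; rewrite mulrDr; exact: prod_setD.
- by move=> a b Ia Jb; rewrite mulrA; apply: prod_set_mul => //; exact: Is.
Qed.

Lemma prod_set_nonzero I J : prod_set I J 1 -> exists2 x, I x & x != 0.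
Proof.
move=> h1; apply/not_notP => nex.
suff : (1 : K) = 0 by apply/eqP; exact: oner_neq0.
move: h1; apply: (@prod_set_min [set 0]) => //=.
  by move=> x y -> ->; rewrite addr0.
move=> a b Ia _; have [->|a0] := eqVneq a 0; first by rewrite mul0r.
by case: nex; exists a.
Qed.

End Ideals.

(** * Valuations and the function attached to an invertible ideal *)

Section Valuations.
Variable K : fieldType.
Variables (R : set K) (v : set K -> K -> int).
Implicit Types (M N J : set K).

Definition local_vals := forall M, sr_maximal R M ->
  [/\ (forall x y, x != 0 -> y != 0 -> v M (x * y) = v M x + v M y),
      (forall x y, x != 0 -> y != 0 -> x + y != 0 ->
         Num.min (v M x) (v M y) <= v M (x + y)),
      (exists t, t != 0 /\ v M t = 1) &
      localization R M = [set x | x = 0 \/ (x != 0 /\ 0 <= v M x)]].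

(** [local_vals] prescribes nothing about the value at 0; this relation treats it as infinite. *)
Definition vge M x (n : int) := x = 0 \/ n <= v M x.

Hypotheses (sR : subring R) (qR : quotient_field_of R) (vR : local_vals).

Lemma vge_le M x m n : m <= n -> vge M x n -> vge M x m.
Proof. by move=> mn [->|h]; [left|right; exact: le_trans h]. Qed.

Lemma vgeN0 M x n : x != 0 -> vge M x n -> n <= v M x.
Proof. by move=> x0 [e|//]; rewrite e eqxx in x0. Qed.

Section OnePrime.
Variables (M : set K) (mM : sr_maximal R M).

Lemma valM x y : x != 0 -> y != 0 -> v M (x * y) = v M x + v M y.
Proof. by case: (vR mM) => h _ _ _; exact: h. Qed.

Lemma val1 : v M 1 = 0.
Proof.
have n1 : (1 : K) != 0 by exact: oner_neq0.
by have := valM n1 n1; rewrite mulr1; lia.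
Qed.

Lemma valV x : x != 0 -> v M x^-1 = - v M x.
Proof.
move=> x0; have := valM x0 (invr_neq0 x0); rewrite divff // val1; lia.
Qed.

Lemma valX x n : x != 0 -> v M (x ^+ n) = v M x *+ n.
Proof.
move=> x0; elim: n => [|n IH]; first by rewrite expr0 val1.
by rewrite exprS valM ?expf_neq0 // IH mulrS.
Qed.

Lemma vgeD x y n : vge M x n -> vge M y n -> vge M (x + y) n.
Proof.
move=> hx hy; have [->|x0] := eqVneq x 0; first by rewrite add0r.
have [->|y0] := eqVneq y 0; first by rewrite addr0.
have [|s0] := eqVneq (x + y) 0; [by left|right].
case: (vR mM) => _ /(_ x y x0 y0 s0) h _ _; apply: le_trans h.
by rewrite le_min (vgeN0 x0 hx) (vgeN0 y0 hy).
Qed.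

Lemma vgeM x y m n : vge M x m -> vge M y n -> vge M (x * y) (m + n).
Proof.
move=> hx hy; have [->|x0] := eqVneq x 0; first by rewrite mul0r; left.
have [->|y0] := eqVneq y 0; first by rewrite mulr0; left.
by right; rewrite valM // lerD // vgeN0.
Qed.

Lemma locP x : localization R M x <-> vge M x 0.
Proof.
case: (vR mM) => _ _ _ ->; split=> /=; first by move=> [|[]]; [left|right].
have [->|x0] := eqVneq x 0; first by left.
by move=> /vgeN0 h; right; split=> //; exact: h.
Qed.

Lemma vge_ring x : R x -> vge M x 0.
Proof.
move=> Rx; apply/locP; exists x, 1; split=> //; split; first by case: sR.
have [idM [/(sr_ideal_proper sR idM) nM1 _]] := mM.
by split=> //; rewrite divr1.
Qed.

Lemma memMP x : R x -> M x <-> vge M x 1.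
Proof.
move=> Rx; have [->|x0] := eqVneq x 0.
  by split=> _; [left|case: mM => -[_ []]].
have vx := vgeN0 x0 (vge_ring Rx); split=> [Mx|].
  right; rewrite -(gtz0_ge1); rewrite lt_neqAle vx andbT eq_sym; apply/eqP => vx0.
  have : localization R M x^-1 by apply/locP; right; rewrite valV // vx0.
  move=> [a [b [Ra [Rb [nMb e]]]]]; apply: nMb.
  have [-> | b0] := eqVneq b 0; first by case: mM => -[_ []].
  have -> : b = a * x by rewrite -[x]invrK e invf_div mulrC divfK //;
    apply: contra_neq x0 => a0; apply: invr_inj; rewrite e a0 mul0r invr0.
  by case: mM => -[_ [_ [_]]] h _; apply: h.
move=> /(vgeN0 x0) h; apply/not_notP => nMx.
have : localization R M x^-1.
  by exists 1, x; rewrite div1r; split=> //; case: sR.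
move=> /locP /(vgeN0 (invr_neq0 x0)); rewrite valV //; lia.
Qed.

Lemma notM_val x : R x -> ~ M x -> x != 0 /\ v M x = 0.
Proof.
move=> Rx nMx; have x0 : x != 0.
  by apply: contra_notN nMx => /eqP ->; case: mM => -[_ []].
split=> //; have := vgeN0 x0 (vge_ring Rx).
have : ~ (1 <= v M x) by move=> h; apply: nMx; apply/memMP => //; right.
lia.
Qed.

Lemma vge1N : ~ vge M 1 1.
Proof.
move=> /(vgeN0 (oner_neq0 _)); rewrite val1; lia.
Qed.

Lemma max_nonzero : exists t, [/\ M t, R t & t != 0].
Proof.
have [_ _ [t [t0 vt]] _] := vR mM.
have : localization R M t by apply/locP; right; rewrite vt.
move=> [a [b [Ra [Rb [nMb e]]]]].
have [b0 vb] := notM_val Rb nMb.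
have a0 : a != 0 by apply: contra_neq t0 => a0; rewrite e a0 mul0r.
exists a; split=> //; apply/memMP => //; right.
have : v M a = v M (t * b) by rewrite e divfK.
by rewrite valM // vt vb => ->.
Qed.

End OnePrime.

(** [R] is the intersection of its localizations: the denominators of [x] form an ideal contained in
    no maximal ideal, so 1 is a denominator. *)
Lemma vge_all_ring x : (forall M, sr_maximal R M -> vge M x 0) -> R x.
Proof.
move=> hx; pose I := [set r | R r /\ R (r * x)].
have [R1 [RB RM]] := sR.
have idI : sr_ideal R I.
  split; first by move=> r [].
  split; first by split; rewrite ?mul0r; exact: subring0.
  split; first by move=> a b [Ra Rax] [Rb Rbx]; split; rewrite ?mulrDl; exact: subringD.
  by move=> s a Rs [Ra Rax]; split; rewrite -?mulrA; exact: RM.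
have [[_]|nI1] := pselect (I 1); first by rewrite mul1r.
have [M mM IM] := krull sR idI nI1.
have [a [b [Ra [Rb [nMb xE]]]]] := (locP mM x).2 (hx M mM).
exfalso; apply: nMb; apply: IM; split=> //.
have [b0|b0] := eqVneq b 0; first by rewrite b0 mul0r; exact: subring0.
by rewrite xE mulrC divfK.
Qed.

(** Dimension at most one: each element of a maximal ideal above [P] has a power divisible by [a] in
    the localization, hence lies in [P]. *)
Lemma prime_nonzero_maximal P a : sr_prime R P -> P a -> a != 0 -> sr_maximal R P.
Proof.
move=> [idP [PR Ppr]] Pa a0.
have [PS [P0 [PD PM]]] := idP.
have [M mM PsM] := krull sR idP (sr_ideal_proper sR idP PR).
suff -> : P = M by [].
apply/seteqP; split=> // x Mx.
have Rx : R x by case: mM => -[MR _] _; exact: MR.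
have [->//|x0] := eqVneq x 0.
have vx : 1 <= v M x by apply: vgeN0 => //; apply/memMP.
have va : 0 <= v M a by apply: vgeN0 => //; apply: vge_ring => //; exact: PS.
(* As [v M x] is at least 1, the value of [x ^+ n] is at least that of [a]. *)
pose n := `|v M a|%N.
have : localization R M (x ^+ n / a).
  apply/locP => //; right; rewrite valM ?invr_neq0 ?expf_neq0 // valV // valX //.
  rewrite -mulr_natr /n; nia.
move=> [b [s [Rb [Rs [nMs e]]]]].
have s0 : s != 0 by apply: contra_notN nMs => /eqP ->; case: mM => -[_ []].
have Psx : P (s * x ^+ n).
  have -> : s * x ^+ n = b * a.
    by rewrite -[x ^+ n](divfK a0) e mulrCA mulrA divfK // mulrC mulrA.
  exact: PM.
have RX k : R (x ^+ k).
  by elim: k => [|k IH]; rewrite ?expr0 ?exprS; case: sR => // R1 [_ RM]; exact: RM.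
have [Ps|] := Ppr _ _ Rs (RX n) Psx; first by case: nMs; exact: PsM.
elim: n {e Psx} => [|n IH]; first by rewrite expr0 => P1; case: (sr_ideal_proper sR idP PR).
by rewrite exprS => /(Ppr _ _ Rx (RX n)) [|/IH].
Qed.

Definition nuP J M (n : int) :=
  (forall x, J x -> vge M x n) /\ exists x, [/\ J x, x != 0 & v M x = n].

(** The default 0 off [Max R] makes two such functions equal as soon as they agree on maximal
    ideals, and makes every point outside [Max R] a common zero. *)
Definition nu J M : int := xget 0 [set n | sr_maximal R M /\ nuP J M n].

Lemma nuP_uniq J M m n : nuP J M m -> nuP J M n -> m = n.
Proof.
move=> [h [x [Jx x0 vx]]] [k [y [Jy y0 vy]]]; 
have := vgeN0 y0 (h y Jy); have := vgeN0 x0 (k x Jx); lia.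
Qed.

Lemma nuE J M n : sr_maximal R M -> nuP J M n -> nu J M = n.
Proof.
move=> mM h; rewrite /nu; case: xgetP => [m _ [_ hm]|/(_ n) []]; last by split.
exact: nuP_uniq hm h.
Qed.

Lemma nu_off J M : ~ sr_maximal R M -> nu J M = 0.
Proof. by move=> nM; rewrite /nu; case: xgetP => // m _ []. Qed.

(** A common denominator [d] bounds the values on [J] from below by [- v M d], so the minimum is
    found among natural numbers. *)
Lemma nuP_exists J M : sr_maximal R M -> frac_ideal R J -> (exists2 x, J x & x != 0) ->
  nuP J M (nu J M).
Proof.
move=> mM [J0 [JD [JM [d [d0 [Rd dJ]]]]]] [x Jx x0].
suff [n hn] : exists n, nuP J M n by rewrite (nuE mM hn).
have ge y : J y -> y != 0 -> 0 <= v M d + v M y.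
  move=> Jy y0; rewrite -valM //; apply: vgeN0; first exact: mulf_neq0.
  by apply: vge_ring => //; exact: dJ.
pose P n := `[< exists y, [/\ J y, y != 0 & v M d + v M y = n%:Z] >].
have exP : exists n, P n.
  exists `|(v M d + v M x)%R|%N; apply/asboolP; exists x; split=> //.
  by have := ge x Jx x0; lia.
case: (ex_minnP exP) => m /asboolP [y [Jy y0 vy]] minm.
exists (v M y); split; last by exists y.
move=> z Jz; have [->|z0] := eqVneq z 0; first by left.
right; have gz := ge z Jz z0.
have := minm `|(v M d + v M z)%R|%N; have -> : P `|(v M d + v M z)%R|%N.
  by apply/asboolP; exists z; split=> //; lia.
move=> /(_ isT); lia.
Qed.

Lemma Inv_nonzero J : Inv R J -> exists2 x, J x & x != 0.
Proof.
move=> [_ [J' [_ JJ]]]; apply: (@prod_set_nonzero _ _ J').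
by rewrite JJ; case: sR.
Qed.

Lemma nu_spec J M : Inv R J -> sr_maximal R M -> nuP J M (nu J M).
Proof. by move=> iJ mM; apply: nuP_exists => //; [case: iJ|exact: Inv_nonzero]. Qed.

Lemma nu_vge J M x : Inv R J -> sr_maximal R M -> J x -> vge M x (nu J M).
Proof. by move=> iJ mM; case: (nu_spec iJ mM) => h _; exact: h. Qed.

Lemma nu_prod J J' M : Inv R J -> Inv R J' -> nu (prod_set J J') M = nu J M + nu J' M.
Proof.
move=> iJ iJ'; have [mM|nM] := pselect (sr_maximal R M); last by rewrite !nu_off.
have [h [x [Jx x0 vx]]] := nu_spec iJ mM; have [h' [x' [Jx' x0' vx']]] := nu_spec iJ' mM.
apply: nuE => //; split; last first.
  exists (x * x'); split; [exact: prod_set_mul|exact: mulf_neq0|].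
  by rewrite valM // vx vx'.
move=> y; apply: (@prod_set_min _ [set y | vge M y (nu J M + nu J' M)]) => /=.
- by left.
- by move=> ? ?; exact: vgeD.
- by move=> a b /h ? /h' ?; exact: vgeM.
Qed.

Lemma frac_ring : frac_ideal R R.
Proof.
have [R1 [RB RM]] := sR; split; first exact: subring0.
split; first by move=> x y; exact: subringD.
split; first exact: RM.
by exists 1; split; [exact: oner_neq0|split=> // x; rewrite mul1r].
Qed.

Lemma prod_ringl J : frac_ideal R J -> prod_set J R = J.
Proof.
move=> [J0 [JD [JM _]]]; apply/seteqP; split.
  by apply: prod_set_min => // a b Ja Rb; rewrite mulrC; exact: JM.
by move=> x Jx; rewrite -[x]mulr1; apply: prod_set_mul => //; case: sR.
Qed.

Lemma Inv_ring : Inv R R.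
Proof. by split; [exact: frac_ring|exists R; split; [exact: frac_ring|exact: prod_ringl frac_ring]]. Qed.

Lemma nu_ring M : nu R M = 0.
Proof.
have := nu_prod M Inv_ring Inv_ring; rewrite (prod_ringl frac_ring); lia.
Qed.

Lemma Inv_inverse J : Inv R J -> exists J', [/\ Inv R J', prod_set J J' = R &
  forall M, nu J' M = - nu J M].
Proof.
move=> iJ; have [fJ [J' [fJ' JJ]]] := iJ.
have iJ' : Inv R J' by split=> //; exists J; rewrite prod_setC.
exists J'; split=> // M; have := nu_prod M iJ iJ'.
by rewrite JJ nu_ring; lia.
Qed.

(** For the converse, [x] times the inverse [J'] has nonnegative values everywhere, so it lies in
    [R]; multiplying back by [J] puts [x] in [J]. Hence the function [nu J] determines [J]. *)
Lemma Inv_mem J x : Inv R J -> J x <-> forall M, sr_maximal R M -> vge M x (nu J M).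
Proof.
move=> iJ; split=> [Jx M mM|hx]; first exact: nu_vge.
have [J' [iJ' JJ nJ']] := Inv_inverse iJ.
have [[J0 [JD [JM _]]] _] := iJ.
suff h y : prod_set J J' y -> J (x * y).
  by rewrite -[x]mulr1; apply: h; rewrite JJ; case: sR.
move: y; apply: (@prod_set_min _ [set y | J (x * y)]) => /=.
- by rewrite mulr0.
- by move=> y z; rewrite mulrDr; exact: JD.
- move=> a b Ja Jb; rewrite (mulrC a) mulrA; apply: JM => //.
  apply: vge_all_ring => M mM.
  by have := vgeM mM (hx M mM) (nu_vge iJ' mM Jb); rewrite nJ' subrr.
Qed.

Lemma nu_inj J J' : Inv R J -> Inv R J' -> nu J = nu J' -> J = J'.
Proof.
move=> iJ iJ' e; apply/seteqP; split=> x.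
  by move=> /(Inv_mem _ iJ); rewrite e => /(Inv_mem _ iJ').
by move=> /(Inv_mem _ iJ'); rewrite -e => /(Inv_mem _ iJ).
Qed.

(** Locally at [M] the ideal is generated by [x], with a single denominator [s] outside [M] for all
    of [J]. *)
Definition loc_principal J := forall M, sr_maximal R M -> exists x s,
  [/\ J x, x != 0, R s, ~ M s & forall j, J j -> R (s * j / x)].

(** If products [a * b] from [J] and its inverse sum to 1, one of them avoids [M]; then [a] is a
    local generator with denominator [a * b]. Conversely the inverse is the set of multipliers of
    [J] into [R], and each [s / x] is one, so the product lies in no maximal ideal. *)
Lemma InvP J : frac_ideal R J -> Inv R J <-> loc_principal J.
Proof.
move=> fJ; have [R1 [RB RM]] := sR; have [J0 [JD [JM [d [d0 [Rd dJ]]]]]] := fJ.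
split=> [iJ M mM|lp].
  have [_ [J' [fJ' JJ]]] := iJ.
  have JR a b : J a -> J' b -> R (a * b) by move=> ? ?; rewrite -JJ; exact: prod_set_mul.
  apply/not_notP => nlp; have [idM [MS _]] := mM.
  apply: (sr_ideal_proper sR idM MS).
  have : prod_set J J' 1 by rewrite JJ.
  have [_ [M0 [MD MM]]] := idM.
  apply: prod_set_min => // a b Ja Jb; apply/not_notP => nMab; apply: nlp.
  have a0 : a != 0 by apply: contra_notN nMab => /eqP ->; rewrite mul0r.
  exists a, (a * b); split=> // [|j Jj]; first exact: JR.
  have -> : a * b * j / a = j * b by field.
  exact: JR.
split=> //; pose J' := [set y | forall j, J j -> R (y * j)].
have JR : prod_set J J' `<=` R.
  apply: prod_set_min; first exact: subring0.
    by move=> x y; exact: subringD.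
  by move=> a b Ja Jb; rewrite mulrC; exact: Jb.
have idP : sr_ideal R (prod_set J J').
  split=> //; split; first exact: prod_set0.
  split; first by move=> x y; exact: prod_setD.
  by move=> s x Rs; apply: prod_set_scale => // a; exact: JM.
have JJ1 : prod_set J J' 1.
  apply/not_notP => n1; have [M mM PM] := krull sR idP n1.
  have [x [s [Jx x0 Rs nMs sJ]]] := lp M mM.
  apply: nMs; apply: PM; rewrite -[s](divfK x0) mulrC; apply: prod_set_mul => //.
  by move=> j Jj; rewrite mulrAC; exact: sJ.
have [x Jx x0] := prod_set_nonzero JJ1.
exists J'; split; last first.
  apply/seteqP; split=> // y Ry; rewrite -[y]mulr1; case: idP => _ [_ [_]]; exact.
split; first by move=> j _; rewrite mul0r; exact: subring0.
split; first by move=> y z hy hz j Jj; rewrite mulrDl; apply: subringD; [|exact: hy|exact: hz].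
split; first by move=> r y Rr hy j Jj; rewrite -mulrA; apply: (RM) => //; exact: hy.
exists (d * x); split; first exact: mulf_neq0.
split; first exact: dJ.
by move=> y hy; rewrite -mulrA (mulrC x); apply: (RM) => //; exact: hy.
Qed.

Lemma Inv_prod J J' : Inv R J -> Inv R J' -> Inv R (prod_set J J').
Proof.
move=> iJ iJ'; have [R1 [RB RM]] := sR.
have [fJ _] := iJ; have [fJ' _] := iJ'.
have [J0 [JD [JM [d [d0 [Rd dJ]]]]]] := fJ; have [J0' [JD' [JM' [d' [d0' [Rd' dJ']]]]]] := fJ'.
apply/InvP.
  split; first exact: prod_set0.
  split; first by move=> x y; exact: prod_setD.
  split; first by move=> s x Rs; apply: prod_set_scale => // a; exact: JM.
  exists (d * d'); split; first exact: mulf_neq0.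
  split; first exact: RM.
  apply: (@prod_set_min _ [set x | R (d * d' * x)]) => /=.
  - by rewrite mulr0; exact: subring0.
  - by move=> x y; rewrite mulrDr; exact: subringD.
  - by move=> a b Ja Jb; rewrite mulrACA; apply: (RM); [exact: dJ|exact: dJ'].
move=> M mM; have [x [s [Jx x0 Rs nMs sJ]]] := (InvP fJ).1 iJ M mM.
have [x' [s' [Jx' x0' Rs' nMs' sJ']]] := (InvP fJ').1 iJ' M mM.
exists (x * x'), (s * s'); split; [exact: prod_set_mul|exact: mulf_neq0|exact: RM| |].
  move=> Mss; have [_ [_ pM]] := sr_maximal_prime sR mM.
  by case: (pM _ _ Rs Rs' Mss).
apply: (@prod_set_min _ [set j | R (s * s' * j / (x * x'))]) => /=.
- by rewrite mulr0 mul0r; exact: subring0.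
- by move=> y z; rewrite mulrDr mulrDl; exact: subringD.
- move=> a b Ja Jb.
  have -> : s * s' * (a * b) / (x * x') = (s * a / x) * (s' * b / x').
    by field; rewrite x0 x0'.
  by apply: (RM); [exact: sJ|exact: sJ'].
Qed.

(** Of the two local generators, the one of smaller value divides the other in the localization and
    generates the sum. This is what closes the group of functions under minimum. *)
Lemma Inv_add J J' : Inv R J -> Inv R J' -> Inv R (addsg J J').
Proof.
move=> iJ iJ'; have [R1 [RB RM]] := sR.
have [fJ _] := iJ; have [fJ' _] := iJ'.
have [J0 [JD [JM [d [d0 [Rd dJ]]]]]] := fJ; have [J0' [JD' [JM' [d' [d0' [Rd' dJ']]]]]] := fJ'.
apply/InvP.
  split; first by exists 0, 0; rewrite addr0.
  split; first move=> _ _ [a [b [Ia Jb ->]]] [a' [b' [Ia' Jb' ->]]].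
    by exists (a + a'), (b + b'); split; [exact: JD|exact: JD'|rewrite addrACA].
  split; first move=> s _ Rs [a [b [Ia Jb ->]]].
    by exists (s * a), (s * b); split; [exact: JM|exact: JM'|rewrite mulrDr].
  exists (d * d'); split; first exact: mulf_neq0.
  split; first exact: RM.
  move=> _ [a [b [Ia Jb ->]]]; rewrite mulrDr; apply: subringD => //.
    by rewrite mulrAC; apply: (RM) => //; exact: dJ.
  by rewrite -mulrA; apply: (RM) => //; exact: dJ'.
move=> M mM; have [_ [_ pM]] := sr_maximal_prime sR mM.
have pM3 a b c : R a -> R b -> R c -> ~ M a -> ~ M b -> ~ M c -> ~ M (a * b * c).
  by move=> Ra Rb Rc na nb nc /(pM _ _ (RM _ _ Ra Rb) Rc) [/(pM _ _ Ra Rb) []|].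
have [x [s [Jx x0 Rs nMs sJ]]] := (InvP fJ).1 iJ M mM.
have [x' [s' [Jx' x0' Rs' nMs' sJ']]] := (InvP fJ').1 iJ' M mM.
have aux a : a != 0 -> 0 <= v M a -> exists t, [/\ R t, ~ M t & R (t * a)].
  move=> a0 va; have : localization R M a by apply/locP => //; right.
  move=> [b [t [Rb [Rt [nMt e]]]]]; exists t; split=> //.
  by have [t0 _] := notM_val mM Rt nMt; rewrite e mulrC divfK.
have [le|lt] := leP (v M x) (v M x').
  have [||t [Rt nMt Rtx]] := aux (x' / x).
  - by rewrite mulf_neq0 ?invr_neq0.
  - rewrite valM ?invr_neq0 // valV //; lia.
  exists x, (s * s' * t); split; [|by []| | |].
  - by exists x, 0; rewrite addr0.
  - by apply: (RM) => //; exact: RM.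
  - exact: pM3.
  move=> _ [a [b [Ja Jb ->]]]; rewrite mulrDr mulrDl; apply: subringD => //.
    have -> : s * s' * t * a / x = s' * t * (s * a / x) by ring.
    by apply: (RM); [exact: RM|exact: sJ].
  have -> : s * s' * t * b / x = s * (s' * b / x') * (t * (x' / x)).
    by field; rewrite x0 x0'.
  by apply: (RM) => //; apply: (RM) => //; exact: sJ'.
have [||t [Rt nMt Rtx]] := aux (x / x').
- by rewrite mulf_neq0 ?invr_neq0.
- rewrite valM ?invr_neq0 // valV //; lia.
exists x', (s * s' * t); split; [|by []| | |].
- by exists 0, x'; rewrite add0r.
- by apply: (RM) => //; exact: RM.
- exact: pM3.
move=> _ [a [b [Ja Jb ->]]]; rewrite mulrDr mulrDl; apply: subringD => //; last first.
  have -> : s * s' * t * b / x' = s * t * (s' * b / x') by ring.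
  by apply: (RM); [exact: RM|exact: sJ'].
have -> : s * s' * t * a / x' = s' * (s * a / x) * (t * (x / x')).
  by field; rewrite x0 x0'.
by apply: (RM) => //; apply: (RM) => //; exact: sJ.
Qed.

Lemma nu_add J J' M : Inv R J -> Inv R J' ->
  nu (addsg J J') M = Num.min (nu J M) (nu J' M).
Proof.
move=> iJ iJ'; have [mM|nM] := pselect (sr_maximal R M); last by rewrite !nu_off // minxx.
have [h [x [Jx x0 vx]]] := nu_spec iJ mM; have [h' [x' [Jx' x0' vx']]] := nu_spec iJ' mM.
have [[J0 _] _] := iJ; have [[J0' _] _] := iJ'.
apply: nuE => //; split.
  move=> _ [a [b [/h ha /h' hb ->]]]; apply: vgeD => //.
    by apply: vge_le ha; rewrite ge_min lexx.
  by apply: vge_le hb; rewrite ge_min lexx orbT.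
case: leP => _; [exists x|exists x']; split=> //.
  by exists x, 0; rewrite addr0.
by exists 0, x'; rewrite add0r.
Qed.

Lemma Inv_principal a : a != 0 -> exists J,
  [/\ Inv R J, J a & forall M, sr_maximal R M -> nu J M = v M a].
Proof.
move=> a0; have [R1 [RB RM]] := sR.
pose P c := [set x | exists2 r, R r & x = r * c].
have fP c : c != 0 -> frac_ideal R (P c).
  move=> c0; split; first by exists 0; [exact: subring0|rewrite mul0r].
  split; first by move=> _ _ [r Rr ->] [r' Rr' ->]; exists (r + r'); [exact: subringD|rewrite mulrDl].
  split; first by move=> s _ Rs [r Rr ->]; exists (s * r); [exact: RM|rewrite mulrA].
  have [p [q [Rp [Rq [q0 cE]]]]] := qR c.
  exists q; split=> //; split=> // _ [r Rr ->].
  have -> : q * (r * c) = r * p by rewrite cE; field.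
  exact: RM.
exists (P a); have Pa : P a a by exists 1; rewrite ?mul1r.
split=> //.
  split; first exact: fP.
  exists (P a^-1); split; first by apply: fP; rewrite invr_neq0.
  apply/seteqP; split.
    apply: prod_set_min; [exact: subring0|by move=> x y; exact: subringD|].
    move=> _ _ [r Rr ->] [r' Rr' ->].
    have -> : r * a * (r' * a^-1) = r * r' by field.
    exact: RM.
  move=> x Rx; have -> : x = (x * a) * (1 * a^-1) by field.
  by apply: prod_set_mul; [exists x|exists 1].
move=> M mM; apply: nuE => //; split; last by exists a.
move=> _ [r Rr ->]; rewrite -[v M a]add0r; apply: vgeM => //; last by right.
exact: vge_ring.
Qed.

(** [J] is the fractional ideal generated by [s], a sum of principal ones; all that is recorded is
    that its function is the minimum of the values of the generators. *)
Lemma Inv_gen (s : seq K) : has (fun x => x != 0) s -> exists J, Inv R J /\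
  forall M n, sr_maximal R M -> (forall x, x \in s -> vge M x n) <-> n <= nu J M.
Proof.
elim: s => [//|a s IH] hs.
have [a0|a0] := eqVneq a 0.
  have [J [iJ hJ]] : exists J, Inv R J /\
      forall M n, sr_maximal R M -> (forall x, x \in s -> vge M x n) <-> n <= nu J M.
    by apply: IH; move: hs; rewrite /= a0 eqxx.
  exists J; split=> // M n mM; rewrite -hJ //; split=> h x.
    by move=> xs; apply: h; rewrite inE xs orbT.
  by rewrite inE => /orP[/eqP ->|]; [left|exact: h].
have [Ja [iJa _ nJa]] := Inv_principal a0.
have [h0|/hasPn h0] := boolP (has (fun x => x != 0) s).
  have [J [iJ hJ]] := IH h0.
  exists (addsg Ja J); split; first exact: Inv_add.
  move=> M n mM; rewrite nu_add // le_min nJa //; split=> [h|/andP[h1 h2] x].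
    apply/andP; split; first by apply: vgeN0 => //; apply: h; rewrite inE eqxx.
    by apply/hJ => // x xs; apply: h; rewrite inE xs orbT.
  by rewrite inE => /orP[/eqP ->|]; [right|move: x; exact/hJ].
exists Ja; split=> // M n mM; rewrite nJa //; split=> [h|h x].
  by apply: vgeN0 => //; apply: h; rewrite inE eqxx.
rewrite inE => /orP[/eqP ->|/h0]; first by right.
by rewrite negbK => /eqP ->; left.
Qed.

(** The factors from [J] in an expression of 1 as a sum of products already attain the minimum at
    every [M]. A nonzero element is added so that later a prime containing the list is nonzero. *)
Lemma Inv_fg J : Inv R J -> exists s : seq K,
  [/\ (forall x, x \in s -> J x), has (fun x => x != 0) s &
  forall M n, sr_maximal R M -> (forall x, x \in s -> vge M x n) -> n <= nu J M].
Proof.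
move=> iJ; have [x0 Jx0 nx0] := Inv_nonzero iJ; have [J' [iJ' JJ nJ']] := Inv_inverse iJ.
have : prod_set J J' 1 by rewrite JJ; case: sR.
move=> [s [sJ e]]; exists (x0 :: map fst s); split.
- by move=> x; rewrite inE => /orP[/eqP -> //|/mapP [p /sJ [? _] ->]].
- by rewrite /= nx0.
move=> M n mM hs.
suff : vge M 1 (n + nu J' M).
  by move=> /(vgeN0 (oner_neq0 _)); rewrite val1 // nJ'; lia.
rewrite e big_seq; apply: (big_ind (fun x => vge M x (n + nu J' M))).
- by left.
- by move=> x y; exact: vgeD.
- move=> p ps; apply: vgeM => //; first by apply: hs; rewrite inE map_f // orbT.
  by apply: nu_vge => //; case: (sJ p ps).
Qed.

Definition nugrp := [set nu J | J in Inv R].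

Lemma sgrp_nugrp : sgrp nugrp.
Proof.
split.
  by exists R; [exact: Inv_ring|apply/funext => M; exact: nu_ring].
move=> _ _ [J iJ <-] [J2 iJ2 <-]; have [J' [iJ' _ nJ']] := Inv_inverse iJ2.
exists (prod_set J J'); first exact: Inv_prod.
by apply/funext => M; rewrite nu_prod // nJ'.
Qed.

Lemma nugrp_min g h : nugrp g -> nugrp h -> nugrp (fun M => Num.min (g M) (h M)).
Proof.
move=> [J iJ <-] [J' iJ' <-]; exists (addsg J J'); first exact: Inv_add.
by apply/funext => M; rewrite nu_add.
Qed.

Lemma nugrp_off g M : nugrp g -> ~ sr_maximal R M -> g M = 0.
Proof. by move=> [J iJ <-]; exact: nu_off. Qed.

End Valuations.

(** * The inverse topology *)

(** The elements whose principal open set is finitely covered form an ideal [J]. If no power of [a]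
    lies in [J], some prime contains [J] and avoids [a]; the member of the cover containing it is
    defined by elements that all lie in [J], a contradiction. *)
Lemma zar_compact_principal (K : fieldType) (R : set K) a : subring R -> R a ->
  compact_in (zar_open R) [set P | sr_prime R P /\ ~ P a].
Proof.
move=> sR Ra F Fop cov; have [R1 [RB RM]] := sR.
pose J := [set x | R x /\ exists l : seq (set (set K)),
  (forall U, List_In U l -> F U) /\
  forall P, sr_prime R P -> P x \/ exists U, List_In U l /\ U P].
have [[_ [l [lF lP]]]|nJa] := pselect (J a).
  exists l; split=> // P [pP nPa]; have [//|[U [Ul UP]]] := lP P pP.
  by exists U.
exfalso.
have J0 : J 0.
  split; first exact: subring0.
  by exists [::]; split=> // P [[_ [P0 _]] _]; left.
have JD x y : J x -> J y -> J (x + y).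
  move=> [Rx [l [lF lP]]] [Ry [l' [lF' lP']]]; split; first exact: subringD.
  exists (l ++ l'); split=> [U /List.in_app_iff [/lF|/lF']//|P pP].
  have [Px|[U [Ul UP]]] := lP P pP; last first.
    by right; exists U; split=> //; apply/List.in_app_iff; left.
  have [Py|[U [Ul UP]]] := lP' P pP; last first.
    by right; exists U; split=> //; apply/List.in_app_iff; right.
  by left; case: pP => -[_ [_ [PD _]]] _; exact: PD.
have JM s x : R s -> J x -> J (s * x).
  move=> Rs [Rx [l [lF lP]]]; split; first exact: RM.
  exists l; split=> // P pP; have [Px|] := lP P pP; [left|by right].
  by case: pP => -[_ [_ [_ PM]]] _; exact: PM.
have a0 : a != 0 by apply: contra_notN nJa => /eqP ->.
have RX n : R (a ^+ n).
  by elim: n => [|n IH]; rewrite ?expr0 ?exprS //; exact: RM.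
have JX n : ~ J (a ^+ n).
  move=> [_ [l [lF lP]]]; apply: nJa; split=> //; exists l; split=> // P pP.
  have [Pan|] := lP P pP; [left|by right].
  have [idP [PR Ppr]] := pP.
  elim: n Pan {lP} => [|n IH]; first by rewrite expr0 => /(sr_ideal_proper sR idP PR).
  by rewrite exprS => /(Ppr _ _ Ra (RX n)) [|/IH].
(* [S] is [R] with [a] inverted and [J'] the extension of [J]; a maximal ideal above [J'] contracts
   to the required prime. *)
pose S := [set x | exists n, R (a ^+ n * x)].
pose J' := [set x | exists n, J (a ^+ n * x)].
have sS : subring S.
  split; first by exists 0%N; rewrite expr0 mulr1.
  split=> x y [m hm] [n hn]; exists (m + n)%N.
    rewrite exprD mulrBr -{1}(mulrC (a ^+ n)) -!mulrA.
    by apply: RB; apply: (RM).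
  by rewrite exprD mulrACA; exact: RM.
have RS : R `<=` S by move=> x Rx; exists 0%N; rewrite expr0 mul1r.
have JJ' : J `<=` J' by move=> x Rx; exists 0%N; rewrite expr0 mul1r.
have idJ' : sr_ideal S J'.
  split; first by move=> x [n [h _]]; exists n.
  split; first exact: JJ'.
  split=> [x y [m hm] [n hn]|x y [m hm] [n hn]]; exists (m + n)%N.
    rewrite exprD mulrDr -{1}(mulrC (a ^+ n)) -!mulrA.
    by apply: JD; apply: (JM).
  by rewrite exprD mulrACA; exact: JM.
have [|Q mQ J'Q] := krull sS idJ'.
  by move=> [n]; rewrite mulr1; exact: JX.
have [idQ [QS Qpr]] := sr_maximal_prime sS mQ.
have nQ1 := sr_ideal_proper sS idQ QS.
have [QsS [Q0 [QD QM]]] := idQ.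
have pP : sr_prime R (Q `&` R).
  split.
    split; first by move=> x [].
    split; first by split=> //; exact: subring0.
    split; first by move=> x y [? ?] [? ?]; split; [exact: QD|exact: subringD].
    by move=> s x Rs [? ?]; split; [apply: QM => //; exact: RS|exact: RM].
  split; first by move=> e; have : (Q `&` R) 1; [rewrite e|case].
  move=> x y Rx Ry [Qxy _].
  by have [|] := Qpr _ _ (RS _ Rx) (RS _ Ry) Qxy; [left|right].
have nPa : ~ (Q `&` R) a.
  move=> [Qa _]; apply: nQ1; rewrite -(mulVf a0); apply: QM => //.
  by exists 1%N; rewrite expr1 divff.
have [U [FU UP]] := cov _ (conj pP nPa).
have [Sg [SgR UE]] := Fop U FU.
move: (UP); rewrite UE => -[_]; apply => x Sgx.
split; last exact: SgR.
apply: J'Q; apply: JJ'; split; first exact: SgR.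
exists [:: U]; split=> [U' [<-|]//|P' pP'].
have [SP|nSP] := pselect (Sg `<=` P'); first by left; exact: SP.
by right; exists U; split; [left|rewrite UE].
Qed.

Lemma zar_principalE (K : fieldType) (R : set K) a :
  [set P | sr_prime R P /\ ~ P a] = [set P | sr_prime R P /\ ~ ([set a] `<=` P)].
Proof.
apply/seteqP; split=> P [pP h]; split=> // Pa; apply: h; first exact: Pa.
by move=> _ ->.
Qed.

(** Basic open sets are given by containing a finite list. A compact Zariski-open set is a finite
    union of principal ones, so its complement consists of the primes containing finitely many
    elements. *)
Lemma maxtopP (K : fieldType) (R : set K) W : subring R ->
  maxtop R W <-> W `<=` Max R /\ forall M, W M -> exists s : seq K,
    (forall x, x \in s -> M x) /\
    forall N, sr_maximal R N -> (forall x, x \in s -> N x) -> W N.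
Proof.
move=> sR; split.
  move=> [U [[USpec Uop] ->]]; split; first by move=> M [].
  move=> M [UM mM]; have [l [lS [_ [lM lU]]]] := Uop M UM.
  suff [s [sM sl]] : exists s : seq K, (forall x, x \in s -> M x) /\
      forall N, sr_prime R N -> (forall x, x \in s -> N x) ->
      forall B, List_In B l -> B N.
    exists s; split=> // N mN sN; split=> //; apply: lU.
    by have pN := sr_maximal_prime sR mN; split=> //; exact: sl.
  elim: l lS lM {lU} => [|B l IH] lS lM; first by exists [::].
  have [s [sM sl]] : exists s : seq K, (forall x, x \in s -> M x) /\
      forall N, sr_prime R N -> (forall x, x \in s -> N x) ->
      forall B, List_In B l -> B N.
    by apply: IH => B' h; [apply: lS|apply: lM]; right.
  have [V [[Sg [SgR VE]] [Vc BE]]] := lS B (or_introl erefl).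
  have SgM : Sg `<=` M.
    have := lM B (or_introl erefl); rewrite BE => -[pM nV].
    by apply/not_notP => h; apply: nV; rewrite VE.
  have [||t [tF tV]] := Vc [set D | exists2 a, Sg a & D = [set P | sr_prime R P /\ ~ P a]].
  - move=> _ [a Sga ->]; exists [set a]; split; first by move=> _ ->; exact: SgR.
    exact: zar_principalE.
  - rewrite VE => P [pP /existsNP [a /not_implyP [Sga nPa]]].
    by exists [set P | sr_prime R P /\ ~ P a]; split=> //; exists a.
  have [s' [s'S ts']] : exists s' : seq K, (forall x, x \in s' -> Sg x) /\
      forall P D, List_In D t -> D P -> exists2 a, a \in s' & ~ P a.
    elim: t tF {tV} => [|D t IHt] tF; first by exists [::].
    have [|s' [s'S ts']] := IHt; first by move=> D' h; apply: tF; right.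
    have [a Sga DE] := tF D (or_introl erefl).
    exists (a :: s'); split.
      by move=> x; rewrite inE => /orP[/eqP ->//|/s'S].
    move=> P D' [<-|D't].
      by rewrite DE => -[_ nPa]; exists a; rewrite // inE eqxx.
    by move=> /(ts' _ _ D't) [b bs nPb]; exists b; rewrite // inE bs orbT.
  exists (s' ++ s); split.
    by move=> x; rewrite mem_cat => /orP[/s'S/SgM|/sM].
  move=> N pN sN B' [<-|B'l]; last first.
    by apply: sl => // x xs; apply: sN; rewrite mem_cat xs orbT.
  rewrite BE; split=> // /tV [D [Dt DN]].
  by have [b bs] := ts' _ _ Dt DN; apply; apply: sN; rewrite mem_cat bs.
move=> [WM Wop].
exists [set P | sr_prime R P /\ exists s : seq K, (forall x, x \in s -> P x) /\
    forall N, sr_maximal R N -> (forall x, x \in s -> N x) -> W N].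
split; last first.
  apply/seteqP; split=> M.
    move=> WM'; split; last exact: WM.
    by split; [apply: sr_maximal_prime => //; exact: WM|exact: Wop].
  by move=> [[pM [s [sM sW]]] mM]; exact: sW.
split; first by move=> P [].
move=> P [pP [s [sP sW]]].
exists [seq Spec R `\` [set P | sr_prime R P /\ ~ P a] | a <- s].
have PR : P `<=` R by case: pP => -[].
have sl (Q : set (set K) -> Prop) : (forall a, a \in s ->
    Q (Spec R `\` [set P | sr_prime R P /\ ~ P a])) ->
    forall B, List_In B [seq Spec R `\` [set P | sr_prime R P /\ ~ P a] | a <- s] -> Q B.
  elim: (s) => [//|a t IH] h B /= [<-|]; first by apply: h; rewrite inE eqxx.
  by apply: IH => b bt; apply: h; rewrite inE bt orbT.
split.
  apply: sl => a /sP /PR Ra; exists [set P | sr_prime R P /\ ~ P a]; split.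
    exists [set a]; split; first by move=> _ ->.
    exact: zar_principalE.
  by split=> //; exact: zar_compact_principal.
split=> //; split.
  by apply: sl => a /sP Pa; split=> // -[].
move=> P' [pP' h]; split=> //; exists s; split=> // a as_.
apply/not_notP => nPa.
have : (Spec R `\` [set P | sr_prime R P /\ ~ P a]) P'.
  by apply: h; elim: (s) as_ => //= b t IH; rewrite inE => /orP[/eqP ->|/IH]; [left|right].
by move=> [_]; apply.
Qed.

(** * The group of functions and the topology of maximal ideals *)

Section GroupTopology.
Variable K : fieldType.
Variables (R : set K) (v : set K -> K -> int).
Hypotheses (sR : subring R) (qR : quotient_field_of R) (vR : local_vals R v).
Let G := nugrp R v.
Implicit Types (g h : set K -> int).

Lemma nugrp_pos g : G g -> G (fun M => Num.max (g M) 0).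
Proof.
move=> Gg; have sG := sgrp_nugrp sR vR.
have := sgrpN sG (nugrp_min sR vR (sgrpN sG Gg) sG.1); congr nugrp.
apply/funext => M; rewrite -[LHS]/(- Num.min (- g M) 0); lia.
Qed.

Lemma nugrp_gt0_seq g : G g -> exists s : seq K,
  [/\ (forall x, x \in s -> R x), has (fun x => x != 0) s &
  forall M, sr_maximal R M -> 0 < g M <-> forall x, x \in s -> M x].
Proof.
move=> /nugrp_pos [J iJ JE]; have [s [sJ s0 sM]] := Inv_fg sR vR iJ.
have ge M : 0 <= nu R v J M by rewrite JE le_max lexx orbT.
have sR' x : x \in s -> R x.
  move=> /sJ Jx; apply: (vge_all_ring sR vR) => M mM.
  by apply: vge_le (ge M) _; exact: nu_vge.
exists s; split=> // M mM.
have -> : 0 < g M <-> 1 <= nu R v J M by rewrite JE; lia.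
split=> [h x xs|h].
  apply/(memMP sR vR mM); first exact: sR'.
  by apply: vge_le h _; apply: nu_vge => //; exact: sJ.
by apply: sM => // x xs; apply/(memMP sR vR mM); [exact: sR'|exact: h].
Qed.

Lemma nugrp_of_seq (s : seq K) M : sr_maximal R M -> (forall x, x \in s -> M x) ->
  exists g, [/\ G g, 0 < g M & forall N, 0 < g N -> sr_maximal R N /\ forall x, x \in s -> N x].
Proof.
(* The list may be empty or zero; a nonzero [t] in [M] makes the ideal nonzero and only shrinks the
   neighbourhood. *)
move=> mM sM; have [t [Mt Rt t0]] := max_nonzero sR vR mM.
have MR x : M x -> R x by case: mM => -[h _] _; exact: h.
have [|J [iJ hJ]] := @Inv_gen _ R v sR qR vR (t :: s); first by rewrite /= t0.
exists (nu R v J); split; first by exists J.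
  suff : 1 <= nu R v J M by lia.
  apply/hJ => // x; rewrite inE => /orP[/eqP ->|/sM Mx].
    by apply/(memMP sR vR mM).
  by apply/(memMP sR vR mM) => //; exact: MR.
move=> N gN; have mN : sr_maximal R N.
  by apply/not_notP => /(nu_off v J) e; move: gN; rewrite e.
split=> // x xs; apply/(memMP sR vR mN); first by apply: MR; exact: sM.
have : 1 <= nu R v J N by lia.
by move=> /(hJ N 1 mN); apply; rewrite inE xs orbT.
Qed.

Lemma maxtop_nugrpP W : maxtop R W <-> W `<=` Max R /\
  forall M, W M -> exists g, [/\ G g, 0 < g M & forall N, 0 < g N -> W N].
Proof.
rewrite (maxtopP _ sR); split=> -[WM h]; split=> // M WMM; have mM := WM M WMM.
  have [s [sM sW]] := h M WMM; have [g [Gg gM gN]] := nugrp_of_seq mM sM.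
  by exists g; split=> // N /gN [mN sN]; exact: sW.
have [g [Gg gM gW]] := h M WMM; have [s [sR' s0 sg]] := nugrp_gt0_seq Gg.
exists s; split; first exact/sg.
by move=> N mN sN; apply: gW; apply/sg.
Qed.

(** Without a finite subcover, some ultrafilter contains [{g > 0}] and the complement of every
    [{h > 0}]. The elements lying in almost all maximal ideals form a prime [P], nonzero because it
    contains the list of [g], hence maximal. Some [{h > 0}] contains [P]; being given by a finite
    list, it belongs to the ultrafilter. *)
Lemma nugrp_compact g (F : set (set K -> int)) : G g -> F `<=` G ->
  (forall M, 0 < g M -> exists2 h, F h & 0 < h M) ->
  exists s : seq (set K -> int), (forall h, h \in s -> F h) /\
    forall M, 0 < g M -> exists2 h, h \in s & 0 < h M.
Proof.
move=> Gg FG cov; apply/not_notP => nfin.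
pose Fil : set_system (set K) := [set A | exists l : seq (set K -> int),
  (forall h, h \in l -> F h) /\
  forall M, 0 < g M -> (forall h, h \in l -> ~ (0 < h M)) -> A M].
have PF : ProperFilter Fil.
  apply: Build_ProperFilter.
    move=> [l [lF l0]]; apply: nfin; exists l; split=> // M gM.
    apply/not_notP => nex; apply: (l0 M gM) => h hl hM.
    by apply: nex; exists h.
  split.
  - by exists [::].
  - move=> A B [l [lF lA]] [l' [lF' lB]]; exists (l ++ l'); split.
      by move=> h; rewrite mem_cat => /orP[/lF|/lF'].
    move=> M gM hl; split; [apply: lA|apply: lB] => // h hh; apply: hl;
      by rewrite mem_cat hh ?orbT.
  - by move=> A B AB [l [lF lA]]; exists l; split=> // M gM hl; apply: AB; exact: lA.
have [U [UU FU]] := ultraFilterLemma PF.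
have [s [sR' s0 sg]] := nugrp_gt0_seq Gg.
have gmax M : 0 < g M -> sr_maximal R M.
  move=> gM; apply/not_notP => /(nugrp_off Gg) e; move: gM; by rewrite e.
have [R1 [RB RM]] := sR.
pose D x := [set M | sr_maximal R M /\ M x].
pose P := [set x | R x /\ U (D x)].
have Uspos : U [set M | 0 < g M] by apply: FU; exists [::].
have Umax : U (Max R) by apply: filterS Uspos; exact: gmax.
have pP : sr_prime R P.
  split.
    split; first by move=> x [].
    split.
      split; first exact: subring0.
      by apply: filterS Umax => M mM; split=> //; case: mM => -[_ []].
    split.
      move=> x y [Rx Ux] [Ry Uy]; split; first exact: subringD.
      apply: filterS (filterI Ux Uy) => M [[mM Mx] [_ My]]; split=> //.
      by case: mM => -[_ [_ [MD _]]] _; exact: MD.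
    move=> r x Rr [Rx Ux]; split; first exact: RM.
    apply: filterS Ux => M [mM Mx]; split=> //.
    by case: mM => -[_ [_ [_ MM]]] _; exact: MM.
  split.
    move=> e; have : P 1 by rewrite e.
    move=> [_ U1]; apply: (@filter_not_empty _ U _); apply: filterS U1 => M [mM M1].
    by have [idM [MS _]] := mM; exact: (sr_ideal_proper sR idM MS).
  move=> a b Ra Rb [_ Uab].
  have [Ua|Ua] := in_ultra_setVsetC (D a) UU; first by left.
  right; split=> //; apply: filterS (filterI Uab Ua) => M [[mM Mab] nMa]; split=> //.
  have [_ [_ pM]] := sr_maximal_prime sR mM.
  by have [Ma|//] := pM _ _ Ra Rb Mab; case: nMa; split.
have sP x : x \in s -> P x.
  move=> xs; split; first exact: sR'.
  apply: filterS Uspos => M gM; have mM := gmax M gM; split=> //.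
  by move: gM => /(sg M mM); apply.
have [a as_ a0] := hasP s0.
have mP := prime_nonzero_maximal sR vR pP (sP a as_) a0.
have gP : 0 < g P by apply/sg.
have [h Fh hP] := cov P gP.
have [t [tR _ th]] := nugrp_gt0_seq (FG h Fh).
have tP x : x \in t -> P x by move: hP => /(th P mP); apply.
have Uh : U [set M | 0 < h M].
  suff Ut : U [set M | sr_maximal R M /\ forall x, x \in t -> M x].
    by apply: filterS Ut => M [mM tM]; apply/th.
  elim: t tP {th tR} => [|x t IH] tP; first by apply: filterS Umax => M mM.
  have [|_ Ux] := tP x; first by rewrite inE eqxx.
  have Ut : U [set M | sr_maximal R M /\ forall x, x \in t -> M x].
    by apply: IH => y yt; apply: tP; rewrite inE yt orbT.
  apply: filterS (filterI Ux Ut) => M [[mM Mx] [_ Mt]]; split=> // y.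
  by rewrite inE => /orP[/eqP ->|/Mt].
have Unh : U [set M | ~ 0 < h M].
  apply: FU; exists [:: h]; split; first by move=> h'; rewrite inE => /eqP ->.
  by move=> M gM; apply; rewrite inE.
apply: (@filter_not_empty _ U _); apply: filterS (filterI Uh Unh) => M [].
by move=> hM; apply.
Qed.

End GroupTopology.

(** * Critical ideals of overrings *)

Section CritStep.
Variable K : fieldType.
Variables (R : set K) (v : set K -> K -> int).
Hypotheses (sR : subring R) (qR : quotient_field_of R) (vR : local_vals R v).
Let G := nugrp R v.

(** Closedness in [Max R], tested on the basic open sets [{g > 0}]. *)
Definition max_closed (C : set (set K)) := C `<=` Max R /\
  forall M, sr_maximal R M -> ~ C M ->
  exists g, [/\ G g, 0 < g M & forall N, C N -> g N <= 0].

Variables (C : set (set K)) (Ccl : max_closed C).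
Let T := Tof R C.
Let Cmax M : C M -> sr_maximal R M. Proof. by case: Ccl => h _; exact: h. Qed.

Lemma TofP x : T x <-> forall M, C M -> vge v M x 0.
Proof.
by split=> h M CM; move: (h M CM); rewrite (locP vR (Cmax CM)).
Qed.

Lemma sub_Tof : R `<=` T.
Proof. by move=> x Rx; apply/TofP => M CM; exact: (vge_ring sR vR (Cmax CM)). Qed.

Lemma subring_Tof : subring T.
Proof.
split; first by apply: sub_Tof; case: sR.
split=> x y /TofP hx /TofP hy; apply/TofP => M CM; have mM := Cmax CM.
  apply: (vgeD vR mM); first exact: hx.
  rewrite -mulN1r -[X in vge _ _ _ X]addr0; apply: (vgeM vR mM); last exact: hy.
  apply: (vge_ring sR vR mM); rewrite -sub0r; case: (sR) => R1 [RB _]; apply: RB => //.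
  exact: subring0.
by rewrite -[X in vge _ _ _ X]addr0; apply: (vgeM vR mM); [exact: hx|exact: hy].
Qed.

Lemma TofM x y : T x -> T y -> T (x * y).
Proof. by case: subring_Tof => _ [_]; apply. Qed.

Lemma comax_val Q b : sr_maximal R Q -> R b -> ~ Q b ->
  exists c q, [/\ R c, Q q & 1 = b * c + q].
Proof.
move=> mQ Rb nQb; have [c [q [Rc Qq e]]] := sr_maximal_comax sR mQ Rb nQb.
by exists c, q; rewrite mulrC.
Qed.

Lemma extendedP Q x : C Q -> prod_set Q T x <-> T x /\ vge v Q x 1.
Proof.
move=> CQ; have mQ := Cmax CQ; have [[QR [Q0 [QD QM]]] _] := mQ.
split.
  apply: (@prod_set_min _ [set x | T x /\ vge v Q x 1]) => /=.
  - by split; [apply: sub_Tof; exact: subring0|left].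
  - move=> a b [? ?] [? ?]; split; last exact: (vgeD vR mQ).
    exact: (subringD subring_Tof).
  - move=> a b Qa Tb; split; first by apply: TofM => //; apply: sub_Tof; exact: QR.
    rewrite -[X in vge _ _ _ X]addr0; apply: (vgeM vR mQ); last by move/TofP: Tb; apply.
    by apply/(memMP sR vR mQ) => //; exact: QR.
move=> [Tx vx].
have [a [b [Ra [Rb [nQb xE]]]]] : localization R Q x by move: Tx; apply.
have [b0 vb] := notM_val sR vR mQ Rb nQb.
have [c [q [Rc Qq e]]] := comax_val mQ Rb nQb.
have Qa : Q a.
  apply/(memMP sR vR mQ) => //; have -> : a = b * x by rewrite xE mulrC divfK.
  by rewrite -[X in vge _ _ _ X]add0r; apply: (vgeM vR mQ) => //; right; rewrite vb.
have -> : x = a * c + q * x.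
  by rewrite -[LHS]mul1r e mulrDl; congr (_ + _); rewrite xE mulrAC mulrCA divff // mulr1 mulrC.
by apply: prod_setD; apply: prod_set_mul => //; exact: sub_Tof.
Qed.

Lemma extended_ideal P : sr_maximal R P -> sr_ideal T (prod_set P T).
Proof.
move=> [[PR [P0 [PD PM]]] _]; split.
  apply: prod_set_min; first by apply: sub_Tof; exact: subring0.
    by move=> x y; exact: (subringD subring_Tof).
  by move=> a b Pa Tb; apply: TofM => //; apply: sub_Tof; exact: PR.
split; first exact: prod_set0.
split; first by move=> x y; exact: prod_setD.
move=> s x Ts; rewrite prod_setC; apply: prod_set_scale => a Ta; exact: TofM.
Qed.

Lemma extended_maximal Q : C Q -> sr_maximal T (prod_set Q T).
Proof.
move=> CQ; have mQ := Cmax CQ; split; first exact: extended_ideal.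
have [R1 [RB RM]] := sR; split.
  move=> e; have : prod_set Q T 1 by rewrite e; apply: sub_Tof.
  by move=> /(extendedP _ CQ) [_ /(vge1N vR mQ)].
move=> J [JT [J0 [JD JM]]] QJ.
have [JQ|nJQ] := pselect (J `<=` prod_set Q T); first by left; apply/seteqP.
right; apply/seteqP; split=> // y Ty; rewrite -[y]mulr1; apply: (JM) => //.
have /existsNP [x /not_implyP [Jx nx]] := nJQ.
have Tx := JT x Jx.
have [a [b [Ra [Rb [nQb xE]]]]] : localization R Q x by move: Tx; apply.
have [b0 vb] := notM_val sR vR mQ Rb nQb.
have aE : a = b * x by rewrite xE mulrC divfK.
have nQa : ~ Q a.
  move=> Qa; apply: nx; apply/extendedP => //; split=> //.
  have [x0|x0] := eqVneq x 0; first by left.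
  have [/(_ Qa) va _] := memMP sR vR mQ Ra.
  right; have a0 : a != 0 by rewrite aE mulf_neq0.
  by have := vgeN0 a0 va; rewrite aE (valM vR mQ) // vb add0r.
have [c [q [Rc Qq e]]] := comax_val mQ Ra nQa.
rewrite e; apply: JD; last by apply: QJ; rewrite -[q]mulr1; apply: prod_set_mul => //; exact: sub_Tof.
rewrite aE mulrAC; apply: JM => //; apply: sub_Tof; exact: RM.
Qed.

(** Here closedness of [C] enters: an invertible ideal inside [P] whose function vanishes on [C] has
    its inverse inside [T]. *)
Lemma extended_trivial P : sr_maximal R P -> ~ C P -> prod_set P T 1.
Proof.
move=> mP nCP; have [_ /(_ P mP nCP) [g [Gg gP gC]]] := Ccl.
have [J iJ JE] := nugrp_pos sR vR Gg.
have [J' [iJ' JJ nJ']] := Inv_inverse sR vR iJ.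
have sub1 : J `<=` P.
  move=> x Jx; have Rx : R x.
    apply: (vge_all_ring sR vR) => M mM; apply: vge_le (nu_vge sR vR iJ mM Jx).
    by rewrite JE; lia.
  apply/(memMP sR vR mP) => //; apply: vge_le (nu_vge sR vR iJ mP Jx).
  by rewrite JE; lia.
have sub2 : J' `<=` T.
  move=> x Jx; apply/TofP => M CM; apply: vge_le (nu_vge sR vR iJ' (Cmax CM) Jx).
  by rewrite nJ' JE; have := gC M CM; lia.
have : prod_set J J' 1 by rewrite JJ; case: sR.
apply: prod_set_min; [exact: prod_set0|by move=> x y; exact: prod_setD|].
by move=> a b /sub1 ? /sub2 ?; exact: prod_set_mul.
Qed.

(** The contraction of [N] to [R] is a nonzero prime, hence maximal, and lies in [C] because
    otherwise it would generate the unit ideal. For empty [C] the ring is [K] with maximal ideal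
    0. *)
Lemma Tof_maximal N : C !=set0 -> sr_maximal T N ->
  exists2 Q, C Q & N = prod_set Q T.
Proof.
move=> [Q0 CQ0] mN; have [idN [NT maxN]] := mN; have [NsT [N0 [ND NM]]] := idN.
have N1 := sr_ideal_proper subring_Tof idN NT.
have [_ [_ Npr]] := sr_maximal_prime subring_Tof mN.
have [R1 [RB RM]] := sR.
have pP : sr_prime R (N `&` R).
  split.
    split; first by move=> x [].
    split; first by split=> //; exact: subring0.
    split; first by move=> x y [? ?] [? ?]; split; [exact: ND|exact: subringD].
    by move=> s x Rs [? ?]; split; [apply: NM => //; exact: sub_Tof|exact: RM].
  split; first by move=> e; have : (N `&` R) 1; [rewrite e|case].
  move=> x y Rx Ry [Nxy _].
  by have [|] := Npr _ _ (sub_Tof Rx) (sub_Tof Ry) Nxy; [left|right].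
have [a [Na Ra] a0] : exists2 a, (N `&` R) a & a != 0.
  apply/not_notP => nex.
  have NZ x : N x -> x = 0.
    move=> Nx; have [a [b [Ra [Rb [b0 xE]]]]] := qR x.
    have aE : a = b * x by rewrite xE mulrC divfK.
    have [a0|a0] := eqVneq a 0; first by rewrite xE a0 mul0r.
    by case: nex; exists a => //; split=> //; rewrite aE; apply: NM => //; exact: sub_Tof.
  have [|e|e] := maxN _ (extended_ideal (Cmax CQ0)).
  - by move=> x /NZ ->; exact: prod_set0.
  - have [t [Qt Rt t0]] := max_nonzero sR vR (Cmax CQ0).
    have : N t by rewrite -e -[t]mulr1; apply: prod_set_mul => //; exact: sub_Tof.
    by move=> /NZ /eqP; rewrite (negbTE t0).
  - have [_ [ne _]] := extended_maximal CQ0; exact: ne.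
have mP := prime_nonzero_maximal sR vR pP (conj Na Ra) a0.
have PN : prod_set (N `&` R) T `<=` N.
  by apply: prod_set_min => // x y [Nx _] Ty; rewrite mulrC; exact: NM.
have CP : C (N `&` R) by apply/not_notP => /(extended_trivial mP) /PN.
exists (N `&` R) => //.
have [_ [_ /(_ N idN PN) [//|]]] := extended_maximal CP.
by [].
Qed.

Lemma extended_sqrP Q x : C Q ->
  prod_set (prod_set Q T) (prod_set Q T) x <-> T x /\ vge v Q x 2.
Proof.
move=> CQ; have mQ := Cmax CQ; have [[QR [Q0 [QD QM]]] _] := mQ.
have [R1 [RB RM]] := sR.
split.
  apply: (@prod_set_min _ [set x | T x /\ vge v Q x 2]) => /=.
  - by split; [apply: sub_Tof; exact: subring0|left].
  - move=> a b [? ?] [? ?]; split; last exact: (vgeD vR mQ).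
    exact: (subringD subring_Tof).
  - move=> a b /(extendedP _ CQ) [Ta va] /(extendedP _ CQ) [Tb vb].
    by split; [exact: TofM|exact: (vgeM vR mQ va vb)].
move=> [Tx vx].
have Qx : prod_set Q T x by apply/extendedP => //; split=> //; apply: vge_le vx.
have [_ _ [p [p0 vp]] _] := vR mQ.
have [a1 [b1 [Ra1 [Rb1 [nQb1 pE]]]]] : localization R Q p.
  by apply/(locP vR mQ); right; rewrite vp.
have [b10 vb1] := notM_val sR vR mQ Rb1 nQb1.
have a10 : a1 != 0 by apply: contra_neq p0 => e; rewrite pE e mul0r.
have va1 : v Q a1 = 1.
  have -> : a1 = p * b1 by rewrite pE divfK.
  by rewrite (valM vR mQ) // vp vb1.
have Qa1 : Q a1 by apply/(memMP sR vR mQ) => //; right; rewrite va1.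
have QTa1 : prod_set Q T a1.
  by rewrite -[a1]mulr1; apply: prod_set_mul => //; exact: sub_Tof.
have : localization R Q (x / (a1 * a1)).
  apply/(locP vR mQ); have [->|x0] := eqVneq x 0; first by left; rewrite mul0r.
  right; rewrite (valM vR mQ) ?(valV vR mQ) ?invr_neq0 ?mulf_neq0 // (valM vR mQ) // va1.
  by have := vgeN0 x0 vx; lia.
move=> [a [b [Ra [Rb [nQb xE]]]]].
have [b0 vb] := notM_val sR vR mQ Rb nQb.
have [c [q [Rc Qq e]]] := comax_val mQ Rb nQb.
have bx : b * x = a * (a1 * a1).
  have -> : x = a / b * (a1 * a1) by rewrite -xE divfK // mulf_neq0.
  by field.
(* Multiply [1 = b * c + q] by [x]. Both terms are products of two elements of the extended ideal,
   the second because [x] itself lies there. *)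
have -> : x = (c * a * a1) * a1 + q * x.
  have -> : c * a * a1 * a1 = b * c * x by rewrite (mulrC b) -(mulrA c b) bx !mulrA.
  by rewrite -mulrDl -e mul1r.
apply: prod_setD; apply: prod_set_mul => //.
  have [_ [_ [_ QTM]]] := extended_ideal mQ; apply: QTM => //.
  by apply: sub_Tof; exact: RM.
by rewrite -[q]mulr1; apply: prod_set_mul => //; exact: sub_Tof.
Qed.

Lemma fg_vge (s c : seq K) Q n : C Q -> (forall y, y \in c -> T y) ->
  size c = size s -> (forall y, y \in s -> vge v Q y n) ->
  vge v Q (\sum_(i < size s) c`_i * s`_i) n.
Proof.
move=> CQ cT sc sv; apply: (big_ind (fun x => vge v Q x n)).
- by left.
- by move=> x y; exact: (vgeD vR (Cmax CQ)).
- move=> i _; rewrite -[n]add0r; apply: (vgeM vR (Cmax CQ)).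
    have /cT /TofP : c`_i \in c by apply: mem_nth; rewrite sc.
    exact.
  by apply: sv; exact: mem_nth.
Qed.

Lemma fg_Tof (s c : seq K) : (forall y, y \in c -> T y) ->
  size c = size s -> (forall y, y \in s -> T y) -> T (\sum_(i < size s) c`_i * s`_i).
Proof.
move=> cT sc sT; apply/TofP => M CM; apply: fg_vge => // y /sT /TofP; exact.
Qed.

Lemma fg_gen (s : seq K) x : x \in s -> exists c : seq K,
  (forall y, y \in c -> T y) /\ size c = size s /\ x = \sum_(i < size s) c`_i * s`_i.
Proof.
move=> xs; have R1 : R 1 by case: sR.
exists (mkseq (fun i => (i == index x s)%:R) (size s)); split.
  move=> y /mapP [i _ ->]; apply: sub_Tof.
  by case: (_ == _) => //; exact: subring0.
split; first by rewrite size_mkseq.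
have h : (index x s < size s)%N by rewrite index_mem.
rewrite (bigD1 (Ordinal h)) //= nth_mkseq // eqxx mul1r nth_index // big1 ?addr0 //.
move=> i ne; rewrite nth_mkseq // (_ : _ == _ = false) ?mul0r //.
by apply: contraNF ne => /eqP e; apply/eqP/val_inj.
Qed.

(** A finitely generated ideal inside the extension of [P] lies in no square of a maximal ideal
    exactly when the minimal value of its generators is at most 1 at every point of [C]; it is
    nonnegative there and equals 1 at [P]. *)
Lemma crit_stepP P : crit_step R C P <->
  C P /\ ~ exists g, [/\ G g, (forall Q, C Q -> 0 <= g Q <= 1) & g P = 1].
Proof.
split.
  move=> [mP [mPT crit]].
  have CP : C P.
    apply/not_notP => /(extended_trivial mP).
    have [idP [PT _]] := mPT; exact: (sr_ideal_proper subring_Tof idP PT).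
  split=> // -[_ [[J iJ <-] gC gP]].
  have [s [sJ _ sM]] := Inv_fg sR vR iJ.
  have sT x : x \in s -> T x.
    move=> /sJ Jx; apply/TofP => Q CQ; apply: vge_le (nu_vge sR vR iJ (Cmax CQ) Jx).
    by have /andP[] := gC Q CQ.
  pose I := [set x | exists c : seq K, (forall y, y \in c -> T y) /\ size c = size s /\
                 x = \sum_(i < size s) c`_i * s`_i].
  have [||N [mN IN]] := crit I.
  - by exists s.
  - move=> _ [c [cT [sc ->]]]; apply/extendedP => //; split; first exact: fg_Tof.
    by apply: fg_vge => // y /sJ Jy; rewrite -gP; apply: nu_vge => //; exact: Cmax.
  have [|Q CQ NE] := Tof_maximal _ mN; first by exists P.
  have := gC Q CQ; suff : 2 <= nu R v J Q by lia.
  apply: sM; first exact: Cmax.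
  move=> x xs; have : I x by exact: fg_gen.
  by move=> /IN; rewrite NE => /(extended_sqrP _ CQ) [].
move=> [CP ng]; split; first exact: Cmax.
split; first exact: extended_maximal.
move=> I [s [sT IE]] IP; apply/not_notP => nN; apply: ng.
have sI x : x \in s -> I x by move=> xs; rewrite IE; exact: fg_gen.
have sq Q : C Q -> ~ (forall x, x \in s -> vge v Q x 2).
  move=> CQ h; apply: nN; exists (prod_set Q T); split; first exact: extended_maximal.
  move=> x; rewrite IE => -[c [cT [sc ->]]]; apply/extended_sqrP => //.
  by split; [exact: fg_Tof|exact: fg_vge].
(* The zero ideal would lie in the square of the extension of [P]. *)
have h0 : has (fun x => x != 0) s.
  apply/negP => /negP /hasPn h; apply: (sq P CP) => x /h.
  by rewrite negbK => /eqP ->; left.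
have [J [iJ hJ]] := Inv_gen sR qR vR h0.
exists (nu R v J).
have le1 Q : C Q -> nu R v J Q <= 1.
  move=> CQ; have := sq Q CQ; rewrite (hJ Q 2 (Cmax CQ)); lia.
have ge0 Q : C Q -> 0 <= nu R v J Q.
  by move=> CQ; apply/(hJ Q 0 (Cmax CQ)) => x /sT /TofP; exact.
split; first by exists J.
  by move=> Q CQ; rewrite le1 // ge0.
have : 1 <= nu R v J P.
  by apply/(hJ P 1 (Cmax CP)) => x /sI /IP /(extendedP _ CP) [].
by have := le1 P CP; lia.
Qed.

(** The function witnessing that a point of [C] is noncritical does so for every point of [C] where
    it is positive. *)
Lemma max_closed_step : max_closed (crit_step R C).
Proof.
split; first by move=> M /crit_stepP [/Cmax].
move=> M mM; have [CM|nCM] := pselect (C M); last first.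
  move=> _; case: Ccl => _ /(_ M mM nCM) [g [Gg gM gC]]; exists g; split=> // N.
  by move=> /crit_stepP [/gC].
move=> nst; have [g [Gg gC gM]] : exists g,
    [/\ G g, (forall Q, C Q -> 0 <= g Q <= 1) & g M = 1].
  by apply/not_notP => ng; apply: nst; apply/crit_stepP.
exists g; split=> //; first by rewrite gM.
move=> N /crit_stepP [CN nN]; have := gC N CN.
suff : g N <> 1 by lia.
by move=> gN; apply: nN; exists g.
Qed.

End CritStep.

(** * The layers *)

Section Layers.
Variables (T : Type) (X : set T) (op : set (set T)) (G : set (T -> int)).
Hypotheses (sG : sgrp G)
  (Gmin : forall g h, G g -> G h -> G (fun x => Num.min (g x) (h x)))
  (Goff : forall g x, G g -> ~ X x -> g x = 0)
  (opP : forall W, op W <-> W `<=` X /\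
     forall x, W x -> exists g, [/\ G g, 0 < g x & forall y, 0 < g y -> W y])
  (Gcompact : forall g (F : set (T -> int)), G g -> F `<=` G ->
     (forall x, 0 < g x -> exists2 h, F h & 0 < h x) ->
     exists s : seq (T -> int), (forall h, h \in s -> F h) /\
       forall x, 0 < g x -> exists2 h, h \in s & 0 < h x).

Lemma Gmax g h : G g -> G h -> G (fun x => Num.max (g x) (h x)).
Proof.
move=> Gg Gh; have := sgrpN sG (Gmin (sgrpN sG Gg) (sgrpN sG Gh)).
congr G; apply/funext => x; rewrite -[LHS]/(- Num.min (- g x) (- h x)); lia.
Qed.

Lemma Gpos g : G g -> G (fun x => Num.max (g x) 0).
Proof. by move=> Gg; exact: Gmax sG.1. Qed.

Lemma Gdom g x : G g -> 0 < g x -> X x.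
Proof. by move=> Gg gx; apply/not_notP => /(Goff Gg) e; rewrite e in gx. Qed.

Definition gclosed (C : set T) := C `<=` X /\
  forall x, X x -> ~ C x -> exists g, [/\ G g, 0 < g x & forall y, C y -> g y <= 0].

Variables (C D : set T) (Ccl : gclosed C) (DC : D `<=` C).
Hypothesis DP : forall x, C x -> D x <->
  exists g, [/\ G g, (forall y, C y -> 0 <= g y <= 1) & g x = 1].

(** The functions of [G] vanishing on [C] off [D], restricted to [C] and extended by zero. *)
Definition layer_group := [set f : T -> int | (forall x, ~ D x -> f x = 0) /\
  exists2 g, G g & forall x, C x -> g x = f x].
Let Q := layer_group.

Lemma sgrp_layer : sgrp Q.
Proof.
split; first by split=> //; exists 0 => //; exact: sG.1.
move=> f f' [f0 [g Gg gf]] [f0' [g' Gg' gf']]; split.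
  by move=> x Dx; rewrite -[LHS]/(f x - f' x) f0 // f0' // subrr.
exists (g - g'); first exact: sG.2.
by move=> x Cx; rewrite -[LHS]/(g x - g' x) gf // gf'.
Qed.

Lemma layer_indS U : Q (ind U) -> U `<=` D.
Proof.
by move=> [U0 _] x Ux; apply/not_notP => /U0; rewrite indT.
Qed.

Lemma layer_indI U V : Q (ind U) -> Q (ind V) -> Q (ind (U `&` V)).
Proof.
move=> QU QV; have [_ [g Gg gU]] := QU; have [_ [h Gh hV]] := QV; split.
  by move=> x nDx; apply: indF => -[/(layer_indS QU)].
exists (fun x => Num.min (g x) (h x)); first exact: Gmin.
move=> x Cx; rewrite gU // hV // ind_setI -[RHS]/(ind U x * ind V x).
by rewrite /ind; case: ifP; case: ifP.
Qed.

Lemma layer_indD U V : Q (ind U) -> Q (ind V) -> Q (ind (U `\` V)).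
Proof.
move=> QU QV; have -> : ind (U `\` V) = ind U - ind (U `&` V).
  by rewrite setDE ind_setI ind_setC mulrBr -!ind_setI setIT.
by apply: sgrp_layer.2 => //; exact: layer_indI.
Qed.

Lemma layer_indU U V : Q (ind U) -> Q (ind V) -> Q (ind (U `|` V)).
Proof.
move=> QU QV; have -> : ind (U `|` V) = ind U + ind (V `\` U).
  apply/funext => x; rewrite -[RHS]/(ind U x + ind (V `\` U) x).
  have [Ux|nUx] := pselect (U x).
    by rewrite (indT Ux) indT ?indF ?addr0 // => [[]|]; [|left].
  rewrite (indF nUx) add0r.
  have [Vx|nVx] := pselect (V x); first by rewrite !indT //; right.
  by rewrite !indF // => -[].
by apply: sgrpD; [exact: sgrp_layer|exact: QU|exact: layer_indD].
Qed.

Lemma layer_ind0 : Q (ind set0).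
Proof.
have -> : ind set0 = 0 :> (T -> int) by apply/funext => x; exact: indF.
exact: sgrp_layer.1.
Qed.

Lemma layer_ind_small h : G h -> (forall y, C y -> 0 <= h y <= 1) ->
  Q (ind (C `&` [set x | 0 < h x])).
Proof.
move=> Gh h01; split.
  move=> x nDx; apply: indF => -[Cx /= hx]; apply: nDx; apply/DP => //.
  by exists h; split=> //; have := h01 x Cx; lia.
exists h => // x Cx; have := h01 x Cx.
have [hx|hx] := ltP 0 (h x); first by rewrite indT //; lia.
by rewrite indF; [lia|move=> [_ /=]; lia].
Qed.

(** Truncating the positive part of [g] by a function with values 0 and 1 on [C] gives again such a
    function. *)
Lemma layer_base x g : D x -> G g -> 0 < g x ->
  exists U, [/\ Q (ind U), U x & forall y, U y -> 0 < g y].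
Proof.
move=> Dx Gg gx; have Cx := DC Dx; have [h [Gh h01 hx]] := (DP Cx).1 Dx.
pose k y := Num.min (h y) (Num.max (g y) 0).
exists (C `&` [set y | 0 < k y]); split.
- apply: layer_ind_small; first by apply: Gmin => //; exact: Gpos.
  by move=> y Cy; have := h01 y Cy; rewrite /k; lia.
- by split=> //=; rewrite /k hx; lia.
- by move=> y [_ /=]; rewrite /k; lia.
Qed.

Lemma layer_point x : D x -> exists2 U, Q (ind U) & U x.
Proof.
move=> Dx; have Cx := DC Dx; have [h [Gh h01 hx]] := (DP Cx).1 Dx.
have [|U [QU Ux _]] := layer_base Dx Gh; first by rewrite hx.
by exists U.
Qed.

(** Compactness covers [{g > 0}] by finitely many functions. Its points outside [C] must be covered
    as well, by functions nonpositive on [C], which leave no trace there. *)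
Lemma layer_ind_gt0 g : G g -> C `&` [set x | 0 < g x] `<=` D ->
  Q (ind (C `&` [set x | 0 < g x])).
Proof.
move=> Gg WD.
pose F := [set h | G h /\ ((forall y, C y -> 0 <= h y <= 1) \/ (forall y, C y -> h y <= 0))].
have [||s [sF scov]] := Gcompact (F := F) Gg.
- by move=> h [].
- move=> x gx; have [Cx|nCx] := pselect (C x).
    have [h [Gh h01 hx]] := (DP Cx).1 (WD x (conj Cx gx)).
    by exists h; [split=> //; left|rewrite hx].
  have [_ /(_ x (Gdom Gg gx) nCx) [h [Gh hx hC]]] := Ccl.
  by exists h => //; split=> //; right.
have [U QU sU] : exists2 U, Q (ind U) & forall h, h \in s ->
    C `&` [set x | 0 < h x] `<=` U.
  elim: s sF {scov} => [|h s IH] sF; first by exists set0 => //; exact: layer_ind0.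
  have [|U QU sU] := IH; first by move=> k ks; apply: sF; rewrite inE ks orbT.
  have Qh : Q (ind (C `&` [set x | 0 < h x])).
    have [|Gh [h01|h0]] := sF h; first by rewrite inE eqxx.
      exact: layer_ind_small.
    suff -> : C `&` [set x | 0 < h x] = set0 by exact: layer_ind0.
    by apply/seteqP; split=> // x [/h0 h1 /=]; lia.
  exists ((C `&` [set x | 0 < h x]) `|` U); first exact: layer_indU.
  move=> k; rewrite inE => /orP[/eqP ->|/sU kU]; first exact: subsetUl.
  by move=> x /kU; right.
have [_ [u Gu uU]] := QU; split.
  by move=> x nDx; apply: indF => /WD.
(* On [C] this is 1 where [g] is positive, since [u] is 1 there and [g] integral, and 0
   elsewhere. *)
exists (fun x => Num.min (u x) (Num.max (g x) 0)); first by apply: Gmin => //; exact: Gpos.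
move=> x Cx; rewrite uU //; have [gx|gx] := ltP 0 (g x).
  have [h hs hx] := scov x gx.
  by rewrite !indT //; [lia|apply: sU hs _ _; split].
rewrite (@indF _ (C `&` _)); last by move=> [_ /=]; lia.
by rewrite /ind; case: ifP => _; lia.
Qed.

Lemma layer_pos f : Q f -> Q (fun x => Num.max (f x) 0).
Proof.
move=> [f0 [g Gg gf]]; split; first by move=> x /f0 ->; lia.
by exists (fun x => Num.max (g x) 0); [exact: Gpos|move=> x /gf ->].
Qed.

Lemma layer_gt0 f : Q f -> Q (ind [set x | 0 < f x]).
Proof.
move=> [f0 [g Gg gf]].
have -> : [set x | 0 < f x] = C `&` [set x | 0 < g x].
  apply/seteqP; split=> x /=; last by move=> [Cx]; rewrite gf.
  move=> fx; have Cx : C x.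
    by apply: DC; apply/not_notP => /f0 e; rewrite e in fx.
  by rewrite gf.
apply: layer_ind_gt0 => // x [Cx /=]; rewrite gf // => fx.
by apply/not_notP => /f0 e; rewrite e in fx.
Qed.

Lemma layer_bounded f : Q f -> exists n : nat, forall x, f x <= n%:Z.
Proof.
move=> [f0 [g Gg gf]].
pose F := [set h | G h /\ exists n : nat, forall y, C y -> 0 < h y -> g y <= n%:Z].
have [||s [sF scov]] := Gcompact (F := F) Gg.
- by move=> h [].
- move=> x gx; have [Cx|nCx] := pselect (C x); last first.
    have [_ /(_ x (Gdom Gg gx) nCx) [h [Gh hx hC]]] := Ccl.
    exists h => //; split=> //; exists 0%N => y /hC; lia.
  have Dx : D x by apply/not_notP => /f0; rewrite -gf //; lia.
  have [u [Gu u01 ux]] := (DP Cx).1 Dx.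
  (* With this [k] the function [k * u - g] equals 1 at [x], and where it is positive on [C], [g] is
     below [k * u], hence below [k]. *)
  pose k := `|(g x + 1)%R|%N.
  have E y : (u *~ k%:Z - g) y = u y * k%:Z - g y.
    by rewrite -[LHS]/((u *~ k%:Z) y - g y) fct_mulrzE -mulrzr intz.
  exists (u *~ k%:Z - g).
    split; first by apply: sG.2 => //; exact: sgrpMz.
    exists k => y Cy; rewrite E; have := u01 y Cy; nia.
  by rewrite E ux /k; lia.
have [n sn] : exists n : nat, forall h, h \in s -> forall y, C y -> 0 < h y -> g y <= n%:Z.
  elim: s sF {scov} => [|h s IH] sF; first by exists 0%N.
  have [|n sn] := IH; first by move=> k ks; apply: sF; rewrite inE ks orbT.
  have [|Gh [m hm]] := sF h; first by rewrite inE eqxx.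
  exists (n + m)%N => k; rewrite inE => /orP[/eqP ->|/sn kn] y Cy ky.
    have := hm y Cy ky; lia.
  have := kn y Cy ky; lia.
exists n => x; have [Dx|/f0 ->] := pselect (D x); last by [].
have Cx := DC Dx; rewrite -gf //; have [gx|] := ltP 0 (g x); last by lia.
by have [h hs hx] := scov x gx; exact: sn hx.
Qed.

(** Subtracting from a nonnegative [f] the indicator of [{f > 0}] lowers its bound by one;
    boundedness ends the process. *)
Lemma layer_span : Q `<=` zspan [set ind U | U in [set U | Q (ind U)]].
Proof.
set Z := zspan _; have sZ : sgrp Z by exact: sgrp_zspan.
have pos (n : nat) f : Q f -> (forall x, 0 <= f x <= n%:Z) -> Z f.
  elim: n f => [|n IH] f Qf fn.
    have -> : f = 0 by apply/funext => x; have := fn x; rewrite -[RHS]/(0 : int); lia.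
    exact: sZ.1.
  have Qi := layer_gt0 Qf.
  rewrite -[f](subrK (ind [set x | 0 < f x])); apply: sgrpD => //; last first.
    by apply: zspan_gen; exists [set x | 0 < f x].
  apply: IH; first exact: sgrp_layer.2.
  move=> x; rewrite -[(_ - _) x]/(f x - ind [set x | 0 < f x] x).
  have := fn x; have [fx|fx] := ltP 0 (f x); first by rewrite indT //; lia.
  by rewrite indF /=; lia.
move=> f Qf.
have QNf : Q (- f) by apply: sgrpN => //; exact: sgrp_layer.
have [n fn] := layer_bounded Qf; have [m fm] := layer_bounded QNf.
have -> : f = (fun x => Num.max (f x) 0) - (fun x => Num.max ((- f) x) 0).
  apply/funext => x; rewrite -[RHS]/(Num.max (f x) 0 - Num.max (- f x) 0); lia.
apply: sZ.2; [apply: (pos n)|apply: (pos m)]; try exact: layer_pos.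
  by move=> x; have := fn x; lia.
by move=> x; have := fm x; lia.
Qed.

Lemma layer_free p : ~ X p -> free_mod [set 0] Q.
Proof.
move=> nXp; apply: (@free_indicator_span _ p).
- exact: sgrp_layer.
- by move=> f [f0 _]; apply: f0 => /DC; case: Ccl => CX _ /CX.
- exact: layer_indI.
- exact: layer_span.
Qed.

(** * Topology of a layer and its compactly supported functions *)

Let tau := subspace op D.

Lemma layer_openP V : tau V <-> V `<=` D /\
  forall x, V x -> exists U, [/\ Q (ind U), U x & U `<=` V].
Proof.
split.
  move=> [W [/opP [WX Wop] ->]]; split; first by move=> x [].
  move=> x [Wx Dx]; have [g [Gg gx gW]] := Wop x Wx.
  have [U [QU Ux Ug]] := layer_base Dx Gg gx.
  exists U; split=> // y Uy; split; last exact: (layer_indS QU).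
  by apply: gW; exact: Ug.
move=> [VD Vop].
(* The largest open set whose trace on [D] lies in [V]. *)
exists [set x | X x /\ exists g, [/\ G g, 0 < g x & forall y, D y -> 0 < g y -> V y]].
split.
  apply/opP; split; first by move=> x [].
  move=> x [Xx [g [Gg gx gV]]]; exists g; split=> // y gy; split.
    exact: Gdom gy.
  by exists g.
apply/seteqP; split=> x.
  move=> Vx; have Dx := VD x Vx; split=> //; split.
    by case: Ccl => CX _; apply: CX; exact: DC.
  have [U [[_ [g Gg gU]] Ux UV]] := Vop x Vx.
  exists g; split=> //; first by rewrite gU ?indT //; exact: DC.
  move=> y Dy; rewrite gU; last exact: DC.
  by have [Uy|nUy] := pselect (U y); [rewrite indT // => _; exact: UV|rewrite indF].
by move=> [[Xx [g [Gg gx gV]]] Dx]; exact: gV.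
Qed.

(** [U] is the trace on [C] of a compact set [{g > 0}]; points of the latter outside [C] are covered
    by functions nonpositive on [C]. *)
Lemma layer_compact U : Q (ind U) -> compact_in tau U.
Proof.
move=> QU Fam Fop cov; have [_ [g Gg gU]] := QU; have UD := layer_indS QU.
pose F := [set h | G h /\ ((exists2 V, Fam V & forall y, C y -> 0 < h y -> V y) \/
   (forall y, C y -> h y <= 0))].
have [||s [sF scov]] := Gcompact (F := F) Gg.
- by move=> h [].
- move=> x gx; have [Cx|nCx] := pselect (C x); last first.
    have [_ /(_ x (Gdom Gg gx) nCx) [h [Gh hx hC]]] := Ccl.
    by exists h => //; split=> //; right.
  have Ux : U x by apply/not_notP => nUx; move: gx; rewrite gU // indF.
  have [V [FV Vx]] := cov x Ux.
  have [_ /(_ x Vx) [U' [[_ [h Gh hU']] U'x U'V]]] := (layer_openP V).1 (Fop V FV).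
  exists h; last by rewrite hU' // indT.
  split=> //; left; exists V => // y Cy; rewrite hU' // => iy.
  by apply: U'V; apply/not_notP => ny; rewrite indF in iy.
have [l [lF ls]] : exists l : seq (set T), (forall V, List_In V l -> Fam V) /\
    forall h, h \in s -> (exists2 V, List_In V l & forall y, C y -> 0 < h y -> V y) \/
       (forall y, C y -> h y <= 0).
  elim: s sF {scov} => [|h s IH] sF; first by exists [::].
  have [|l [lF ls]] := IH; first by move=> k ks; apply: sF; rewrite inE ks orbT.
  have [|Gh [[V FV hV]|h0]] := sF h; first by rewrite inE eqxx.
    exists (V :: l); split; first by move=> W [<-|/lF].
    move=> k; rewrite inE => /orP[/eqP ->|/ls [[W Wl kW]|k0]].
    - by left; exists V => //; left.
    - by left; exists W => //; right.
    - by right.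
  exists l; split=> // k; rewrite inE => /orP[/eqP ->|/ls //]; by right.
exists l; split=> // x Ux; have Cx := DC (UD x Ux).
have [|h hs hx] := scov x; first by rewrite gU // indT.
have [[V Vl hV]|h0] := ls h hs; first by exists V; split=> //; exact: hV.
by have := h0 x Cx; lia.
Qed.

Lemma layer_loc_cst f : Q f -> forall x, D x ->
  exists U, [/\ Q (ind U), U x & forall y, U y -> f y = f x].
Proof.
pose P := [set f : T -> int | forall x, D x ->
  exists U, [/\ Q (ind U), U x & forall y, U y -> f y = f x]].
move=> /layer_span; apply: (@zspan_min _ _ P).
  split.
    by move=> x Dx; have [U QU Ux] := layer_point Dx; exists U.
  move=> f1 f2 h1 h2 x Dx; have [U [QU Ux fU]] := h1 x Dx.
  have [V [QV Vx fV]] := h2 x Dx; exists (U `&` V); split=> //; first exact: layer_indI.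
  move=> y [Uy Vy]; rewrite -[LHS]/(f1 y - f2 y) -[RHS]/(f1 x - f2 x).
  by rewrite fU // fV.
move=> _ [V QV <-] x Dx; have [Vx|nVx] := pselect (V x).
  by exists V; split=> // y Vy; rewrite !indT.
have [U QU Ux] := layer_point Dx; exists (U `\` V); split=> //.
  exact: layer_indD.
by move=> y [Uy nVy]; rewrite !indF.
Qed.

Lemma continuous_supp_closure f : continuous_Z tau D f ->
  closure_in tau D [set y | D y /\ f y != 0] = [set y | D y /\ f y != 0].
Proof.
move=> cf; apply/seteqP; split=> y; last first.
  by move=> [Dy fy]; split=> // V _ Vy; exists y.
move=> [Dy h]; split=> //.
have [|a [[Da fa] [_ /= ay]]] := h _ (cf [set f y]); first by split.
by rewrite -ay.
Qed.

(* The layer is locally compact and zero-dimensional, with the compact open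
   sets [U] such that [layer_group (ind U)] as a basis. *)
Lemma layer_CcE : Cc tau D = Q.
Proof.
apply/seteqP; split=> f.
  move=> [f0 [cf]]; rewrite (continuous_supp_closure cf) => kf.
  pose Fam := [set U | Q (ind U) /\ exists c, forall y, U y -> f y = c].
  have [||l [lF lcov]] := kf Fam.
  - move=> U [QU _]; apply/layer_openP; split; first exact: layer_indS.
    by move=> x Ux; exists U; split.
  - move=> x [Dx fx].
    have [_ /(_ x) [|U [QU Ux Uf]]] := (layer_openP _).1 (cf [set f x]); first by split.
    by exists U; split=> //; split=> //; exists (f x) => y /Uf [].
  have [L [QL QfL lL]] : exists L, [/\ Q (ind L), Q (f * ind L) &
      forall U, List_In U l -> U `<=` L].
    elim: l lF {lcov} => [|U l IH] lF.
      exists set0; split=> //; first exact: layer_ind0.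
      suff -> : f * ind set0 = 0 by exact: sgrp_layer.1.
      by apply/funext => x; rewrite -[LHS]/(f x * ind set0 x) indF // mulr0.
    have [|L [QL QfL lL]] := IH; first by move=> V Vl; apply: lF; right.
    have [QU [c fc]] := lF U (or_introl erefl).
    exists (U `|` L); split; first exact: layer_indU.
      (* Only the part of [U] not yet in [L] is new, and [f] is the constant [c] there. *)
      have -> : f * ind (U `|` L) = f * ind L + ind (U `\` L) *~ c.
        apply/funext => x.
        rewrite -[LHS]/(f x * ind (U `|` L) x).
        rewrite -[RHS]/(f x * ind L x + (ind (U `\` L) *~ c) x) fct_mulrzE.
        have [Lx|nLx] := pselect (L x).
          rewrite (indT Lx) (@indF _ (U `\` L)) ?mul0rz ?addr0; last by case.
          by rewrite indT //; right.
        rewrite (indF nLx) mulr0 add0r.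
        have [Ux|nUx] := pselect (U x).
          by rewrite !indT // ?mulr1 ?intz; [exact: fc|left].
        by rewrite !indF ?mulr0 ?mul0rz // => -[].
      apply: sgrpD => //; first exact: sgrp_layer.
      apply: sgrpMz; first exact: sgrp_layer.
      exact: layer_indD.
    by move=> V [<-|/lL VL]; [exact: subsetUl|move=> x /VL; right].
  suff -> : f = f * ind L by [].
  apply/funext => x; rewrite -[RHS]/(f x * ind L x).
  have [fx0|fx] := eqVneq (f x) 0; first by rewrite fx0 mul0r.
  have Dx : D x by apply/not_notP => /f0 e; rewrite e eqxx in fx.
  have [U [Ul Ux]] := lcov x (conj Dx fx).
  by rewrite indT ?mulr1 //; exact: lL Ux.
move=> Qf; have [f0 _] := Qf.
have cf : continuous_Z tau D f.
  move=> A; apply/layer_openP; split; first by move=> x [].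
  move=> x [Dx Ax]; have [U [QU Ux Uf]] := layer_loc_cst Qf Dx.
  exists U; split=> // y Uy; split; first exact: (layer_indS QU).
  by rewrite /preimage /= Uf.
split=> //; split=> //; rewrite (continuous_supp_closure cf).
apply: layer_compact.
have QNf : Q (- f) by apply: sgrpN => //; exact: sgrp_layer.
have := layer_indU (layer_gt0 Qf) (layer_gt0 QNf); congr (Q (ind _)).
apply/seteqP; split=> x /=; rewrite -?[(- f) x]/(- f x).
  move=> fx; suff fx0 : f x != 0 by split=> //; apply/not_notP => /f0 /eqP; rewrite (negbTE fx0).
  by case: fx; lia.
by move=> [_ fx]; have [?|?] := ltP 0 (f x); [left|right; lia].
Qed.

(** Basis elements of the free group [Q] are lifted to [G] arbitrarily and the lifts extended
    additively. *)
Lemma layer_section p : ~ X p -> exists s : (T -> int) -> (T -> int),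
  additive_on Q s /\ forall f, Q f -> G (s f) /\ forall x, C x -> s f x = f x.
Proof.
move=> nXp; have [B bB] := layer_free nXp; have sQ := sgrp_layer.
have QE := basis_mod_span0 sQ bB.
have [l lP] : {l : (T -> int) -> (T -> int) & forall f, Q f ->
    G (l f) /\ forall x, C x -> l f x = f x}.
  apply: (@choice _ _ (fun f g => Q f -> G g /\ forall x, C x -> g x = f x)) => f.
  have [[_ [g Gg gf]]|nQ] := pselect (Q f); last by exists 0.
  by exists g.
have [s [sadd sB]] := basis_extend l sQ bB.
exists s; split=> //.
pose P := [set f | Q f /\ (G (s f) /\ forall x, C x -> s f x = f x)].
suff : Q `<=` P by move=> h f /h [].
rewrite {1}QE; apply: zspan_min; last first.
  move=> b Bb; have Qb : Q b by case: bB => h _ _; exact: h.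
  by split=> //; rewrite sB //; exact: lP.
split.
  split; first exact: sQ.1.
  by rewrite (additive_on0 sQ sadd); split=> //; exact: sG.1.
move=> f g [Qf [Gf Cf]] [Qg [Gg Cg]]; split; first exact: sQ.2.
rewrite (additive_onB sQ sadd) //; split; first exact: sG.2.
by move=> x Cx; rewrite -[LHS]/(s f x - s g x) Cf // Cg.
Qed.

End Layers.

Lemma sum_support (J : eqType) (V : zmodType) (F : J -> V) (s t : seq J) :
  uniq s -> uniq t -> (forall j, F j != 0 -> j \in s /\ j \in t) ->
  \sum_(j <- s) F j = \sum_(j <- t) F j.
Proof.
move=> us ut st.
have nz (r : seq J) : \sum_(j <- r) F j = \sum_(j <- [seq j <- r | F j != 0]) F j.
  rewrite big_filter [RHS]big_mkcond; apply: eq_bigr => j _.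
  by case: eqP.
rewrite (nz s) (nz t); apply: perm_big; apply: uniq_perm; try exact: filter_uniq.
move=> j; rewrite !mem_filter; case: (boolP (F j != 0)) => //= /st [-> ->] //.
Qed.

(** The coordinate map is the additive extension of the map sending a basis element to its own delta
    function. *)
Lemma free_abelian_basis (A : zmodType) (H B : set A) :
  sgrp H -> basis_mod [set 0] H B -> free_abelian H (fun x y => x + y).
Proof.
move=> sH bB; have HE := basis_mod_span0 sH bB; have [BH _ _] := bB.
pose Bt := {b : A | B b}.
pose l (b : A) : Bt -> int := fun b' => if sval b' == b then 1 else 0.
have [f [fadd fB]] := basis_extend l sH bB.
have fE s c (b : Bt) : uniq s -> (forall b, b \in s -> B b) ->
    f (lincomb s c) b = if sval b \in s then c (sval b) else 0.
  move=> us sB; rewrite /lincomb (additive_on_sum sH fadd); last first.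
    by move=> a /sB /BH; exact: sgrpMz.
  rewrite fct_sumE; transitivity (\sum_(a <- s) if a == sval b then c a else 0).
    apply: eq_big_seq => a as_; rewrite (additive_onMz _ sH fadd); last by apply: BH; exact: sB.
    rewrite fct_mulrzE fB; last exact: sB.
    by rewrite /l eq_sym; case: eqP => // _; rewrite ?intz ?mul0rz.
  case: ifP => [bs|nbs].
    rewrite (bigD1_seq (sval b)) //= eqxx big1 ?addr0 // => a /negbTE ->.
    by [].
  rewrite big_seq big1 // => a as_; case: eqP => // e.
  by rewrite -e as_ in nbs.
exists Bt, f; split; [|split; [|split]].
- move=> x; rewrite HE => -[s [c [us sB ->]]].
  have [t st] : exists t : seq Bt, forall b : Bt, sval b \in s -> List_In b t.
    elim: s sB {us} => [|a s IH] sB; first by exists [::].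
    have [|t st] := IH; first by move=> b bs; apply: sB; rewrite inE bs orbT.
    have Ba : B a by apply: sB; rewrite inE eqxx.
    exists (exist _ a Ba :: t) => -[b Bb] /=; rewrite inE => /orP[/eqP e|bs].
      by left; apply: eq_exist; rewrite e.
    by right; exact: st.
  exists t => b; rewrite fE // => h; apply: st.
  by move: h; case: ifP.
- move=> x y Hx Hy e; apply/eqP; rewrite -subr_eq0; apply/eqP.
  have fxy : f (x - y) = 0 by rewrite (additive_onB sH fadd) // e subrr.
  have : H (x - y) by exact: sH.2.
  rewrite HE => -[s [c [us sB xyE]]]; rewrite xyE /lincomb big_seq big1 // => b bs.
  have := congr1 (fun g => g (exist _ b (sB b bs))) fxy.
  by rewrite /= xyE fE //= bs => ->; rewrite mulr0z.
- move=> z [t zt].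
  pose c (b : A) : int := if pselect (B b) is left Bb then z (exist _ b Bb) else 0.
  pose s : seq A := undup [seq sval b | b : {classic Bt} <- t].
  have tB b : b \in s -> B b.
    by rewrite mem_undup => /mapP [[b' Bb'] _ ->].
  have us : uniq s by exact: undup_uniq.
  exists (lincomb s c); split; first by apply: sgrp_lincomb => // b /tB /BH.
  apply/funext => b; rewrite fE // /c.
  have -> : (if pselect (B (sval b)) is left Bb then z (exist _ (sval b) Bb) else 0) = z b.
    case: b => b Bb /=; case: pselect => // Bb'; congr z; exact: eq_exist.
  case: ifP => // nbs; apply/esym/eqP; apply/not_notP => /negP zb.
  move/negP: nbs; apply; rewrite mem_undup.
  have := zt b zb; elim: (t) => //= b' t' IH [->|/IH h].
    by rewrite inE eqxx.
  by rewrite inE h orbT.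
- by move=> x y Hx Hy; rewrite fadd.
Qed.

(** * The direct sum decomposition *)

Section WellOrder.
Variables (d : Order.disp_t) (I : orderType d).
Hypothesis wfI : well_founded (fun x y : I => (x < y)%O).

Lemma wf_min (P : set I) i : P i -> exists2 m, P m & forall j, P j -> (m <= j)%O.
Proof.
elim/(well_founded_ind wfI): i => i IH Pi.
have [[j [ji Pj]]|nex] := pselect (exists j, (j < i)%O /\ P j); first exact: IH Pj.
exists i => // j Pj; rewrite leNgt; apply/negP => ji.
by apply: nex; exists j.
Qed.

Lemma is_succ_exists (i j : I) : (i < j)%O -> exists k, is_succ i k.
Proof.
move=> ij; have [m im mmin] := @wf_min [set k | (i < k)%O] j ij.
by exists m; split=> // k [ik km]; have := mmin k ik; rewrite leNgt km.
Qed.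

Lemma is_succ_le (i j k : I) : is_succ i j -> (i < k)%O -> (j <= k)%O.
Proof.
by move=> [_ h] ik; rewrite leNgt; apply/negP => kj; exact: (h k).
Qed.

Lemma is_succ_uniq (i j k : I) : is_succ i j -> is_succ i k -> j = k.
Proof.
move=> ij ik; apply/eqP; rewrite eq_le (is_succ_le ij ik.1) (is_succ_le ik ij.1).
by [].
Qed.

Lemma lt_is_succ (i j k : I) : is_succ i j -> (k < j)%O -> (k <= i)%O.
Proof.
by move=> [_ h] kj; rewrite leNgt; apply/negP => ik; exact: (h k).
Qed.

End WellOrder.

(** * Splitting the filtration along the layers *)

Section Assembly.
Variables (K : fieldType) (X : set (set K)) (G : set (set K -> int)).
Hypotheses (sG : sgrp G)
  (Gmin : forall g h, G g -> G h -> G (fun x => Num.min (g x) (h x)))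
  (Goff : forall g x, G g -> ~ X x -> g x = 0)
  (Gcompact : forall g (F : set (set K -> int)), G g -> F `<=` G ->
     (forall x, 0 < g x -> exists2 h, F h & 0 < h x) ->
     exists s : seq (set K -> int), (forall h, h \in s -> F h) /\
       forall x, 0 < g x -> exists2 h, h \in s & 0 < h x).
Variables (d : Order.disp_t) (I : orderType d) (C : I -> set (set K)) (alpha : I) (p : set K).
Hypotheses (wfI : well_founded (fun x y : I => (x < y)%O)) (nXp : ~ X p)
  (Ccl : forall i, gclosed X G (C i))
  (Cmono : forall i j, (i < j)%O -> C j `<=` C i)
  (Cstep : forall i j, is_succ i j -> forall x, C j x <-> C i x /\
     ~ exists g, [/\ G g, (forall y, C i y -> 0 <= g y <= 1) & g x = 1])
  (Clim : forall j, (forall i, ~ is_succ i j) -> forall x, X x ->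
     (forall i, (i < j)%O -> C i x) -> C j x)
  (C0 : C alpha = set0).

Let D := crit_layer C.
Let Q i := layer_group G (C i) (D i).

Lemma crit_layerS i : D i `<=` C i. Proof. by move=> x []. Qed.

(** Being below [alpha] guarantees a successor; without one, [crit_layer] would be all of [C i]. *)
Lemma crit_layerP i : (i < alpha)%O -> forall x, C i x -> D i x <->
  exists g, [/\ G g, (forall y, C i y -> 0 <= g y <= 1) & g x = 1].
Proof.
move=> ia x Cx; have [j ij] := is_succ_exists wfI ia; split.
  move=> [_ h]; apply/not_notP => ng; apply: (h j ij); apply/(Cstep ij); split=> //.
move=> hg; split=> // k /is_succ_uniq -/(_ _ ij) ->.
by move=> /(Cstep ij) [_]; apply.
Qed.

Lemma crit_layer_sgrp i : sgrp (Q i).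
Proof. exact: sgrp_layer. Qed.

(** These are the subgroups [G_i]. When [i] has a successor, [vanish_off i] is the next one, written
    without naming that successor. *)
Definition vanish_on i := [set g | G g /\ forall x, C i x -> g x = 0].
Definition vanish_off i := [set g | G g /\ forall x, C i x -> ~ D i x -> g x = 0].

Lemma sgrp_vanish_on i : sgrp (vanish_on i).
Proof.
split; first by split=> //; exact: sG.1.
move=> f g [Gf f0] [Gg g0]; split; first exact: sG.2.
by move=> x Cx; rewrite -[LHS]/(f x - g x) f0 // g0 // subrr.
Qed.

Lemma vanish_off_on i j : (i < alpha)%O -> (i < j)%O -> vanish_off i `<=` vanish_on j.
Proof.
move=> ia ij g [Gg g0]; split=> // x Cx; apply: g0; first exact: Cmono Cx.
have [k ik] := is_succ_exists wfI ia; move=> [_ /(_ k ik)]; apply.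
have := is_succ_le ik ij; rewrite le_eqVlt => /orP[/eqP ->//|kj].
exact: Cmono Cx.
Qed.

(* At a limit stage compactness of the support pushes the vanishing of g
   down to an earlier stage. *)
Lemma vanish_on_cases i g : (i <= alpha)%O -> vanish_on i g -> g = 0 \/
  exists2 j, (j < i)%O & vanish_off j g.
Proof.
move=> ia [Gg g0].
have [[k ki]|nsucc] := pselect (exists k, is_succ k i).
  right; exists k; first by case: ki.
  split=> // x Cx nDx; apply: g0; apply/not_notP => nCx; apply: nDx; split=> // j.
  by move=> /is_succ_uniq -/(_ _ ki) ->.
have lim j : ~ is_succ j i by move=> h; apply: nsucc; exists j.
(* Compactness concerns positivity sets, and [{ag > 0}] is the whole support of [g]. *)
pose ag x := Num.max (g x) (- g x).
have Gag : G ag by exact: (Gmax sG Gmin Gg (sgrpN sG Gg)).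
pose F := [set h | G h /\ exists2 k, (k < i)%O & forall y, C k y -> h y <= 0].
have [||s [sF scov]] := Gcompact (F := F) Gag.
- by move=> h [].
- move=> x gx; have Xx : X x by apply: (Gdom Goff Gag).
  have nCx : ~ C i x by move=> /g0 e; move: gx; rewrite /ag e.
  have [k ki nCk] : exists2 k, (k < i)%O & ~ C k x.
    apply/not_notP => nex; apply: nCx; apply: Clim => // k ki.
    by apply/not_notP => nCk; apply: nex; exists k.
  have [_ /(_ x Xx nCk) [h [Gh hx hC]]] := Ccl k.
  by exists h => //; split=> //; exists k.
(* An empty subcover means [g = 0]; this covers the least index, below which there is no [k]. *)
have [nos|[k ki ks]] : (forall x, ~ 0 < ag x) \/
    exists2 k, (k < i)%O & forall h, h \in s -> forall y, C k y -> h y <= 0.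
  case: s sF scov => [|h s] sF scov; first by left=> x /scov [].
  right; elim: s h sF {scov} => [|h' s IH] h sF.
    have [|_ [k ki kh]] := sF h; first by rewrite inE.
    by exists k => // h'; rewrite inE => /eqP ->.
  have [|_ [k ki kh]] := sF h; first by rewrite inE eqxx.
  have [|k' k'i ks] := IH h'; first by move=> u us; apply: sF; rewrite inE us orbT.
  have Cle a b : (a <= b)%O -> C b `<=` C a.
    by rewrite le_eqVlt => /orP[/eqP ->|]; [exact: subset_refl|exact: Cmono].
  exists (Order.max k k'); first by rewrite gt_max ki.
  move=> u; rewrite inE => /orP[/eqP ->|us] y Cy.
    by apply: kh; apply: Cle Cy; rewrite le_max lexx.
  by apply: ks us _ _; apply: Cle Cy; rewrite le_max lexx orbT.
- left; apply/funext => x; rewrite -[RHS]/(0 : int); have := nos x; rewrite /ag; lia.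
right; exists k => //; split=> // x Cx _; apply/eqP/not_notP => /negP gx.
have [|h hs hx] := scov x; first by rewrite /ag; lia.
by have := ks h hs x Cx; lia.
Qed.

(** The value 0 at 0 is required at every index, so that a sum over any list containing the support
    of a family has the same value. *)
Lemma sections : exists s : I -> (set K -> int) -> (set K -> int),
  (forall i, s i 0 = 0) /\
  forall i, (i < alpha)%O -> additive_on (Q i) (s i) /\
    forall f, Q i f -> G (s i f) /\ forall x, C i x -> s i f x = f x.
Proof.
suff [s sP] : {s : I -> (set K -> int) -> (set K -> int) & forall i, s i 0 = 0 /\
    ((i < alpha)%O -> additive_on (Q i) (s i) /\
    forall f, Q i f -> G (s i f) /\ forall x, C i x -> s i f x = f x)}.
  by exists s; split=> i; have [] := sP i.
apply: (@choice _ _ (fun i (s : (set K -> int) -> (set K -> int)) => s 0 = 0 /\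
    ((i < alpha)%O -> additive_on (Q i) s /\
    forall f, Q i f -> G (s f) /\ forall x, C i x -> s f x = f x))) => i.
have [ia|nia] := boolP (i < alpha)%O; last by exists (fun=> 0).
have [s [sadd sP]] := layer_section sG Gmin Goff Gcompact (Ccl i)
  (@crit_layerS i) (crit_layerP ia) nXp.
exists s; split=> //; exact: additive_on0 (crit_layer_sgrp i) sadd.
Qed.

Definition restrict i (g : set K -> int) : set K -> int :=
  fun x => if `[< C i x >] then g x else 0.

Lemma restrictE i g x : C i x -> restrict i g x = g x.
Proof. by rewrite /restrict => /asboolP ->. Qed.

Lemma restrict_layer i g : vanish_off i g -> Q i (restrict i g).
Proof.
move=> [Gg g0]; split; last by exists g => // x /restrictE ->.
move=> x nDx; rewrite /restrict; case: asboolP => // Cx.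
exact: g0.
Qed.

Section WithSections.
Variable s : I -> (set K -> int) -> (set K -> int).
Hypotheses (s0 : forall i, s i 0 = 0)
  (sadd : forall i, (i < alpha)%O -> additive_on (Q i) (s i))
  (sG' : forall i f, (i < alpha)%O -> Q i f -> G (s i f))
  (sC : forall i f x, (i < alpha)%O -> Q i f -> C i x -> s i f x = f x).

Lemma section_off i f : (i < alpha)%O -> Q i f -> vanish_off i (s i f).
Proof.
move=> ia Qf; split; first exact: sG'.
by move=> x Cx nDx; rewrite sC //; case: Qf => f0 _; exact: f0.
Qed.

Lemma section_on i f : (i < alpha)%O -> Q i f -> vanish_on i (s i f) -> f = 0.
Proof.
move=> ia Qf [_ h]; apply/funext => x; have [Dx|nDx] := pselect (D i x).
  by rewrite -(sC ia Qf (crit_layerS Dx)) h //; exact: crit_layerS.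
by case: Qf => f0 _; exact: f0.
Qed.

Lemma section_rem i g : (i < alpha)%O -> vanish_off i g ->
  vanish_on i (g - s i (restrict i g)).
Proof.
move=> ia vg; have Qr := restrict_layer vg; split.
  by apply: sG.2; [case: vg|exact: sG'].
move=> x Cx; rewrite -[LHS]/(g x - s i (restrict i g) x) sC //.
by rewrite restrictE // subrr.
Qed.

(** The section at [i] identifies [Q i] with [vanish_off i] modulo [vanish_on i]; the filtration
    exhausts [G] because [C alpha] is empty. *)
Lemma free_G : free_mod [set 0] G.
Proof.
have [B bB] : {B : I -> set (set K -> int) & forall i, (i < alpha)%O ->
    basis_mod (vanish_on i) (vanish_off i) (B i)}.
  apply: (@choice _ _ (fun i B => (i < alpha)%O -> basis_mod (vanish_on i) (vanish_off i) B)) => i.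
  have [ia|nia] := boolP (i < alpha)%O; last by exists set0.
  have [B bB] := layer_free sG Gmin Goff Gcompact (Ccl i) (@crit_layerS i) (crit_layerP ia) nXp.
  exists (s i @` B) => _; apply: (basis_mod_push _ _ (sadd ia) bB).
  - exact: crit_layer_sgrp.
  - exact: sgrp_vanish_on.
  - by move=> f; exact: section_off.
  - move=> f Qf; split; first exact: section_on.
    by move=> ->; rewrite s0; exact: (sgrp_vanish_on i).1.
  - move=> g vg; exists (restrict i g); first exact: restrict_layer.
    exact: section_rem.
exists [set b | exists2 i, (i < alpha)%O & B i b].
apply: (@basis_mod_filtration _ _ (fun i j : I => (i < j)%O) [set i | (i < alpha)%O]
  [set 0] G vanish_on vanish_off B).
- exact: wfI.
- move=> i j; have [ij|ij|->] := ltgtP i j; [by constructor 2|by constructor 3|by constructor 1].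
- by move=> i j k; exact: lt_trans.
- exact: sgrp1.
- by move=> i _; exact: sgrp_vanish_on.
- exact: sG.
- by move=> i _ _ ->; exact: (sgrp_vanish_on i).1.
- by move=> i _ g [].
- by move=> i j ia _; exact: vanish_off_on.
- move=> i g ia /(vanish_on_cases (ltW ia)) [->|[j ji vj]]; first by left.
  right; exists j, g; split=> //; first exact: lt_trans ia.
  by rewrite subrr.
- move=> g Gg; have [||->|[j ji vj]] := @vanish_on_cases alpha g.
  + exact: lexx.
  + by split=> //; rewrite C0.
  + by left.
  + by right; exists j, g; split=> //; rewrite subrr.
- exact: bB.
Qed.

Let S := dsum alpha Q.

Lemma sgrp_dsum : sgrp S.
Proof.
split.
  split; first by move=> i _; exact: (crit_layer_sgrp i).1.
  by split=> //; exists [::] => i [].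
move=> f g [f1 [f2 [t ft]]] [g1 [g2 [u gu]]]; split.
  by move=> i ia; apply: (crit_layer_sgrp i).2; [exact: f1|exact: g1].
split.
  by move=> i ia; rewrite -[LHS]/(f i - g i) f2 // g2 //.
exists (t ++ u) => i; rewrite -[(f - g) i]/(f i - g i) mem_cat => h.
have [fi0|/ft -> //] := pselect (f i = fun=> 0).
have [gi0|/gu -> ] := pselect (g i = fun=> 0); last by rewrite orbT.
by case: h; rewrite fi0 gi0; exact: (@subrr _ (0 : set K -> int)).
Qed.

Let sel (f : I -> set K -> int) : seq I :=
  xget [::] [set t : seq I | forall i : I, f i <> (fun=> 0) -> i \in t].

Let selP f : S f -> forall i, f i <> 0 -> i \in sel f.
Proof.
move=> [_ [_ [t ft]]]; rewrite /sel; case: xgetP => [u _ //|/(_ t)].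
by case.
Qed.

Let psi f := \sum_(i <- undup (sel f)) s i (f i).

Let psiE f t : S f -> uniq t -> (forall i, f i <> 0 -> i \in t) ->
  psi f = \sum_(i <- t) s i (f i).
Proof.
move=> Sf ut ft; apply: sum_support => //; first exact: undup_uniq.
move=> i si; have fi : f i <> 0 by move=> e; move: si; rewrite e s0 eqxx.
by rewrite mem_undup; split; [exact: selP|exact: ft].
Qed.

Let psi_add : additive_on S psi.
Proof.
move=> f g Sf Sg; pose t := undup (sel f ++ sel g).
have ut : uniq t by exact: undup_uniq.
have tf i : f i <> 0 -> i \in t by move=> /(selP Sf) h; rewrite mem_undup mem_cat h.
have tg i : g i <> 0 -> i \in t by move=> /(selP Sg) h; rewrite mem_undup mem_cat h orbT.
rewrite (psiE Sf ut tf) (psiE Sg ut tg) (@psiE _ t) //; last first.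
- move=> i; rewrite -[(f + g) i]/(f i + g i) => h.
  have [fi|/tf //] := pselect (f i = 0); apply: tg => gi; apply: h.
  by rewrite fi gi addr0.
- by apply: sgrpD => //; exact: sgrp_dsum.
rewrite -big_split; apply: eq_bigr => i _ /=.
rewrite -[(f + g) i]/(f i + g i); case: (boolP (i < alpha)%O) => ia.
  by apply: sadd => //; [case: Sf => h _; exact: h|case: Sg => h _; exact: h].
have fi : f i = 0 by case: Sf => _ [/(_ i (negP ia))].
have gi : g i = 0 by case: Sg => _ [/(_ i (negP ia))].
by rewrite fi gi addr0 s0 addr0.
Qed.

Let psi_G f : S f -> G (psi f).
Proof.
move=> Sf; apply: sgrp_sum => // i _; case: (boolP (i < alpha)%O) => ia.
  by apply: sG' => //; case: Sf => h _; exact: h.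
have fi : f i = 0 by case: Sf => _ [/(_ i (negP ia))].
by rewrite fi s0; exact: sG.1.
Qed.

(** At the largest index [m] of the support, the lift of [f m] is minus the sum of the earlier
    lifts, all of which vanish on [C m]; so [f m] is 0. *)
Let psi_ker f : S f -> psi f = 0 -> f = 0.
Proof.
move=> Sf pf; apply/not_notP => fn0.
have [i fi] : exists i, f i <> 0.
  apply/not_notP => nex; apply: fn0; apply/funext => i.
  by apply/not_notP => h; apply: nex; exists i.
pose t := [seq i <- undup (sel f) | f i != 0].
have it : i \in t by rewrite mem_filter mem_undup (selP Sf) // andbT; apply/eqP.
have ut : uniq t by apply: filter_uniq; exact: undup_uniq.
have tf j : f j <> 0 -> j \in t.
  by move=> h; rewrite mem_filter mem_undup (selP Sf) // andbT; apply/eqP.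
have [m mt mmax] : exists2 m, m \in t & forall j, j \in t -> (j <= m)%O.
  case tE : t it => [//|a t'] _.
  have [i' j'|i' j' k'|m mt mm] := @seq_has_max _ _ (fun i j : I => (i < j)%O) id t' a.
  - by have [ij|ij|->] := ltgtP i' j'; [constructor 2|constructor 3|constructor 1].
  - exact: lt_trans.
  - by exists m => // j /mm [->|/ltW].
have lta j : j \in t -> (j < alpha)%O.
  rewrite mem_filter => /andP[/eqP fj _]; apply/negP => /negP ja.
  by apply: fj; have [_ [/(_ j (negP ja))]] := Sf.
have Qj j : (j < alpha)%O -> Q j (f j) by case: Sf => h _; exact: h.
have ma := lta m mt.
suff : f m = 0 by move: mt; rewrite mem_filter => /andP[/eqP].
apply: (section_on ma (Qj m ma)).
have -> : s m (f m) = - \sum_(j <- t | j != m) s j (f j).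
  apply/eqP; rewrite -addr_eq0 -(bigD1_seq m) //= -(psiE Sf ut tf) pf.
  by [].
apply: sgrpN; first exact: sgrp_vanish_on.
rewrite -big_filter; apply: sgrp_sum; first exact: sgrp_vanish_on.
move=> j; rewrite mem_filter => /andP[jm jt].
apply: (@vanish_off_on j); [exact: lta|by rewrite lt_neqAle jm mmax|].
by apply: section_off; [exact: lta|apply: Qj; exact: lta].
Qed.

(** Subtracting the lift of its restriction moves [g] to an earlier stage, and well-foundedness
    stops this after finitely many steps. *)
Let psi_surj g : G g -> exists2 f, S f & psi f = g.
Proof.
move=> Gg.
have sIm : sgrp [set g | exists2 f, S f & psi f = g].
  split.
    exists 0; first exact: sgrp_dsum.1.
    exact: additive_on0 sgrp_dsum psi_add.
  move=> _ _ [f Sf <-] [f' Sf' <-]; exists (f - f'); first exact: sgrp_dsum.2.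
  exact: additive_onB sgrp_dsum psi_add Sf Sf'.
have ImU i : (i < alpha)%O -> vanish_off i `<=` [set g | exists2 f, S f & psi f = g].
  elim/(well_founded_ind wfI): i => i IH ia {g Gg} g vg.
  have Qr := restrict_layer vg.
  rewrite -[g](subrK (s i (restrict i g))); apply: sgrpD => //.
    have [->|[j ji vj]] := vanish_on_cases (ltW ia) (section_rem ia vg); first exact: sIm.1.
    by apply: (IH j ji _ _ vj); exact: lt_trans ia.
  pose f j := if j == i then restrict i g else 0.
  have fi : f i = restrict i g by rewrite /f eqxx.
  have Sf : S f.
    split; first by move=> j ja; rewrite /f; case: eqP => [->//|_]; exact: (crit_layer_sgrp j).1.
    split; first by move=> j ja; rewrite /f; case: eqP => // e; rewrite e in ja.
    by exists [:: i] => j; rewrite /f inE; case: eqP.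
  exists f => //; rewrite (@psiE f [:: i]) //; first by rewrite big_seq1 fi.
  by move=> j; rewrite /f inE; case: eqP.
have [||->|[j ji vj]] := @vanish_on_cases alpha g.
- exact: lexx.
- by split=> //; rewrite C0.
- exact: sIm.1.
- exact: ImU vj.
Qed.

Lemma dsum_iso : exists psi : (I -> set K -> int) -> (set K -> int),
  [/\ (forall f, S f -> G (psi f)), (forall f g, S f -> S g -> psi f = psi g -> f = g),
      (forall g, G g -> exists2 f, S f & psi f = g) & additive_on S psi].
Proof.
exists psi; split=> // f g Sf Sg e; apply/eqP; rewrite -subr_eq0; apply/eqP.
apply: psi_ker; first exact: sgrp_dsum.2.
by rewrite (additive_onB sgrp_dsum psi_add) // e subrr.
Qed.

End WithSections.
End Assembly.

Theorem theorem5p9 (K : fieldType) (R : set K) (d : Order.disp_t) (I : orderType d)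
    (wfI : well_founded (fun x y : I => (x < y)%O))
    (C : I -> set (set K)) (alpha alpha1 : I) :
  almost_dedekind R ->
  crit_seq R C ->
  (* alpha is the SP-rank: least index with Crit_alpha = Crit_{alpha+1} *)
  is_succ alpha alpha1 -> C alpha = C alpha1 ->
  (forall b b1, (b < alpha)%O -> is_succ b b1 -> C b <> C b1) ->
  (* R is SP-scattered *)
  C alpha = set0 ->
  (exists phi : set K -> I -> set K -> int,
     set_iso (Inv R)
       (dsum alpha (fun i => Cc (subspace (maxtop R) (crit_layer C i)) (crit_layer C i)))
       (@prod_set K) (@dsum_add I (set K)) phi)
  /\ free_abelian (Inv R) (@prod_set K).
Proof.
move=> [sR [qR dvr]] [Csucc Clim] _ _ _ C0.
have [v vR] : {v : set K -> K -> int & local_vals R v}.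
  apply: (@choice _ _ (fun M (w : K -> int) => sr_maximal R M ->
    [/\ (forall x y, x != 0 -> y != 0 -> w (x * y) = w x + w y),
      (forall x y, x != 0 -> y != 0 -> x + y != 0 ->
         Num.min (w x) (w y) <= w (x + y)),
      (exists t, t != 0 /\ w t = 1) &
      localization R M = [set x | x = 0 \/ (x != 0 /\ 0 <= w x)]])) => M.
  have [mM|nM] := pselect (sr_maximal R M); last by exists (fun=> 0).
  by have [w [h1 [h2 [h3 h4]]]] := dvr M mM; exists w.
pose G := nugrp R v.
have sG : sgrp G := sgrp_nugrp sR vR.
have Gmin : forall g h, G g -> G h -> G (fun x => Num.min (g x) (h x)).
  exact: nugrp_min.
have Goff : forall g x, G g -> ~ Max R x -> g x = 0 by move=> g x; exact: nugrp_off.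
have opP := maxtop_nugrpP sR qR vR.
have Gc := nugrp_compact sR vR.
(* A point outside an intersection is outside one of the earlier closed sets. The least index falls
   under the limit clause and gives [Max R]. *)
have Ccl i : max_closed R v (C i).
  elim/(well_founded_ind wfI): i => i IH.
  have [[k ki]|nsucc] := pselect (exists k, is_succ k i).
    by rewrite (Csucc k i ki); apply: max_closed_step => //; apply: IH; case: ki.
  have lim j : ~ is_succ j i by move=> h; apply: nsucc; exists j.
  rewrite (Clim i lim); split; first by move=> M [].
  move=> M mM nCM; have [k ki nCk] : exists2 k, (k < i)%O & ~ C k M.
    apply/not_notP => nex; apply: nCM; split=> // k ki.
    by apply/not_notP => nCk; apply: nex; exists k.
  have [_ /(_ M mM nCk) [g [Gg gM gC]]] := IH k ki; exists g; split=> // N [mN CN].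
  by apply: gC; exact: CN.
have Cstep i j : is_succ i j -> forall x, C j x <-> C i x /\
     ~ exists g, [/\ G g, (forall y, C i y -> 0 <= g y <= 1) & g x = 1].
  by move=> ij x; rewrite (Csucc i j ij); exact: crit_stepP.
have Cmono i j : (i < j)%O -> C j `<=` C i.
  elim/(well_founded_ind wfI): j => j IH ij.
  have [[k kj]|nsucc] := pselect (exists k, is_succ k j); last first.
    rewrite (Clim j); first by move=> M [_]; apply.
    by move=> k kj; apply: nsucc; exists k.
  move=> M /(Cstep k j kj) [CkM _]; have := lt_is_succ kj ij.
  rewrite le_eqVlt => /orP[/eqP -> //|ik].
  by apply: (IH k kj.1 ik).
have Clim' j : (forall i, ~ is_succ i j) -> forall x, Max R x ->
     (forall i, (i < j)%O -> C i x) -> C j x.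
  by move=> lim x mx h; rewrite (Clim j lim).
(* An ideal contains 0, so the empty set can serve as the base point outside [Max R]. *)
have np : ~ Max R (set0 : set K) by move=> [[_ []]].
pose Q i := layer_group G (C i) (crit_layer C i).
have [s [s0 sP]] := sections sG Gmin Goff Gc alpha wfI np Ccl Cstep.
have sadd i : (i < alpha)%O -> additive_on (Q i) (s i) by move=> /sP [].
have sG' i f : (i < alpha)%O -> Q i f -> G (s i f) by move=> /sP [_ h] /h [].
have sC i f x : (i < alpha)%O -> Q i f -> C i x -> s i f x = f x.
  by move=> /sP [_ h] /h [_]; apply.
have QE i : (i < alpha)%O ->
    Cc (subspace (maxtop R) (crit_layer C i)) (crit_layer C i) = Q i.
  move=> ia; apply: (layer_CcE sG Gmin Goff opP Gc (Ccl i)).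
    by move=> x [].
  exact: (crit_layerP wfI Cstep ia).
have -> : dsum alpha (fun i => Cc (subspace (maxtop R) (crit_layer C i)) (crit_layer C i))
    = dsum alpha Q.
  by apply/seteqP; split=> f [h1 h2]; split=> // i ia; have := h1 i ia; rewrite QE.
split; last first.
  have [B bB] := free_G sG Gmin Goff Gc wfI np Ccl Cmono Cstep Clim' C0 s0 sadd sG' sC.
  have [Bt [f [f1 [f2 [f3 f4]]]]] := free_abelian_basis sG bB.
  have GJ J : Inv R J -> G (nu R v J) by move=> iJ; exists J.
  exists Bt, (fun J => f (nu R v J)); split; [|split; [|split]].
  - by move=> J iJ; apply: f1; exact: GJ.
  - move=> J J' iJ iJ' e; apply: (nu_inj sR vR iJ iJ').
    by apply: f2 e; exact: GJ.
  - by move=> z /f3 [_ [[J iJ <-] <-]]; exists J.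
  - move=> J J' iJ iJ'; rewrite -f4; try exact: GJ.
    by congr f; apply/funext => M; rewrite nu_prod.
have [psi [p1 p2 p3 p4]] :=
  dsum_iso sG Gmin Goff Gc wfI Ccl Cmono Clim' C0 s0 sadd sG' sC.
(* [phi] is the inverse of [psi] composed with [nu]; its additivity follows from that of [psi] by
   injectivity. *)
have [phi phiP] : {phi : set K -> I -> set K -> int & forall J, Inv R J ->
    dsum alpha Q (phi J) /\ psi (phi J) = nu R v J}.
  apply: (@choice _ _ (fun J f => Inv R J -> dsum alpha Q f /\ psi f = nu R v J)) => J.
  have [iJ|nJ] := pselect (Inv R J); last by exists (fun _ _ => 0).
  have [|f Sf fE] := p3 (nu R v J); first by exists J.
  by exists f.
exists phi; split; [|split; [|split]].
- by move=> J /phiP [].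
- move=> J J' iJ iJ' e; apply: (nu_inj sR vR iJ iJ').
  by rewrite -(phiP J iJ).2 -(phiP J' iJ').2 e.
- move=> f Sf; have [J iJ JE] := p1 f Sf; exists J; split=> //.
  have [Sp pE] := phiP J iJ; apply: p2 => //.
  by rewrite pE.
- move=> J J' iJ iJ'; have iP := Inv_prod sR iJ iJ'.
  have [S1 e1] := phiP J iJ; have [S2 e2] := phiP J' iJ'; have [S3 e3] := phiP _ iP.
  have S12 : dsum alpha Q (phi J + phi J') by apply: sgrpD => //; exact: sgrp_dsum.
  apply: (p2 _ (phi J + phi J')) => //.
  by rewrite e3 p4 // e1 e2; apply/funext => M; rewrite nu_prod.
Qed.
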